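(* Let $\{B^H(t):t\in[0,1]\}$ be a $d$-dimensional fractional Brownian motion with Hurst index $H\in(0,1)$, let $f:[0,1]\to\mathbb{R}^d$ be a bounded Borel measurable function and let $E\subset\mathbf{I}$ be a Borel set. Then: (i) If $\mathcal{C}_{\rho_{\mathbf{d}_H}}^{d}(Gr_E(f))>0$, then $\lambda_d\big((B^H+f)(E)\big)>0$ with positive probability. (ii) If $\mathcal{H}_{\rho_{\mathbf{d}_H}}^{d}(Gr_E(f))=0$, then $\lambda_d\big((B^H+f)(E)\big)=0$ almost surely.
   Context: $\mathbf{I}=[a,b]$ with fixed $0<a<b\le 1$; $\lambda_d$ is Lebesgue measure on $\mathbb{R}^d$. A real fractional Brownian motion $B_0^H$ is a centered Gaussian process with continuous paths and covariance $\frac12(|t|^{2H}+|s|^{2H}-|t-s|^{2H})$; $B^H$ has $d$ independent copies of $B_0^H$ as components and is defined on a complete probability space $(\Omega,\mathcal{F},\mathbb{P})$. $Gr_E(f)=\{(t,f(t)):t\in E\}\subset\mathbb{R}_+\times\mathbb{R}^d$. The parabolic metric on $\mathbb{R}_+\times\mathbb{R}^d$ is $\rho_{\mathbf{d}_H}((s,x),(t,y))=\max\{|t-s|^H,\|x-y\|\}$. For a metric space $(\mathscr{X},\rho)$, $G\subset\mathscr{X}$ and $\beta>0$: $\mathcal{H}_\rho^\beta(G)=\lim_{\delta\to0}\inf\{\sum_{n}(2r_n)^\beta: G\subseteq\bigcup_{n} B_\rho(r_n),\ r_n\le\delta\}$, where $B_\rho(r)$ denotes an open ball of radius $r$; and $\mathcal{C}_\rho^\beta(G)=\big[\inf_{\mu\in\mathcal{P}(G)}\iint\rho(u,v)^{-\beta}\mu(du)\mu(dv)\big]^{-1}$,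 where $\mathcal{P}(G)$ is the set of (Borel) probability measures carried by $G$ (with $0^{-\beta}=\infty$, $1/\infty=0$, $\inf\emptyset=\infty$). *)

(* Defs.v *)
From HB Require Import structures.
From mathcomp Require Import all_boot all_order all_algebra.
From mathcomp Require Import all_classical all_reals all_analysis.
Set Implicit Arguments.
Unset Strict Implicit.
Unset Printing Implicit Defensive.
Import Order.TTheory GRing.Theory Num.Theory.
Import numFieldNormedType.Exports.
Local Open Scope classical_set_scope.
Local Open Scope ring_scope.

HB.instance Definition _ (T U : ptopologicalType) :=
  Pointed.on (T * U)%type.

(* [borel T] is the topological space T with its Borel sigma-algebra. *)
Definition borel (T : ptopologicalType) := g_sigma_algebraType (@open T).

(* The library's norm on 'rV[R]_d is the sup norm. *)
Definition enorm (R : realType) (d : nat) (x : 'rV[R]_d) : R :=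
  Num.sqrt (\sum_(i < d) x 0 i ^+ 2).

Section LebesgueMeasure.
Variables (R : realType) (d : nat).

Definition box (l u : 'rV[R]_d) : set 'rV[R]_d :=
  [set x | forall i, l 0 i < x 0 i <= u 0 i].

(* Defined on all subsets of R^d as the outer measure, which on the
   Lebesgue-measurable sets (in particular on the analytic sets, such as the
   image of a Borel set by a Borel map) is the Lebesgue measure. *)
Definition lebesgue_rV (A : set 'rV[R]_d) : \bar R :=
  ereal_inf [set S | exists l u : nat -> 'rV[R]_d,
    [/\ forall n i, l n 0 i <= u n 0 i,
        A `<=` \bigcup_n box (l n) (u n) &
        S = (\sum_(0 <= n <oo) (\prod_(i < d) (u n 0 i - l n 0 i))%:E)%E]].

End LebesgueMeasure.

(* The metric space is the subset X of the ambient type T, with metric rho. *)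
Section HausdorffMeasure.
Variables (R : realType) (T : Type) (X : set T) (rho : T -> T -> R).

Definition rho_ball (c : T) (r : R) : set T := X `&` [set y | rho c y < r].

(* A ball of radius 0 is empty, so finite covers are included. *)
Definition hausdorff_content (beta delta : R) (G : set T) : \bar R :=
  ereal_inf [set S | exists (c : nat -> T) (r : nat -> R),
    [/\ forall n, X (c n) /\ 0 <= r n <= delta,
        G `<=` \bigcup_n rho_ball (c n) (r n) &
        S = (\sum_(0 <= n <oo) ((2 * r n) `^ beta)%:E)%E]].

Definition hausdorff_measure (beta : R) (G : set T) : \bar R :=
  lim (hausdorff_content beta delta G @[delta --> 0^'+]).

End HausdorffMeasure.

(* rho is meant to be a metric inducing the topology of T, so that [borel T]
   carries the Borel sets of rho. *)
Section Capacity.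
Local Open Scope ereal_scope.
Variables (R : realType) (T : ptopologicalType) (rho : T -> T -> R).

(* The library's inverse on \bar R satisfies 0^-1 = +oo and +oo^-1 = 0. *)
Definition energy (beta : R) (mu : probability (borel T) R) : \bar R :=
  \int[mu]_u \int[mu]_v ((rho u v `^ beta)%:E)^-1.

Definition capacity (beta : R) (G : set T) : \bar R :=
  (ereal_inf [set energy beta mu |
     mu in [set mu : probability (borel T) R | mu.-negligible (~` G)]])^-1.

End Capacity.

Section Parabolic.
Variables (R : realType) (d : nat).

Definition half_space : set (R * 'rV[R]_d) := [set p | 0 <= p.1].

Definition parabolic (H : R) (p q : R * 'rV[R]_d) : R :=
  Num.max (`|q.1 - p.1| `^ H) (enorm (p.2 - q.2)).

Definition graph_on (E : set R) (f : R -> 'rV[R]_d) : set (R * 'rV[R]_d) :=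
  [set (t, f t) | t in E].

End Parabolic.

Section Processes.
Context (dO : measure_display) (Omega : measurableType dO) (R : realType).
Variable P : probability Omega R.

(* Constants are Gaussian; [normal_prob m 0] is not a point mass. *)
Definition gaussian_rv (Y : Omega -> R) : Prop :=
  measurable_fun setT Y /\
  exists m s : R, forall A : set R, measurable A ->
    P (Y @^-1` A) = if s == 0 then \d_m A else normal_prob m s A.

(* [I] is the set of times of the process. *)
Definition gaussian_process (I : set R) (X : R -> Omega -> R) : Prop :=
  forall (n : nat) (t c : 'I_n -> R), (forall i, I (t i)) ->
    gaussian_rv (fun w => \sum_(i < n) c i * X (t i) w).

Definition real_fbm (I : set R) (H : R) (X : R -> Omega -> R) : Prop :=
  [/\ gaussian_process I X,
      forall t, I t -> ('E_P[X t] = 0)%E,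
      forall s t, I s -> I t -> covariance P (X s) (X t) =
        ((`|t| `^ (2 * H) + `|s| `^ (2 * H) - `|t - s| `^ (2 * H)) / 2)%:E &
      forall w, {within I, continuous (fun t => X t w)}].

Definition process_sigma_algebra (I : set R) (X : R -> Omega -> R) :
    set (set Omega) :=
  <<s [set A | exists2 t, I t &
         exists2 S : set R, measurable S & A = X t @^-1` S] >>.

Definition independent_processes (I : set R) (d : nat)
    (X : 'I_d -> R -> Omega -> R) : Prop :=
  forall A : 'I_d -> set Omega,
    (forall i, process_sigma_algebra I (X i) (A i)) ->
    P (\bigcap_i A i) = (\prod_(i < d) P (A i))%E.

Definition fbm (I : set R) (H : R) (d : nat) (B : R -> Omega -> 'rV[R]_d) :
    Prop :=
  (forall i : 'I_d, real_fbm I H (fun t w => B t w 0 i)) /\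
  independent_processes I (fun i t w => B t w 0 i).

End Processes.

(* Main.v *)
(** (i) Let mu have finite energy and be carried by the graph, and let K be a
    compact subset of the graph with mu K >= 1/2. A Gaussian increment satisfies
    P(|B_s - B_t + z| < h) <= C h^d max(|t - s|^H, |z|)^-d, so the expected
    (mu x mu)-mass of the pairs of points of K whose images lie within h of each
    other is at most C h^d times the energy. By Cauchy-Schwarz, (mu K)^2 is at
    most this mass times the number of grid cells of side h that the image of K
    meets; hence with probability at least 1/2 the total volume of these cells
    is bounded below for infinitely many h, which forces the compact image to
    have positive measure. Choquet's capacitability argument, applied to
    A |-> E^*[min(1, lambda_d^*(image of A))] and to mu, gives the measurability
    of the event and the compact set K.

    (ii) By dyadic chaining, the oscillation of B over the time span of a
    parabolic ball of radius r has a d-th moment of order r^d. A cover of the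
    graph by balls of radii r_n therefore covers the image by boxes of expected
    total volume at most C sum_n r_n^d. *)
Require Import Defs.
From HB Require Import structures.
From mathcomp Require Import all_boot all_order all_algebra.
From mathcomp Require Import all_classical all_reals all_analysis.
From mathcomp Require Import ring lra zify measurable_realfun.
Import Order.TTheory GRing.Theory Num.Theory.
Import numFieldNormedType.Exports.
Set Implicit Arguments.
Unset Strict Implicit.
Unset Printing Implicit Defensive.
Local Open Scope classical_set_scope.
Local Open Scope ring_scope.

(** * Analytic sets and capacitability *)

(** Two obstacles shape the proof: [f] is only Borel, so [B + f] has no continuity, and the image of
    a Borel set under a random map gives an event that is not evidently measurable. Both are met by
    writing the image of [E] as the image of its graph under [path_field], (t, x) |-> B_t + x, which
    is continuous in (t, x) for every outcome. The roughness of [f] then sits only in the graph, an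
    analytic subset of a compact slab because [f] is bounded. On closed subsets of the slab the
    measure of the image is a random variable; capacitability carries this to the graph up to a null
    set, which the completeness of [P] absorbs. In (ii) the chaining series is controlled by moments
    of even order 2q, with q large enough to beat the number of mesh points however small H is. The
    inequality x^d <= r^d + r^(d-2q) x^(2q) then returns to order d. The measure of the image is
    treated there through its outer integral, which is shown to vanish. *)

Section Analytic.
Context {T : topologicalType}.
Implicit Types (A : set T) (Phi : (nat -> nat) -> set T).

Definition prefix_union Phi (m : nat -> nat) (k : nat) : set T :=
  \bigcup_(m' in [set m' | forall i, (i < k)%N -> (m' i <= m i)%N]) Phi m'.

(* A Souslin-type presentation: [prefix_union Phi m k] collects the points
   reached once the first k bounds are chosen, and the second clause keeps the
   set obtained in the limit inside A. *)
Definition analytic A := exists Phi, A = \bigcup_m Phi m /\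
  forall m, \bigcap_k closure (prefix_union Phi m k) `<=` A.

Lemma analytic_closed A : closed A -> analytic A.
Proof.
move=> cA; exists (fun=> A); split.
  by apply/seteqP; split => [x Ax|x [m _]//]; exists (fun=> 0%N).
move=> m x /(_ 0%N I); rewrite {2}(closure_id A).1//.
by apply: closureS => y [].
Qed.

Lemma closure_bigcup_lt (S : nat -> set T) n :
  closure (\bigcup_(j in `I_n) S j) `<=` \bigcup_(j in `I_n) closure (S j).
Proof.
elim: n => [|n IH].
  by rewrite !II0 !bigcup_set0 closure0.
rewrite !IIS !bigcup_setU !bigcup_set1 closureU; exact: setSU.
Qed.

(** The first entry of the sequence selects the index n. Bounding that entry leaves finitely many
    indices, and closure commutes with finite unions; a point outside every [A j] is excluded at
    some stage [k j] for each of them, hence at the stage after the largest of these. *)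
Lemma analytic_bigcup (A : nat -> set T) :
  (forall n, analytic (A n)) -> analytic (\bigcup_n A n).
Proof.
move=> /choice[Phi PhiA].
exists (fun m => Phi (m 0%N) (fun i => m i.+1)); split.
  apply/seteqP; split => [x [n _]|x [m _ mx]].
    rewrite (PhiA n).1 => -[m _ mx].
    by exists (fun i => if i is j.+1 then m j else n).
  by exists (m 0%N) => //; rewrite (PhiA _).1; eexists; last exact: mx.
move=> m x mx; apply: contrapT => nAx.
pose mS i := m i.+1.
have /choice[k kx] : forall j, exists k,
    ~ closure (prefix_union (Phi j) mS k) x.
  move=> j; apply: contrapT => /forallNP H; apply: nAx; exists j => //.
  by apply: ((PhiA j).2 mS) => k _; apply: contrapT.
pose K := (\max_(j < (m 0%N).+1) k j)%N.
have := mx K.+1 I.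
have sub : prefix_union (fun m0 => Phi (m0 0%N) (fun i => m0 i.+1)) m K.+1
    `<=` \bigcup_(j in `I_(m 0%N).+1) prefix_union (Phi j) mS (k j).
  move=> y [m' /= m'm my].
  have lt0 : (m' 0%N < (m 0%N).+1)%N by rewrite ltnS m'm.
  exists (m' 0%N) => //.
  exists (fun i => m' i.+1) => //= i ik; apply: m'm; rewrite ltnS.
  apply: (leq_trans ik); exact: (leq_bigmax (Ordinal lt0)).
move=> /(closureS sub)/closure_bigcup_lt[j _]; exact: kx.
Qed.

(** One sequence encodes a sequence for every n through [pickle], and any k entries of the n-th one
    are already bounded by a finite prefix of the code. *)
Lemma analytic_bigcap (A : nat -> set T) :
  (forall n, analytic (A n)) -> analytic (\bigcap_n A n).
Proof.
move=> /choice[Phi PhiA].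
pose sub (m : nat -> nat) (n i : nat) := m (pickle (n, i)).
exists (fun m => \bigcap_n Phi n (sub m n)); split.
  apply/seteqP; split => [x Ax|x [m _ mx] n _]; last first.
    by rewrite (PhiA n).1; exists (sub m n) => //; exact: mx.
  have /choice[m mx] : forall n, exists m, Phi n m x.
    by move=> n; have := Ax n I; rewrite (PhiA n).1 => -[m _ ?]; exists m.
  exists (fun k => if unpickle k is Some (n, i) then m n i else 0%N) => //.
  move=> n _; rewrite (_ : sub _ n = m n)//.
  by apply/funext => i; rewrite /sub pickleK.
move=> m x mx n _; apply: ((PhiA n).2 (sub m n)) => k _.
have := mx (\max_(i < k) (pickle (n, nat_of_ord i)).+1)%N I.
apply: closureS => y [m' /= m'm my]; exists (sub m' n); last exact: my.
move=> i ik /=; apply: m'm.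
exact: (leq_bigmax (Ordinal ik)).
Qed.

Lemma analytic_bigcap_count (I : countType) (A : I -> set T) :
  (forall i, analytic (A i)) -> analytic (\bigcap_i A i).
Proof.
move=> anA.
rewrite (_ : \bigcap_i A i =
  \bigcap_n (if unpickle n is Some i then A i else setT)).
  apply: analytic_bigcap => n; case: unpickle => [i|]; first exact: anA.
  by apply: analytic_closed; exact: closedT.
apply/seteqP; split => [x Ax n _|x Ax i _].
  by case: unpickle => // i; exact: Ax.
by have := Ax (pickle i) Logic.I; rewrite pickleK.
Qed.

Lemma analyticU A B : analytic A -> analytic B -> analytic (A `|` B).
Proof. by move=> ? ?; rewrite -bigcup2E; apply: analytic_bigcup => -[|[|n]] //=;
  apply: analytic_closed; exact: closed0. Qed.

Lemma analyticI A B : analytic A -> analytic B -> analytic (A `&` B).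
Proof. by move=> ? ?; rewrite -bigcap2E; apply: analytic_bigcap => -[|[|n]] //=;
  apply: analytic_closed; exact: closedT. Qed.

(** Choquet's argument: continuity from below allows the bounds to be chosen one at a time while the
    capacity stays above c. The closures of the resulting prefix unions decrease to a closed subset
    of A, and continuity from above, assumed only along closed subsets of X, keeps its capacity at
    least c. *)
Lemma capacitability (R : realType) (C : set T -> \bar R) (X A : set T)
    (c : \bar R) :
  {homo C : A B / A `<=` B >-> (A <= B)%E} ->
  (forall (S : nat -> set T) (e : \bar R), nondecreasing_seq S ->
     (e < C (\bigcup_n S n))%E -> exists n, (e < C (S n))%E) ->
  (forall (F : nat -> set T) (e : \bar R), nonincreasing_seq F ->
     (forall n, closed (F n) /\ F n `<=` X) ->
     (forall n, (e <= C (F n))%E) -> (e <= C (\bigcap_n F n))%E) ->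
  closed X -> A `<=` X -> analytic A -> (c < C A)%E ->
  exists F, [/\ closed F, F `<=` A & (c <= C F)%E].
Proof.
move=> Cmono Cbelow Cabove cX AX [Phi [AE PhiA]] cA.
pose upd (m : nat -> nat) (k v i : nat) := if i == k then v else m i.
have step m k : (c < C (prefix_union Phi m k))%E ->
    exists v, (c < C (prefix_union Phi (upd m k v) k.+1))%E.
  move=> cm; apply: (Cbelow (fun v => prefix_union Phi (upd m k v) k.+1)).
    move=> v v' vv'; rewrite /subsetP; apply/subsetPset => x [m' /= m'm mx].
    exists m' => //= i ik; apply: (leq_trans (m'm _ ik)).
    by rewrite /upd; case: ifP.
  apply: (lt_le_trans cm); apply: Cmono => x [m' /= m'm mx].
  exists (m' k) => //; exists m' => //= i; rewrite ltnS /upd.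
  by case: eqVneq => [->//|ik ik']; apply: m'm; rewrite ltn_neqAle ik.
have /choice[v vP] : forall mk : (nat -> nat) * nat, exists v,
    (c < C (prefix_union Phi mk.1 mk.2))%E ->
    (c < C (prefix_union Phi (upd mk.1 mk.2 v) mk.2.+1))%E.
  move=> [m k] /=; have [/step[v ?]|_] := boolP (c < _)%E; first by exists v.
  by exists 0%N.
pose M := fix M k := if k is k'.+1 then upd (M k') k' (v (M k', k'))
  else fun=> 0%N.
have MP k : (c < C (prefix_union Phi (M k) k))%E.
  elim: k => [|k /(vP (_, _))//].
  apply: (lt_le_trans cA); apply: Cmono; rewrite AE => x [m _ mx].
  by exists m.
(* Stage k.+1 fixes entry k and no later stage changes it, so the diagonal sequence agrees with
   [M k] below k. *)
pose m k := M k.+1 k.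
have MS k i : (i < k)%N -> M k i = m i.
  elim: k => // k IH; rewrite ltnS leq_eqVlt => /orP[/eqP->//|ik].
  by rewrite -IH//= /upd ltn_eqF.
have cm k : (c < C (prefix_union Phi m k))%E.
  apply: (lt_le_trans (MP k)); apply: Cmono => x [m' /= m'm mx].
  by exists m' => //= i ik; rewrite -(MS k)// m'm.
have PX k : closure (prefix_union Phi m k) `<=` X.
  rewrite (closure_id X).1//; apply: closureS.
  by apply: subset_trans AX; rewrite AE => x [m' _ mx]; exists m'.
exists (\bigcap_k closure (prefix_union Phi m k)); split.
- by apply: closed_bigI => k _; exact: closed_closure.
- exact: PhiA.
- apply: Cabove.
  + move=> k k' kk'; apply/subsetPset; apply: closureS => x [m' /= m'm mx].
    by exists m' => //= i ik; apply: m'm; exact: leq_trans kk'.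
  + by move=> k; split; [exact: closed_closure|exact: PX].
  + move=> k; apply/ltW/(lt_le_trans (cm k))/Cmono; exact: subset_closure.
Qed.

End Analytic.

(** * Lebesgue outer measure *)

Lemma nneseries_pairing (R : realType) : exists f : nat -> nat * nat,
  (forall ij, exists k, f k = ij) /\
  forall a : nat -> nat -> \bar R, (forall i j, (0 <= a i j)%E) ->
    (\sum_(k <oo) a (f k).1 (f k).2 = \sum_(i <oo) \sum_(j <oo) a i j)%E.
Proof.
have /card_esym/ppcard_eqP[f] := card_nat2.
exists f; split; first by move=> ij; exists (f^-1%FUN ij); rewrite invK ?inE.
move=> a a0; pose a' ij := a ij.1 ij.2.
transitivity (\esum_(ij in [set: nat * nat]) a' ij)%E.
  rewrite nneseries_esumT//.
  by rewrite (@reindex_esum R nat (nat * nat)%type setT setT f a').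
rewrite nneseries_esumT; last by move=> i; exact: nneseries_ge0.
under [RHS]eq_esum do rewrite nneseries_esumT//.
rewrite esum_esum//; congr esum.
by apply/seteqP; split.
Qed.

(** The hulls of the A n need not increase. The intersections of all later hulls do, still contain A
    n, and are no larger than the hull of A n; continuity from below for measurable sets applies to
    them. *)
Lemma outer_measure_nondecreasing (R : realType) (T : pointedType)
    (mu : {outer_measure set T -> \bar R}) :
  (forall A, exists U, [/\ mu.-cara.-measurable U, A `<=` U & (mu U <= mu A)%E]) ->
  forall (A : nat -> set T) c, nondecreasing_seq A ->
    (c < mu (\bigcup_n A n))%E -> exists n, (c < mu (A n))%E.
Proof.
move=> hull A c Amono; apply: contraPP => /forallNP Ac; apply/negP; rewrite -leNgt.
have {}Ac n : (mu (A n) <= c)%E by rewrite leNgt; apply/negP.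
have /choice[U UP] := fun n => hull (A n).
pose W n := \bigcap_(m in [set m | (n <= m)%N]) U m.
have mW n : mu.-cara.-measurable (W n).
  by apply: bigcap_measurable => [|m _]; [exists n => /=|case: (UP m)].
apply: (@le_trans _ _ (mu (\bigcup_n W n))).
  apply: le_outer_measure => x [n _ nx]; exists n => // m /= nm.
  by case: (UP m) => _ + _; apply; move: nx; apply/subsetPset/Amono.
have Wmono : nondecreasing_seq W.
  by move=> n n' nn'; apply/subsetPset => x Wx m /= nm; apply: Wx; exact: leq_trans nm.
have : mu \o W @ \oo --> mu (\bigcup_n W n).
  apply: (@nondecreasing_cvg_mu _ (caratheodory_type mu)) => //.
  exact: bigcup_measurable.
move=> /cvg_lim <-//; apply: lime_le.
  apply: ereal_nondecreasing_is_cvgn => n m nm; apply: le_outer_measure.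
  exact/subsetPset/Wmono.
apply: nearW => n; apply: le_trans (Ac n); case: (UP n) => _ _; apply: le_trans.
by apply: le_outer_measure => x; apply => /=.
Qed.

Section LebesgueOuter.
Context {R : realType} {d : nat}.
Implicit Types (l u x : 'rV[R]_d) (A : set 'rV[R]_d).

Definition vol l u := \prod_(i < d) (u 0 i - l 0 i).

Lemma vol_ge0 l u : (forall i, l 0 i <= u 0 i) -> 0 <= vol l u.
Proof. by move=> lu; apply: prodr_ge0 => i _; rewrite subr_ge0. Qed.

Lemma lebesgue_rV_ge0 A : (0 <= lebesgue_rV A)%E.
Proof.
apply: le_ereal_inf_tmp => _ [l [u [lu _ ->]]]; apply: nneseries_ge0 => n _ _.
by rewrite lee_fin; exact: vol_ge0.
Qed.

Lemma le_lebesgue_rV : {homo @lebesgue_rV R d : A B / A `<=` B >-> (A <= B)%E}.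
Proof.
move=> A B AB; apply: ereal_inf_le_tmp => _ [l [u [lu Blu ->]]].
by exists l, u; split => //; exact: subset_trans Blu.
Qed.

Lemma lebesgue_rV_lt A c : (lebesgue_rV A < c)%E ->
  exists l u : nat -> 'rV[R]_d, [/\ forall n i, l n 0 i <= u n 0 i,
    A `<=` \bigcup_n box (l n) (u n) &
    (\sum_(n <oo) (vol (l n) (u n))%:E < c)%E].
Proof. by move=> /ereal_inf_lt[_ [l [u [lu Alu ->]]] ?]; exists l, u. Qed.

Lemma lebesgue_rV_le_cover A (l u : nat -> 'rV[R]_d) :
  (forall n i, l n 0 i <= u n 0 i) -> A `<=` \bigcup_n box (l n) (u n) ->
  (lebesgue_rV A <= \sum_(n <oo) (vol (l n) (u n))%:E)%E.
Proof. by move=> lu Alu; apply: ereal_inf_lbound; exists l, u. Qed.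

Definition setc x i v : 'rV[R]_d := \row_j (if j == i then v else x 0 j).

Lemma vol_setc_l l u i v : vol (setc l i v) u =
  (u 0 i - v) * \prod_(j < d | j != i) (u 0 j - l 0 j).
Proof.
rewrite /vol (bigD1 i)//= mxE eqxx; congr (_ * _).
by apply: eq_bigr => j /negbTE ji; rewrite mxE ji.
Qed.

Lemma vol_setc_r l u i v : vol l (setc u i v) =
  (v - l 0 i) * \prod_(j < d | j != i) (u 0 j - l 0 j).
Proof.
rewrite /vol (bigD1 i)//= mxE eqxx; congr (_ * _).
by apply: eq_bigr => j /negbTE ji; rewrite mxE ji.
Qed.

(** The hyperplane cuts every box of a cover into two boxes whose volumes add up to that of the box.
    This is the Caratheodory criterion for half-spaces, from which boxes follow. *)
Lemma lebesgue_rV_halfspace (X : set 'rV[R]_d) i c :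
  (lebesgue_rV (X `&` [set x : 'rV[R]_d | (x 0 i <= c)%R]) +
   lebesgue_rV (X `&` ~` [set x : 'rV[R]_d | (x 0 i <= c)%R]) <=
   lebesgue_rV X)%E.
Proof.
apply: le_ereal_inf_tmp => _ [l [u [lu Xlu ->]]].
(* Clamping c to the i-th side keeps both pieces ordered when the hyperplane misses the box; one of
   them is then degenerate. *)
pose m n := Order.max (l n 0 i) (Order.min (u n 0 i) c).
have ml n : l n 0 i <= m n by rewrite le_max lexx.
have mu n : m n <= u n 0 i by rewrite ge_max lu ge_min lexx.
have lu1 n j : l n 0 j <= setc (u n) i (m n) 0 j.
  by rewrite mxE; case: eqVneq => [->|].
have lu2 n j : setc (l n) i (m n) 0 j <= u n 0 j.
  by rewrite mxE; case: eqVneq => [->|].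
have := @lebesgue_rV_le_cover (X `&` [set x | x 0 i <= c]) l
  (fun n => setc (u n) i (m n)) lu1.
have := @lebesgue_rV_le_cover (X `&` ~` [set x | x 0 i <= c])
  (fun n => setc (l n) i (m n)) u lu2.
move=> c2 c1.
apply: (@le_trans _ _ ((\sum_(n <oo) (vol (l n) (setc (u n) i (m n)))%:E) +
  \sum_(n <oo) (vol (setc (l n) i (m n)) (u n))%:E)%E).
  apply: leeD; [apply: c1|apply: c2] => x [/Xlu[n _ /= xn]].
    move=> xc; exists n => // j; have := xn j; rewrite mxE.
    case: eqVneq => [->|//] /andP[lx xu].
    by rewrite lx /m le_max le_min xu xc orbT.
  move=> /negP; rewrite -ltNge => xc; exists n => // j.
  have := xn j; rewrite mxE; case: eqVneq => [->|//] /andP[lx xu].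
  by rewrite xu andbT /m gt_max lx gt_min xc orbT.
rewrite -nneseriesD; last 2 first.
- by move=> n _ _; rewrite lee_fin vol_ge0.
- by move=> n _ _; rewrite lee_fin vol_ge0.
apply: lee_nneseries => n _ *.
  by rewrite adde_ge0 ?lee_fin ?vol_ge0.
rewrite -EFinD lee_fin vol_setc_l vol_setc_r [leRHS](bigD1 i)//= -mulrDl.
by rewrite (_ : m n - _ + _ = u n 0 i - l n 0 i)//; ring.
Qed.

End LebesgueOuter.


Section LebesgueOuterS.
Context {R : realType} {d : nat}.
Let V := 'rV[R]_d.+1.
Implicit Types (l u x : V) (A : set V).

(** Degenerate boxes pad finite covers to sequences. This fails in dimension 0, where the empty
    product gives every box volume 1; hence the dimension [d.+1] from here on. *)
Lemma volxx l : vol l l = 0.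
Proof. by rewrite /vol big_ord_recl subrr mul0r. Qed.

Lemma lebesgue_rV0 : lebesgue_rV (set0 : set V) = 0%E.
Proof.
apply/eqP; rewrite eq_le lebesgue_rV_ge0 andbT.
apply: (le_trans (@lebesgue_rV_le_cover _ _ _ (fun=> 0) (fun=> 0) _ _)) => //.
by rewrite eseries0// => n _ _; rewrite volxx.
Qed.

Lemma lebesgue_rV_box l u : (forall i, l 0 i <= u 0 i) ->
  (lebesgue_rV (box l u) <= (vol l u)%:E)%E.
Proof.
move=> lu; pose u' n := if n is 0%N then u else l.
apply: (le_trans (@lebesgue_rV_le_cover _ _ _ (fun=> l) u' _ _)).
- by case.
- by move=> x ?; exists 0%N.
- rewrite nneseries_recl//=; last first.
    by move=> [|n]; rewrite lee_fin ?volxx// vol_ge0.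
  by rewrite eseries_cond eseries0 ?adde0// => -[//|n] _ _ /=; rewrite volxx.
Qed.

Lemma lebesgue_rV_sigma_subadditive : sigma_subadditive (@lebesgue_rV R d.+1).
Proof.
move=> A; have [[i ioo]|] := pselect (exists i, lebesgue_rV (A i) = +oo%E).
  rewrite (eseries_pinfty _ _ ioo) ?leey// => n _.
  by rewrite -ltNye (lt_le_trans _ (lebesgue_rV_ge0 _)).
rewrite -forallNE => Aoo.
suff add2e (e : {posnum R}) :
    (lebesgue_rV (\bigcup_n A n) <=
     \sum_(i <oo) lebesgue_rV (A i) + e%:num%:E)%E.
  by apply/lee_addgt0Pr => _/posnumP[].
rewrite (le_trans _ (epsilon_trick _ _ _))//; last first.
  by move=> n; exact: lebesgue_rV_ge0.
have /choice[lu luP] : forall n, exists lu : (nat -> V) * (nat -> V),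
  [/\ forall k i, lu.1 k 0 i <= lu.2 k 0 i,
      A n `<=` \bigcup_k box (lu.1 k) (lu.2 k) &
      (\sum_(k <oo) (vol (lu.1 k) (lu.2 k))%:E <=
       lebesgue_rV (A n) + (e%:num / (2 ^ n.+1)%:R)%:E)%E].
  move=> n; have An : lebesgue_rV (A n) \is a fin_num.
    by rewrite ge0_fin_numE ?lebesgue_rV_ge0// ltey; apply/eqP.
  have : (lebesgue_rV (A n) <
      lebesgue_rV (A n) + (e%:num / (2 ^ n.+1)%:R)%:E)%E.
    by rewrite lteDl// lte_fin divr_gt0// ltr0n expn_gt0.
  by move=> /lebesgue_rV_lt[l [u [lu Alu /ltW ?]]]; exists (l, u).
have [f [fsurj fE]] := nneseries_pairing R.
apply: (le_trans (@lebesgue_rV_le_cover _ _ _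
  (fun k => (lu (f k).1).1 (f k).2) (fun k => (lu (f k).1).2 (f k).2) _ _)).
- by move=> k i; case: (luP (f k).1).
- move=> x [n _ nx]; case: (luP n) => _ /(_ _ nx)[k _ kx] _.
  by have [j fj] := fsurj (n, k); exists j; rewrite ?fj.
rewrite (fE (fun i j => (vol ((lu i).1 j) ((lu i).2 j))%:E)); last first.
  by move=> i j; rewrite lee_fin vol_ge0//; case: (luP i).
apply: lee_nneseries => n _; last by case: (luP n).
by move=> _; apply: nneseries_ge0 => k _ _; rewrite lee_fin vol_ge0//; case: (luP n).
Qed.

HB.instance Definition _ := isOuterMeasure.Build R V (@lebesgue_rV R d.+1)
  lebesgue_rV0 (@lebesgue_rV_ge0 R d.+1) (@le_lebesgue_rV R d.+1)
  lebesgue_rV_sigma_subadditive.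

Lemma cara_box l u : (@lebesgue_rV R d.+1).-cara.-measurable (box l u).
Proof.
have half i c : (@lebesgue_rV R d.+1).-cara.-measurable [set x : V | x 0 i <= c].
  by apply: le_caratheodory_measurable => X; exact: lebesgue_rV_halfspace.
rewrite (_ : box l u = \bigcap_(i in [set: 'I_d.+1])
    ([set x | x 0 i <= u 0 i] `\` [set x | x 0 i <= l 0 i])).
  apply: (@fin_bigcap_measurable _ (caratheodory_type (@lebesgue_rV R d.+1))) => //.
  by move=> i _; apply: measurableD; exact: half.
apply/seteqP; split => x xlu i; last first.
  by have [/= -> /negP] := xlu i I; rewrite -ltNge => ->.
move=> _; have /andP[lx xu] := xlu i; split => //=.
by apply/negP; rewrite -ltNge.
Qed.

Lemma lebesgue_rV_hull A : exists U, [/\ (@lebesgue_rV R d.+1).-cara.-measurable U,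
  A `<=` U & (lebesgue_rV U <= lebesgue_rV A)%E].
Proof.
have [Aoo|Aoo] := eqVneq (lebesgue_rV A) +oo%E.
  by exists setT; split => //; rewrite Aoo leey.
have Afin : lebesgue_rV A \is a fin_num.
  by rewrite ge0_fin_numE ?lebesgue_rV_ge0// ltey.
have /choice[lu luP] : forall n, exists lu : (nat -> V) * (nat -> V),
  [/\ forall k i, lu.1 k 0 i <= lu.2 k 0 i,
      A `<=` \bigcup_k box (lu.1 k) (lu.2 k) &
      (\sum_(k <oo) (vol (lu.1 k) (lu.2 k))%:E <
       lebesgue_rV A + (n.+1%:R^-1)%:E)%E].
  move=> n; have : (lebesgue_rV A < lebesgue_rV A + (n.+1%:R^-1)%:E)%E.
    by rewrite lteDl// lte_fin invr_gt0.
  by move=> /lebesgue_rV_lt[l [u [lu Alu ?]]]; exists (l, u).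
exists (\bigcap_n \bigcup_k box ((lu n).1 k) ((lu n).2 k)); split.
- apply: bigcap_measurable => // n _; apply: bigcup_measurable => k _.
  exact: cara_box.
- by move=> x Ax n _; case: (luP n) => _ /(_ _ Ax).
- apply/lee_addgt0Pr => e e0; have [n /ltW ne] := ltr_add_invr e0.
  have [lun _ /ltW sn] := luP n.
  apply: (@le_trans _ _ (lebesgue_rV (\bigcup_k box ((lu n).1 k) ((lu n).2 k)))).
    by apply: le_lebesgue_rV => x; exact.
  apply: (le_trans (lebesgue_rV_sigma_subadditive _)).
  apply: (@le_trans _ _ (lebesgue_rV A + (n.+1%:R^-1)%:E)%E); last first.
    by rewrite leeD2l// lee_fin -[leLHS]add0r.
  apply: le_trans sn; apply: lee_nneseries => k _ *.
    exact: lebesgue_rV_ge0.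
  exact: lebesgue_rV_box.
Qed.

Lemma lebesgue_rV_nondecreasing (A : nat -> set V) c : nondecreasing_seq A ->
  (c < lebesgue_rV (\bigcup_n A n))%E -> exists n, (c < lebesgue_rV (A n))%E.
Proof. exact: (outer_measure_nondecreasing lebesgue_rV_hull). Qed.

End LebesgueOuterS.

(** * Covers by boxes with rational corners *)

Section OpenBoxes.
Context {R : realType} {d : nat}.
Let V := 'rV[R]_d.+1.
Implicit Types (l u x : V) (A K : set V) (q : 'rV[rat]_d.+1 * 'rV[rat]_d.+1).

Definition open_box l u : set V := [set x | forall i, l 0 i < x 0 i < u 0 i].

Definition closed_box l u : set V := [set x | forall i, l 0 i <= x 0 i <= u 0 i].

Lemma open_open_box l u : open (open_box l u).
Proof.
rewrite openE => x lxu; apply: (@filter_forall _ _ _ (nbhs x)) => i.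
have : open ((fun y : V => y 0 i) @^-1` `]l 0 i, u 0 i[).
  apply: open_comp; last exact: itv_open.
  by move=> y _; exact: coord_continuous.
rewrite openE => /(_ x) /=; rewrite in_itv /= => /(_ (lxu i)).
by apply: filterS => y /=; rewrite in_itv.
Qed.

Lemma closed_closed_box l u : closed (closed_box l u).
Proof.
rewrite (_ : closed_box l u = \bigcap_i ((fun x => x 0 i) @^-1` `[l 0 i, u 0 i])).
  apply: closed_bigI => i _; apply: closed_comp; last exact: itv_closed.
  by move=> x _; exact: coord_continuous.
apply/seteqP; split => x lxu i; first by move=> _ /=; rewrite in_itv/=.
by have := lxu i I; rewrite /= in_itv/=.
Qed.

Lemma prod_addr_lt (n : nat) (a : 'I_n -> R) (e : R) : 0 < e ->
  exists2 t : R, 0 < t & \prod_(i < n) (a i + t) < \prod_(i < n) a i + e.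
Proof.
move=> e0.
have cont (r : seq 'I_n) : continuous (fun t : R => \prod_(i <- r) (a i + t)).
  elim: r => [|i r IH] t.
    by under eq_fun do rewrite big_nil; exact: cvg_cst.
  under eq_fun do rewrite big_cons.
  apply: cvgM; last exact: IH.
  by apply: cvgD; [exact: cvg_cst|exact: cvg_id].
have : \forall t \near (0 : R), \prod_(i < n) (a i + t) < \prod_(i < n) a i + e.
  have /cvgr_lt := cont (index_enum 'I_n) 0; apply.
  by under eq_bigr do rewrite addr0; rewrite ltrDl.
move=> /nbhs_ballP[r /= r0 H]; exists (r / 2); first by rewrite divr_gt0.
apply: H; rewrite /ball/= sub0r normrN gtr0_norm ?divr_gt0//.
by rewrite gtr_pMr// invf_lt1// ltr1n.
Qed.

(** Rational corners make the finite lists of boxes countable, so that an event of the form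
    [some finite cover is small] becomes a countable union in [measurable_image_lt]. *)
Definition ratv (q : 'rV[rat]_d.+1) : V := map_mx ratr q.

Lemma box_enlarge l u (e : R) : (forall i, l 0 i <= u 0 i) -> 0 < e -> exists q,
  (forall i, ratv q.1 0 i < l 0 i /\ u 0 i < ratv q.2 0 i) /\
  vol (ratv q.1) (ratv q.2) < vol l u + e.
Proof.
move=> lu e0; have [t t0 te] := prod_addr_lt (fun i => u 0 i - l 0 i) e0.
have t20 : 0 < t / 2 by rewrite divr_gt0.
have /choice[p pP] i : exists p : rat, ratr p \in `]l 0 i - t / 2, l 0 i[.
  by apply: rat_in_itvoo; rewrite ltrBlDr ltrDl.
have /choice[p' p'P] i : exists p : rat, ratr p \in `]u 0 i, u 0 i + t / 2[.
  by apply: rat_in_itvoo; rewrite ltrDl.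
exists (\row_i p i, \row_i p' i) => /=; split.
  move=> i; rewrite !mxE; have := pP i; have := p'P i.
  by rewrite !in_itv/= => /andP[-> _] /andP[_ ->].
apply: le_lt_trans te; apply: ler_prod => i _; rewrite !mxE.
have := pP i; have := p'P i; have := lu i.
by rewrite !in_itv/= => ? /andP[? ?] /andP[? ?]; lra.
Qed.

Lemma lebesgue_rV_closed_box l u : (forall i, l 0 i <= u 0 i) ->
  (lebesgue_rV (closed_box l u) <= (vol l u)%:E)%E.
Proof.
move=> lu; apply/lee_addgt0Pr => e e0.
have [q [qlu /ltW qe]] := box_enlarge lu e0.
have lq i : ratv q.1 0 i <= ratv q.2 0 i.
  by have [/ltW ql /ltW uq] := qlu i; rewrite (le_trans ql)// (le_trans _ uq).
apply: (@le_trans _ _ (vol (ratv q.1) (ratv q.2))%:E); last first.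
  by rewrite -EFinD lee_fin.
apply: le_trans (lebesgue_rV_box lq); apply: le_lebesgue_rV => x lxu i.
have [ql uq] := qlu i; have /andP[lx xu] := lxu i.
by rewrite (lt_le_trans ql)// ltW// (le_lt_trans xu).
Qed.

Lemma lebesgue_rV_open_cover A (c : R) : (lebesgue_rV A < c%:E)%E ->
  exists q : nat -> 'rV[rat]_d.+1 * 'rV[rat]_d.+1,
    [/\ forall n i, ratv (q n).1 0 i < ratv (q n).2 0 i,
        A `<=` \bigcup_n open_box (ratv (q n).1) (ratv (q n).2) &
        (\sum_(n <oo) (vol (ratv (q n).1) (ratv (q n).2))%:E < c%:E)%E].
Proof.
move=> /lebesgue_rV_lt[l [u [lu Alu sc]]].
set s := (X in (X < _)%E) in sc.
have v0 n : (0 <= (vol (l n) (u n))%:E)%E by rewrite lee_fin vol_ge0.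
have s0 : (0 <= s)%E by apply: nneseries_ge0 => n _ _; exact: v0.
have sfin : s \is a fin_num by rewrite ge0_fin_numE// (lt_trans sc)// ltry.
move: sc; rewrite -(fineK sfin) lte_fin => sc.
pose e := (c - fine s) / 2; have e0 : 0 < e by rewrite divr_gt0// subr_gt0.
have e2 n : 0 < e / (2 ^ n.+1)%:R by rewrite divr_gt0// ltr0n expn_gt0.
have /choice[q qP] n := box_enlarge (lu n) (e2 n).
have qlt n i : ratv (q n).1 0 i < ratv (q n).2 0 i.
  have [/(_ i)[ql uq] _] := qP n.
  by rewrite (lt_trans ql)// (le_lt_trans _ uq).
exists q; split => //.
  move=> x /Alu[n _ nx]; exists n => // i; have [/(_ i)[ql uq] _] := qP n.
  by have /andP[lx xu] := nx i; rewrite (lt_trans ql)//= (le_lt_trans xu).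
apply: (@le_lt_trans _ _ (s + e%:E)%E); last first.
  by rewrite -(fineK sfin) -EFinD lte_fin /e; lra.
apply: le_trans (epsilon_trick _ v0 (ltW e0)).
apply: lee_nneseries => n _ *; last by rewrite -EFinD lee_fin ltW//; case: (qP n).
by rewrite lee_fin vol_ge0// => i; exact/ltW.
Qed.

Lemma lebesgue_rV_outer_open A (c : R) : (lebesgue_rV A < c%:E)%E ->
  exists U : set V, [/\ open U, A `<=` U & (lebesgue_rV U < c%:E)%E].
Proof.
move=> /lebesgue_rV_open_cover[q [q12 Aq qc]].
exists (\bigcup_n open_box (ratv (q n).1) (ratv (q n).2)); split => //.
  by apply: bigcup_open => n _; exact: open_open_box.
apply: le_lt_trans qc; apply: lebesgue_rV_le_cover => [n i|x [n _ nx]].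
  exact/ltW.
by exists n => // i; have /andP[-> /ltW ->] := nx i.
Qed.

Lemma compact_lebesgue_rV_cover K (c : R) : compact K ->
  (lebesgue_rV K < c%:E)%E -> exists s : seq ('rV[rat]_d.+1 * 'rV[rat]_d.+1),
    [/\ forall q, q \in s -> forall i, ratv q.1 0 i < ratv q.2 0 i,
        forall x, K x -> exists2 q, q \in s & open_box (ratv q.1) (ratv q.2) x &
        \sum_(q <- s) vol (ratv q.1) (ratv q.2) < c].
Proof.
rewrite compact_cover => Kc /lebesgue_rV_open_cover[q [q12 Kq qc]].
have [D _ KD] := Kc nat setT _
  (fun n _ => @open_open_box (ratv (q n).1) (ratv (q n).2)) Kq.
pose N := (\max_(i <- finmap.enum_fset D) i).+1.
exists [seq q i | i <- iota 0 N]; split.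
- by move=> _ /mapP[n _ ->]; exact: q12.
- move=> x /KD[n nD nx]; exists (q n); last exact: nx.
  apply/mapP; exists n => //.
  by rewrite mem_iota /= add0n ltnS; apply: leq_bigmax_seq.
- rewrite big_map -lte_fin; apply: le_lt_trans qc; rewrite -sumEFin.
  rewrite -[X in iota 0 X]subn0 -/(index_iota 0 N); apply: nneseries_lim_ge.
  by move=> n _ _; rewrite lee_fin vol_ge0// => i; exact/ltW.
Qed.

Lemma lebesgue_rV_le_closed_boxes A (s : seq ('rV[rat]_d.+1 * 'rV[rat]_d.+1)) :
  (forall q, q \in s -> forall i, ratv q.1 0 i <= ratv q.2 0 i) ->
  (forall x, A x -> exists2 q, q \in s & closed_box (ratv q.1) (ratv q.2) x) ->
  (lebesgue_rV A <= (\sum_(q <- s) vol (ratv q.1) (ratv q.2))%:E)%E.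
Proof.
elim: s A => [|q s IH] A q12 Aq.
  rewrite big_nil (_ : A = set0) ?lebesgue_rV0//.
  by rewrite -subset0 => x /Aq[].
rewrite big_cons EFinD.
apply: (@le_trans _ _ (lebesgue_rV (closed_box (ratv q.1) (ratv q.2) `|`
    A `\` closed_box (ratv q.1) (ratv q.2)))).
  apply: le_lebesgue_rV => x Ax.
  by have [|] := pselect (closed_box (ratv q.1) (ratv q.2) x); [left|right].
apply: (le_trans (outer_measureU2 _ _ _)); apply: leeD.
  by apply: lebesgue_rV_closed_box; apply: q12; rewrite inE eqxx.
apply: IH => [q' q's|x [/Aq[q' + q'x] nqx]].
  by apply: q12; rewrite inE q's orbT.
by rewrite inE => /orP[/eqP q'q|]; [rewrite q'q in q'x|exists q'].
Qed.

End OpenBoxes.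

Lemma compact_bigcap_open (T : ptopologicalType) (F : nat -> set T) (U : set T) :
  compact (F 0%N) -> (forall n, closed (F n)) -> nonincreasing_seq F ->
  open U -> \bigcap_n F n `<=` U -> exists n, F n `<=` U.
Proof.
rewrite compact_cover => F0 Fc Fmono oU FU.
have [||D _ FD] := F0 nat setT (fun n => if n is n'.+1 then ~` F n' else U).
- by move=> [//|n] _; exact: closed_openC.
- move=> x F0x; have [Ux|nUx] := pselect (U x); first by exists 0%N.
  have /existsNP[n nFx] : ~ forall n, F n x by move=> Fx; apply/nUx/FU => n _.
  by exists n.+1.
exists (\max_(i <- finmap.enum_fset D) i)%N => x Fx.
have /FD[[//|n] nD /= nFx] : F 0%N x by move: Fx; exact/subsetPset/Fmono.
exfalso; apply: nFx; move: Fx; apply/subsetPset/Fmono.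
have : (n.+1 <= \max_(i <- finmap.enum_fset D) i)%N by apply: leq_bigmax_seq.
exact: ltnW.
Qed.

(** * Grid cells met by a compact set *)

Section Grid.
Context {R : realType} {d : nat}.
Let V := 'rV[R]_d.+1.
Implicit Types (l u x : V) (A K : set V).

Lemma size_uniq_int_box (n : nat) (t : seq 'rV[int]_n) (a : 'I_n -> int)
    (N : 'I_n -> nat) : uniq t ->
  (forall k, k \in t -> forall i, a i <= k 0 i < a i + (N i)%:Z) ->
  (size t <= \prod_(i < n) N i)%N.
Proof.
move=> ut tN; pose M := (\max_i N i)%N.
pose g (k : 'rV[int]_n) : {ffun 'I_n -> 'I_M.+1} :=
  [ffun i : 'I_n => inord (absz (k 0%R i - a i)%R)].
have lt k i : k \in t -> (absz (k 0%R i - a i)%R < N i)%N.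
  by move=> /tN /(_ i)/andP[ak kaN]; lia.
have ltM i j : (j < N i)%N -> (j < M.+1)%N.
  by move=> jN; apply: (ltn_trans jN); rewrite ltnS; exact: leq_bigmax.
have ginj : {in t &, injective g}.
  move=> k k' kt k't gE; apply/rowP => i.
  have := congr1 (fun f : {ffun 'I_n -> 'I_M.+1} => nat_of_ord (f i)) gE.
  rewrite !ffunE !inordK; try by apply: ltM (lt _ i _).
  have /andP[+ _] := tN k kt i; have /andP[+ _] := tN k' k't i.
  by move: (k 0 i) (k' 0 i) (a i) => x y z; lia.
rewrite -(size_map g) -(card_uniqP _); last by rewrite map_inj_in_uniq.
pose F (i : 'I_n) := [pred j : 'I_M.+1 | (j < N i)%N].
apply: (@leq_trans #|(family F : simpl_pred {ffun 'I_n -> 'I_M.+1})|).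
  apply: subset_leq_card; apply/fintype.subsetP => _ /mapP[k kt ->].
  apply/familyP => i; rewrite ffunE inE inordK; first exact: lt.
  exact: ltM (lt _ i kt).
rewrite card_family foldrE big_map big_enum /=; apply: leq_prod => i _.
rewrite cardE -(size_map val) -[leqRHS](size_iota 0); apply: uniq_leq_size.
  by rewrite map_inj_uniq ?enum_uniq//; exact: val_inj.
by move=> _ /mapP[j + ->]; rewrite mem_enum unfold_in mem_iota.
Qed.

Definition grid_cell (h : R) x : 'rV[int]_d.+1 := \row_i Num.floor (x 0 i / h).

(** In coordinate i the cell indices lie between the floors of the two ends, which leaves at most (u
    - l) / h + 2 integers; multiplying by h gives the added 2 * h. *)
Lemma grid_cell_open_box (h : R) l u (t : seq 'rV[int]_d.+1) : 0 < h ->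
  (forall i, l 0 i < u 0 i) -> uniq t ->
  (forall k, k \in t -> exists2 x, open_box l u x & grid_cell h x = k) ->
  (size t)%:R * h ^+ d.+1 <= \prod_(i < d.+1) (u 0 i - l 0 i + 2 * h).
Proof.
move=> h0 lu ut tlu.
pose a (i : 'I_d.+1) := Num.floor (l 0 i / h).
pose b (i : 'I_d.+1) := Num.floor (u 0 i / h).
have ab i : a i <= b i.
  by apply: le_floor; rewrite ler_pM2r ?invr_gt0// ltW.
pose N i := absz (b i - a i + 1).
have NE i : (N i)%:Z = b i - a i + 1 by have := ab i; rewrite /N; lia.
have st : (size t <= \prod_(i < d.+1) N i)%N.
  apply: (@size_uniq_int_box _ _ a) => // _ /tlu[x xlu <-] i.
  have /andP[/ltW lx /ltW xu] := xlu i.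
  have ax : a i <= grid_cell h x 0 i.
    by rewrite mxE; apply: le_floor; rewrite ler_pM2r ?invr_gt0.
  have xb : grid_cell h x 0 i <= b i.
    by rewrite mxE; apply: le_floor; rewrite ler_pM2r ?invr_gt0.
  by rewrite ax NE addrA addrCA subrr addr0 ltzD1.
apply: (@le_trans _ _ ((\prod_(i < d.+1) N i)%N%:R * h ^+ d.+1)).
  by rewrite ler_pM2r ?exprn_gt0// ler_nat.
rewrite natr_prod -[X in h ^+ X]card_ord -prodr_const -big_split /=.
apply: ler_prod => i _; apply/andP; split; first by rewrite mulr_ge0// ltW.
have -> : (N i)%:R = (b i)%:~R - (a i)%:~R + 1 :> R.
  by rewrite -[LHS]/((N i)%:Z%:~R) NE rmorphD rmorphB.
have := floor_itv (l 0 i / h); have := floor_itv (u 0 i / h).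
rewrite -/(a i) -/(b i) !rmorphD /= !ler_pdivlMr// !ltr_pdivrMr//.
by move=> /andP[? ?] /andP[? ?]; lra.
Qed.

(** Finitely many open boxes of total volume below c cover K. Enlarging each side by 2 * h bounds
    the volume of the occupied cells, and by continuity the total is still below c for small h. Its
    contrapositive turns many occupied cells at arbitrarily small scales into positive measure. *)
Lemma lebesgue_rV_grid K (c : R) : compact K -> (lebesgue_rV K < c%:E)%E ->
  exists2 e : R, 0 < e & forall h : R, 0 < h < e ->
    forall t : seq 'rV[int]_d.+1, uniq t ->
      (forall k, k \in t -> exists2 x, K x & grid_cell h x = k) ->
      (size t)%:R * h ^+ d.+1 <= c.
Proof.
move=> cK /(compact_lebesgue_rV_cover cK)[s [s12 Ks sc]].
pose F h := \sum_(q <- s) \prod_(i < d.+1) (ratv q.2 0 i - ratv q.1 0 i + 2 * h : R).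
have Fcont : continuous F.
  have cont1 q (r : seq 'I_d.+1) : continuous (fun h : R =>
      \prod_(i <- r) (@ratv R d q.2 0 i - ratv q.1 0 i + 2 * h)).
    elim: r => [|i r IH] t; first by under eq_fun do rewrite big_nil; exact: cvg_cst.
    under eq_fun do rewrite big_cons.
    apply: cvgM; last exact: IH.
    by apply: cvgD; [exact: cvg_cst|apply: cvgM; [exact: cvg_cst|exact: cvg_id]].
  rewrite /F; elim: (s) => [|q r IH] t.
    by under eq_fun do rewrite big_nil; exact: cvg_cst.
  under eq_fun do rewrite big_cons.
  by apply: cvgD; [exact: cont1|exact: IH].
have : \forall h \near (0 : R), F h < c.
  have /cvgr_lt := Fcont 0; apply.
  rewrite /F; under eq_bigr do under eq_bigr do rewrite mulr0 addr0.
  exact: sc.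
move=> /nbhs_ballP[e /= e0 Fe]; exists e => // h /andP[h0 he] t ut tK.
have {}Fe : F h < c.
  by apply: Fe; rewrite /ball/= sub0r normrN gtr0_norm.
apply/ltW/le_lt_trans/Fe; rewrite /F {Fe F Fcont}.
have {}tK k : k \in t -> exists2 q, q \in s &
    exists2 x, open_box (ratv q.1) (ratv q.2) x & grid_cell h x = k.
  by move=> /tK[x /Ks[q qs qx] xk]; exists q => //; exists x.
elim: s t ut tK s12 {Ks sc} => [|q s IH] t ut tK s12.
  by case: t ut tK => [|k t] _ tK; [rewrite big_nil mul0r|have [] := tK k (mem_head _ _)].
(* Each cell is charged to the first box that meets it: [p] selects the cells charged to q, the
   others go to the tail s. *)
pose p k := `[< exists2 x, open_box (ratv q.1) (ratv q.2) x & grid_cell h x = k >].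
rewrite big_cons -(count_predC p) natrD mulrDl; apply: lerD.
  rewrite -size_filter; apply: grid_cell_open_box => //.
  - by apply: s12; rewrite mem_head.
  - exact: filter_uniq.
  - by move=> k; rewrite mem_filter => /andP[/asboolP].
rewrite -size_filter; apply: IH.
- exact: filter_uniq.
- move=> k; rewrite mem_filter => /andP[/= /asboolP npk /tK[q' + q'k]].
  by rewrite inE => /orP[/eqP q'q|q's]; [exfalso; apply: npk; rewrite -q'q|exists q'].
- by move=> q' q's; apply: s12; rewrite inE q's orbT.
Qed.

(** A finite union of closed boxes is closed, so covering the image of a dense subset D covers the
    image of K. With D countable, the right-hand side involves countably many conditions on the
    values of phi. *)
Lemma compact_lebesgue_rV_ltP (T : topologicalType) (phi : T -> V)
    (K D : set T) (c : R) : continuous phi -> compact K -> D `<=` K ->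
  K `<=` closure D ->
  (lebesgue_rV (phi @` K) < c%:E)%E <->
  exists s : seq ('rV[rat]_d.+1 * 'rV[rat]_d.+1),
    [/\ forall q, q \in s -> forall i, @ratv R d q.1 0 i <= ratv q.2 0 i,
        \sum_(q <- s) @vol R d.+1 (ratv q.1) (ratv q.2) < c &
        forall p, D p -> exists2 q, q \in s &
          closed_box (ratv q.1) (ratv q.2) (phi p)].
Proof.
move=> cphi cK DK KD; split => [|[s [s12 sc Ds]]].
  have cphiK : compact (phi @` K).
    by apply: continuous_compact => //; exact: continuous_subspaceT.
  move=> /(compact_lebesgue_rV_cover cphiK)[s [s12 Ks sc]].
  exists s; split => // [q qs i|p /DK Kp]; first exact/ltW/s12.
  have [|q qs qp] := Ks (phi p); first by exists p.
  by exists q => // i; have /andP[/ltW -> /ltW ->] := qp i.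
apply: (@le_lt_trans _ _ (\sum_(q <- s) vol (ratv q.1) (ratv q.2))%:E); last first.
  by rewrite lte_fin.
apply: lebesgue_rV_le_closed_boxes => // _ [p /KD Dp <-].
pose C := \bigcup_(q in [set` s]) closed_box (@ratv R d q.1) (ratv q.2).
suff [q qs qp] : C (phi p) by exists q.
have Cc : closed (phi @^-1` C).
  apply: closed_comp => [x _|]; first exact: cphi.
  apply: closed_bigcup => [|q _]; first exact: finite_seq.
  exact: closed_closed_box.
suff : (phi @^-1` C) p by [].
rewrite ((closure_id (phi @^-1` C)).1 Cc); apply: closureS Dp => y /Ds[q qs qy].
by exists q.
Qed.

End Grid.

(** * Outer integral *)

Section OuterIntegral.
Local Open Scope ereal_scope.
Context {d : measure_display} {T : measurableType d} {R : realType}.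
Variable P : {measure set T -> \bar R}.
Implicit Types phi h : T -> \bar R.

Definition outer_integral phi : \bar R :=
  ereal_inf [set \int[P]_x h x |
    h in [set h : T -> \bar R | measurable_fun setT h /\ forall x, phi x <= h x]].

Lemma le_outer_integral phi phi' : (forall x, phi x <= phi' x) ->
  outer_integral phi <= outer_integral phi'.
Proof.
move=> le; apply: ereal_inf_le_tmp => _ [h [mh hphi] <-].
by exists h => //; split => // x; exact: le_trans (hphi x).
Qed.

Lemma outer_integral_measurable phi : measurable_fun setT phi ->
  (forall x, 0 <= phi x) -> outer_integral phi = \int[P]_x phi x.
Proof.
move=> mphi phi0; apply/eqP; rewrite eq_le; apply/andP; split.
  by apply: ereal_inf_lbound; exists phi.
apply: le_ereal_inf_tmp => _ [h [mh hphi] <-].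
by apply: ge0_le_integral.
Qed.

(** The pointwise infimum of a minimising sequence of measurable majorants is again one and attains
    the outer integral. *)
Lemma outer_integral_hull phi : (forall x, 0 <= phi x) ->
  exists h, [/\ measurable_fun setT h, forall x, phi x <= h x &
    \int[P]_x h x = outer_integral phi].
Proof.
move=> phi0; have h0 h : (forall x, phi x <= h x) -> forall x, 0 <= h x.
  by move=> phih x; exact: le_trans (phih x).
have [oo|noo] := eqVneq (outer_integral phi) +oo.
  exists (cst +oo); split => // [x|]; first by rewrite leey.
  apply/eqP; rewrite eq_le; apply/andP; split; first by rewrite oo leey.
  by apply: ereal_inf_lbound;
     exists (cst +oo) => //; split => // x; rewrite leey.
have fin : outer_integral phi \is a fin_num.
  rewrite ge0_fin_numE ?ltey//; apply: le_ereal_inf_tmp => _ [h [_ phih] <-].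
  by apply: integral_ge0 => x _; exact: h0.
have /choice[h hP] n : exists h, [/\ measurable_fun setT h,
    forall x, phi x <= h x & \int[P]_x h x < outer_integral phi + (n.+1%:R^-1)%:E].
  have : outer_integral phi < outer_integral phi + (n.+1%:R^-1)%:E.
    by rewrite lteDl// lte_fin invr_gt0.
  by move=> /ereal_inf_lt[_ [h [mh phih] <-] hn]; exists h.
pose g x := einfs (h^~ x) 0%N.
have mg : measurable_fun setT g.
  by apply: measurable_fun_einfs => n; case: (hP n).
have phig x : phi x <= g x.
  by apply: le_ereal_inf_tmp => _ [n _ <-]; case: (hP n).
exists g; split => //; apply/eqP; rewrite eq_le; apply/andP; split; last first.
  by apply: ereal_inf_lbound; exists g.
apply/lee_addgt0Pr => e e0; have [n /ltW ne] := ltr_add_invr e0.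
have [mh phih /ltW hn] := hP n.
apply: (@le_trans _ _ (\int[P]_x h n x)).
  apply: ge0_le_integral => // [x _|x _]; first exact: le_trans (phig x).
  by apply: ereal_inf_lbound; exists n.
by apply: (le_trans hn); rewrite leeD2l// lee_fin -[leLHS]add0r.
Qed.

(** Monotone convergence for nonmeasurable functions: the lower limit of the hulls of the phi n is a
    measurable majorant of psi, and Fatou bounds its integral. *)
Lemma outer_integral_nondecreasing (phi : nat -> T -> \bar R) psi c :
  (forall n x, 0 <= phi n x) ->
  (forall x, {homo phi ^~ x : m n / (m <= n)%N >-> m <= n}) ->
  (forall x e, e < psi x -> exists n, e < phi n x) ->
  c < outer_integral psi -> exists n, c < outer_integral (phi n).
Proof.
move=> phi0 phimono phipsi; apply: contraPP => /forallNP phic; apply/negP.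
rewrite -leNgt; have {}phic n : outer_integral (phi n) <= c.
  by rewrite leNgt; apply/negP.
have /choice[h hP] n := outer_integral_hull (phi0 n).
have h0 n x : 0 <= h n x.
  by apply: (le_trans (phi0 n x)); case: (hP n).
have mh n : measurable_fun setT (h n) by case: (hP n).
pose g x := limn_einf (h^~ x).
have mg : measurable_fun setT g.
  apply: measurableT_comp; first exact: oppe_measurable.
  apply: measurable_fun_limn_esup => n.
  by apply: measurableT_comp; first exact: oppe_measurable.
have psig x : psi x <= g x.
  rewrite leNgt; apply/negP => /phipsi[n]; apply/negP; rewrite -leNgt.
  rewrite /g limn_einf_lim (cvg_lim _ (@cvg_einfs_sup _ (h ^~ x)))//.
  apply: (@le_trans _ _ (einfs (h ^~ x) n)); last by apply: ereal_sup_ubound; exists n.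
  apply: le_ereal_inf_tmp => _ [m /= nm <-]; have [_ + _] := hP m.
  by move=> /(_ x); apply: le_trans; exact: phimono.
apply: (@le_trans _ _ (\int[P]_x g x)); first by apply: ereal_inf_lbound; exists g.
apply: (le_trans (fatou P measurableT mh _)) => [n x _|]; first exact: h0.
rewrite limn_einf_lim; apply: lime_le; first exact: is_cvg_einfs.
apply: nearW => n; apply: le_trans (phic n); have [_ _ <-] := hP n.
by apply: ereal_inf_lbound; exists n => /=.
Qed.

End OuterIntegral.

Lemma integral_prob_cst d (T : measurableType d) (R : realType)
    (P : probability T R) (c : \bar R) : (\int[P]__ c = c)%E.
Proof.
rewrite (integral_cst P measurableT) -[RHS]mule1; congr (_ * _)%E.
exact: probability_setT.
Qed.

Lemma integral_prob1 d (T : measurableType d) (R : realType)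
    (P : probability T R) : (\int[P]_x cst 1 x = 1)%E.
Proof. exact: integral_prob_cst. Qed.

(** * Measurability of the event that a random image has positive measure *)

Lemma integral_nonincreasing_ge d (T : measurableType d) (R : realType)
    (P : probability T R) (phi : nat -> T -> \bar R) (psi : T -> \bar R) c :
  (forall n, measurable_fun setT (phi n)) -> measurable_fun setT psi ->
  (forall n x, 0 <= phi n x <= 1)%E ->
  (forall x, {homo phi ^~ x : m n / (m <= n)%N >-> (n <= m)%E}) ->
  (forall n x, psi x <= phi n x)%E ->
  (forall x e, psi x < e -> exists n, phi n x < e)%E ->
  (forall n, c <= \int[P]_x phi n x)%E -> (c <= \int[P]_x psi x)%E.
Proof.
move=> mphi mpsi phi01 phimono psile psiinf cphi.
have cvgphi x : phi ^~ x @ \oo --> psi x.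
  rewrite (_ : psi x = ereal_inf (range (phi ^~ x))).
    by apply: ereal_nonincreasing_cvgn => m n; exact: phimono.
  apply/eqP; rewrite eq_le; apply/andP; split.
    by apply: le_ereal_inf_tmp => _ [n _ <-].
  rewrite leNgt; apply/negP => /psiinf[n]; apply/negP; rewrite -leNgt.
  by apply: ereal_inf_lbound; exists n.
have [|||_ _ cvgint] := @dominated_convergence _ T R P setT measurableT phi psi
    (cst 1%E) mphi mpsi.
- by apply: aeW => x _; exact: cvgphi.
- by apply/integrableP; split => //; under eq_integral do rewrite gee0_abs//; rewrite integral_prob1 ltry.
- apply: aeW => x n _; have /andP[phi0 phi1] := phi01 n x.
  by rewrite gee0_abs.
rewrite -(cvg_lim _ cvgint)//; apply: lime_ge.
  by apply/cvg_ex; exists (\int[P]_x psi x)%E.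
exact: nearW.
Qed.

Section RandomImage.
Context {R : realType} {d : nat} {dO : measure_display} {Omega : measurableType dO}.
Context {T : ptopologicalType}.
Let V := 'rV[R]_d.+1.
Variable phi : Omega -> T -> V.
Hypothesis phi_continuous : forall w, continuous (phi w).
Hypothesis phi_measurable : forall p i, measurable_fun setT (fun w => phi w p 0 i).

Lemma measurable_image_lt (K : set T) (D : nat -> T) (c : R) : compact K ->
  (forall n, K (D n)) -> K `<=` closure (range D) ->
  measurable [set w | (lebesgue_rV (phi w @` K) < c%:E)%E].
Proof.
move=> cK KD DK.
pose S := [set s : seq ('rV[rat]_d.+1 * 'rV[rat]_d.+1) |
  (forall q, q \in s -> forall i, @ratv R d q.1 0 i <= ratv q.2 0 i) /\
  \sum_(q <- s) @vol R d.+1 (ratv q.1) (ratv q.2) < c].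
rewrite (_ : [set w | _] = \bigcup_(s in S) \bigcap_n
    \bigcup_(q in [set` s]) [set w | closed_box (ratv q.1) (ratv q.2) (phi w (D n))]).
  rewrite bigcup_mkcond; apply: countable_bigcupT_measurable => [|s].
    exact: countableP.
  case: ifPn => // _.
  apply: bigcapT_measurable => n; apply: fin_bigcup_measurable => [|q _].
    exact: finite_seq.
  rewrite (_ : [set w | _] = \bigcap_i ((fun w => phi w (D n) 0 i) @^-1`
      `[ratv q.1 0 i, ratv q.2 0 i])).
    apply: fin_bigcap_measurable => // i _; rewrite -[X in measurable X]setTI.
    exact: phi_measurable.
  apply/seteqP; split => w /= qD i; first by move=> _ /=; rewrite in_itv /= qD.
  by have := qD i I; rewrite /= in_itv.
apply/seteqP; split => w /=.
  move=> /(compact_lebesgue_rV_ltP c (@phi_continuous w) cK _ DK)[].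
    by move=> _ [n _ <-].
  move=> s [s12 sc Ds]; exists s; first by split.
  move=> n _; have [|q qs qD] := Ds (D n); first by exists n.
  by exists q.
move=> [s [s12 sc] Ds].
apply/(compact_lebesgue_rV_ltP c (@phi_continuous w) cK _ DK).
  by move=> _ [n _ <-].
exists s; split => // _ [n _ <-].
by have [q qs qD] := Ds n I; exists q.
Qed.

Lemma measurable_image (K : set T) (D : nat -> T) : compact K ->
  (forall n, K (D n)) -> K `<=` closure (range D) ->
  measurable_fun setT (fun w => lebesgue_rV (phi w @` K)).
Proof.
move=> cK KD DK mT; apply: (measurability _ (ErealGenCInfty.measurableE R)) => //.
move=> _ [_ [c ->] <-]; rewrite setTI -setCitvl preimage_setC; apply: measurableC.
rewrite [X in measurable X](_ : _ =
    [set w | (lebesgue_rV (phi w @` K) < c%:E)%E]).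
  exact: measurable_image_lt DK.
by apply/seteqP; split => w /=; rewrite in_itv.
Qed.

End RandomImage.

(** A lies between the measurable sets where g and h are positive. As g <= h have equal integrals,
    they agree almost everywhere, so A differs from the inner set by part of a null set, which
    completeness makes measurable. *)
Lemma negligible_measurable_eq d (T : measurableType d) (R : realType)
    (P : probability T R) (g h : T -> \bar R) (A : set T) :
  measure_is_complete P -> measurable_fun setT g -> measurable_fun setT h ->
  (forall x, 0 <= g x)%E -> (forall x, g x <= h x <= 1)%E ->
  (\int[P]_x h x <= \int[P]_x g x)%E ->
  [set x | 0 < g x]%E `<=` A -> A `<=` [set x | 0 < h x]%E -> measurable A.
Proof.
move=> Pc mg mh g0 gh1 hg gA Ah.
have gh x : (g x <= h x)%E by case/andP: (gh1 x).
have h1 x : (h x <= 1)%E by case/andP: (gh1 x).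
have h0 x : (0 <= h x)%E by exact: le_trans (gh x).
have gfin x : g x \is a fin_num.
  by rewrite ge0_fin_numE// (le_lt_trans (gh x))// (le_lt_trans (h1 x))// ltry.
have ig : P.-integrable setT g.
  apply/integrableP; split => //; apply: (@le_lt_trans _ _ (\int[P]_x (cst 1 x))%E).
    apply: ge0_le_integral => //; first exact: measurableT_comp.
    by move=> x _; rewrite gee0_abs// (le_trans (gh x)).
  by rewrite integral_prob1 ltry.
have ih : P.-integrable setT h.
  apply/integrableP; split => //; apply: (@le_lt_trans _ _ (\int[P]_x (cst 1 x))%E).
    apply: ge0_le_integral => //; first exact: measurableT_comp.
    by move=> x _; rewrite gee0_abs.
  by rewrite integral_prob1 ltry.
have hg0 x : (0 <= h x - g x)%E by rewrite sube_ge0// gfin.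
have : (\int[P]_x `|h x - g x| = 0)%E.
  under eq_integral do rewrite gee0_abs//.
  rewrite integralB//; apply/eqP; rewrite eq_le; apply/andP; split.
    by rewrite sube_le0.
  by rewrite sube_ge0 ?integrable_fin_num//; apply: ge0_le_integral.
move=> /(ae_eq_integral_abs P measurableT (emeasurable_funB mh mg)).1.
move=> [N [mN PN0 Nsub]].
have mpos u : measurable_fun setT u -> measurable [set x : T | 0 < u x]%E.
  by move=> mu; rewrite -[X in measurable X]setTI; exact: emeasurable_fun_o_infty.
rewrite (_ : A = [set x | 0 < g x]%E `|` (A `\` [set x | 0 < g x]%E)); last first.
  by rewrite setDUK.
apply: measurableU; first exact: mpos.
apply: Pc; exists N; split => // x [/Ah /= hx /negP]; rewrite -leNgt => gx.
apply: Nsub => /= /(_ I) hgx.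
have gx0 : g x = 0%E by apply/eqP; rewrite eq_le gx g0.
by move: hgx; rewrite gx0 sube0 => hx0; rewrite hx0 ltxx in hx.
Qed.

Section ImageCapacity.
Context {R : realType} {d : nat} {dO : measure_display} {Omega : measurableType dO}.
Variable P : probability Omega R.
Context {T : ptopologicalType}.
Let V := 'rV[R]_d.+1.
Variables (phi : Omega -> T -> V) (X : set T).
Hypothesis phi_continuous : forall w, continuous (phi w).
Hypothesis phi_measurable : forall p i, measurable_fun setT (fun w => phi w p 0 i).
Hypothesis X_compact : compact X.
Hypothesis X_closed : closed X.
Hypothesis separable : forall K : set T, K !=set0 ->
  exists D : nat -> T, (forall n, K (D n)) /\ K `<=` closure (range D).

(* Truncation at 1 makes the integrals below finite without changing positivity. *)
Let Phi (S : set T) (w : Omega) : \bar R := mine 1%E (lebesgue_rV (phi w @` S)).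

Let Phi01 S w : (0 <= Phi S w <= 1)%E.
Proof. by rewrite /Phi le_min ge_min lee01 lebesgue_rV_ge0 lexx. Qed.

Let mPhi K : closed K -> K `<=` X -> measurable_fun setT (Phi K).
Proof.
move=> Kc KX; apply: measurable_mine => //.
have [->|K0] := eqVneq K set0.
  rewrite (_ : (fun _ => _) = cst 0%E)//.
  by apply/funext => w; rewrite image_set0 lebesgue_rV0.
have /set0P/separable[D [KD DK]] := K0.
apply: measurable_image DK => //; exact: subclosed_compact KX.
Qed.

Let C (S : set T) := outer_integral P (Phi S).

Let Phimono S S' w : S `<=` S' -> (Phi S w <= Phi S' w)%E.
Proof.
move=> SS'; rewrite /Phi le_min ge_min lexx/= ge_min.
by rewrite [X in _ || X]le_lebesgue_rV ?orbT//; exact: image_subset.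
Qed.

(** Capacitability gives closed F n inside A whose capacities approach [C A]. The supremum of the
    [Phi (F n)] below [Phi A] and the truncated measurable hull above it then have the same
    integral, which is the sandwich of [negligible_measurable_eq]. *)
Lemma measurable_image_pos (A : set T) : measure_is_complete P -> analytic A ->
  A `<=` X -> measurable [set w | (0 < lebesgue_rV (phi w @` A))%E].
Proof.
move=> Pc anA AX.
have Cfin S : (0 <= C S <= 1)%E.
  apply/andP; split.
    apply: le_ereal_inf_tmp => _ [h [mh Phih] <-]; apply: integral_ge0 => w _.
    by apply: le_trans (Phih w); case/andP: (Phi01 S w).
  apply: ereal_inf_lbound; exists (cst 1%E); first by split => // w; case/andP: (Phi01 S w).
  by rewrite integral_prob1.
have CE K : closed K -> K `<=` X -> C K = (\int[P]_w Phi K w)%E.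
  move=> Kc KX; apply: outer_integral_measurable; first exact: mPhi.
  by move=> w; case/andP: (Phi01 K w).
have cap c : (c < C A)%E -> exists F, [/\ closed F, F `<=` A & (c <= C F)%E].
  apply: (capacitability (X := X)) => //.
  - by move=> S S' SS'; apply: le_outer_integral => w; exact: Phimono.
  - move=> S e Smono; apply: outer_integral_nondecreasing.
    + by move=> n w; case/andP: (Phi01 (S n) w).
    + by move=> w m n mn; apply: Phimono; exact/subsetPset/Smono.
    + move=> w e'; rewrite /Phi lt_min image_bigcup => /andP[e1].
      move=> /(lebesgue_rV_nondecreasing _)[|n en]; last first.
        by exists n; rewrite lt_min e1.
      by move=> m n mn; apply/subsetPset/image_subset/subsetPset/Smono.
  - move=> F e Fmono Fc eF.
    have cF : closed (\bigcap_n F n) by apply: closed_bigI => n _; case: (Fc n).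
    have FX : \bigcap_n F n `<=` X by move=> x /(_ 0%N I); case: (Fc 0%N) => _; exact.
    rewrite CE//; apply: (@integral_nonincreasing_ge _ _ _ P (fun n => Phi (F n))).
    + by move=> n; case: (Fc n) => *; exact: mPhi.
    + exact: mPhi.
    + by move=> n w; exact: Phi01.
    + by move=> w m n mn; apply: Phimono; exact/subsetPset/Fmono.
    + by move=> n w; apply: Phimono; exact: bigcap_inf.
    + move=> w e'; rewrite /Phi gt_min => /orP[e1|].
        by exists 0%N; rewrite gt_min e1.
      case: e' => [r||]; last by rewrite ltNge leNye.
        (* Continuity from above: an open set of small measure around the image of the intersection
           already contains the image of some F n, by compactness. *)
        move=> /lebesgue_rV_outer_open[U [oU FU Uc]].
        have [|||||n FnU] := @compact_bigcap_open T F (phi w @^-1` U).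
        * by apply: subclosed_compact X_compact _; case: (Fc 0%N).
        * by move=> n; case: (Fc n).
        * by move=> m n mn; exact: Fmono.
        * by apply: open_comp oU => x _; exact: phi_continuous.
        * by move=> x Fx; apply: FU; exists x.
        exists n; rewrite gt_min; apply/orP; right; apply: le_lt_trans Uc.
        by apply: le_lebesgue_rV => _ [x /FnU ? <-].
      by exists 0%N; rewrite gt_min ltry.
    + by move=> n; rewrite -CE//; case: (Fc n).
have Afin : C A \is a fin_num.
  by have /andP[A0 A1] := Cfin A; rewrite ge0_fin_numE// (le_lt_trans A1)// ltry.
have /choice[F FP] n : exists F, [/\ closed F, F `<=` A & (C A - n.+1%:R^-1%:E <= C F)%E].
  by apply: cap; rewrite lteBlDr// lteDl// lte_fin invr_gt0.
have FX n : F n `<=` X by case: (FP n) => _ FA _; exact: subset_trans AX.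
have mF n : measurable_fun setT (Phi (F n)) by case: (FP n) => ? _ _; exact: mPhi.
have Phi0 w : (0 <= Phi A w)%E by case/andP: (Phi01 A w).
have [h [mh Ah hC]] := outer_integral_hull P Phi0.
pose g w := esups (fun n => Phi (F n) w) 0%N.
have gA w : (g w <= Phi A w)%E.
  rewrite leNgt; apply/negP => /ereal_sup_gt[_ [n _ <-]]; apply/negP.
  by rewrite -leNgt; case: (FP n) => _ FA _; exact: Phimono.
have Fg n w : (Phi (F n) w <= g w)%E by apply: ereal_sup_ubound; exists n.
have mg : measurable_fun setT g by exact: measurable_fun_esups.
have g0 w : (0 <= g w)%E.
  by apply: le_trans (Fg 0%N w); case/andP: (Phi01 (F 0%N) w).
have mh1 : measurable_fun setT (fun w => mine 1 (h w))%E.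
  exact: measurable_mine.
apply: (negligible_measurable_eq Pc mg mh1 g0) => [w|||].
- rewrite ge_min lexx andbT le_min (le_trans (gA w) (Ah w)) andbT.
  by apply: le_trans (gA w) _; case/andP: (Phi01 A w).
- apply: (@le_trans _ _ (C A)).
    rewrite /C -hC; apply: ge0_le_integral => // w _.
      by rewrite le_min lee01 (le_trans (Phi0 w)).
    by rewrite ge_min lexx orbT.
  apply/lee_addgt0Pr => e e0; have [n /ltW ne] := ltr_add_invr e0.
  have [cF FA +] := FP n; rewrite leeBlDr// => /le_trans; apply.
  apply: leeD; last by rewrite lee_fin -[leLHS]add0r.
  rewrite CE//; apply: ge0_le_integral => // w _.
  by case/andP: (Phi01 (F n) w).
- move=> w /= gw; have := lt_le_trans gw (gA w).
  by rewrite /Phi lt_min lte01.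
- move=> w /= Aw; rewrite lt_min lte01/=; apply: lt_le_trans (Ah w).
  by rewrite /Phi lt_min lte01.
Qed.

End ImageCapacity.

(** The outer integral of the indicator is a capacity defined on every subset. It is at least 1 on
    A, since a measurable majorant of the indicator of A is at least 1 off a null set, and it equals
    mu on closed sets. *)
Lemma inner_regular_analytic (R : realType) (T : ptopologicalType)
    (mu : probability (borel T) R) (X A : set T) : closed X -> analytic A ->
  A `<=` X -> mu.-negligible (~` A) -> forall c : R, c < 1 ->
  exists F, [/\ closed F, F `<=` A & (c%:E <= mu F)%E].
Proof.
move=> Xc anA AX [N [mN muN NA]] c c1.
have mclosed F : closed F -> measurable (F : set (borel T)).
  move=> cF; rewrite -[F]setCK; apply: measurableC.
  by apply: sub_sigma_algebra; exact: closed_openC.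
pose Phi (S : set T) (x : borel T) : \bar R := (\1_S x)%:E.
have Phi01 S x : (0 <= Phi S x <= 1)%E.
  by rewrite /Phi !lee_fin indicE; case: (_ \in _); rewrite ?lexx ?ler01.
have PhiS S x : S x -> Phi S x = 1%E by move=> Sx; rewrite /Phi indicE mem_set.
have PhinS S x : ~ S x -> Phi S x = 0%E by move=> Sx; rewrite /Phi indicE memNset.
have Phimono S S' x : S `<=` S' -> (Phi S x <= Phi S' x)%E.
  move=> SS'; have [Sx|nSx] := pselect (S x).
    by rewrite !PhiS//; exact: SS'.
  by rewrite PhinS//; case/andP: (Phi01 S' x).
have mPhi F : closed F -> measurable_fun setT (Phi F).
  by move=> /mclosed mF; apply/measurable_EFinP; exact: measurable_indic.
have CE F : closed F -> outer_integral mu (Phi F) = mu F.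
  move=> cF; rewrite outer_integral_measurable; first last.
  - by move=> x; case/andP: (Phi01 F x).
  - exact: mPhi.
  by rewrite /Phi integral_indic ?setIT//; exact: mclosed.
have cA : (c%:E < outer_integral mu (Phi A))%E.
  apply: (@lt_le_trans _ _ 1%E); first by rewrite lte_fin.
  apply: le_ereal_inf_tmp => _ [h [mh Ah] <-].
  have <- : mu (~` N) = 1%E.
    by rewrite probability_setC// muN sube0.
  rewrite -(setIT (~` N)) -integral_indic//; last exact: measurableC.
  apply: ge0_le_integral => //.
  - by apply/measurable_EFinP/measurable_indic; exact: measurableC.
  - move=> x _; apply: le_trans (Ah x); apply: Phimono => y Ny.
    by apply: contrapT => /NA.
have := capacitability (C := fun S => outer_integral mu (Phi S)) (X := X) (A := A)
  (c := c%:E).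
case=> //.
- by move=> S S' SS'; apply: le_outer_integral => w; exact: Phimono.
- move=> S e Smono; apply: outer_integral_nondecreasing.
  + by move=> n x; case/andP: (Phi01 (S n) x).
  + by move=> x m n mn; apply: Phimono; exact/subsetPset/Smono.
  + move=> x e'; have [[n _ Sx]|nSx] := pselect ((\bigcup_n S n) x).
      by rewrite PhiS; [exists n; rewrite PhiS|exists n].
    rewrite PhinS// => e0; exists 0%N; apply: (lt_le_trans e0).
    by case/andP: (Phi01 (S 0%N) x).
- move=> F e Fmono Fc eF.
  have cF : closed (\bigcap_n F n) by apply: closed_bigI => n _; case: (Fc n).
  rewrite outer_integral_measurable; first last.
  + by move=> x; case/andP: (Phi01 (\bigcap_n F n) x).
  + exact: mPhi.
  apply: (@integral_nonincreasing_ge _ _ _ mu (fun n => Phi (F n))).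
  + by move=> n; case: (Fc n) => *; exact: mPhi.
  + exact: mPhi.
  + by move=> n w; exact: Phi01.
  + by move=> w m n mn; apply: Phimono; exact/subsetPset/Fmono.
  + by move=> n w; apply: Phimono; exact: bigcap_inf.
  + move=> x e'; have [Fx|/existsNP[n /not_implyP[_ nFx]]] := pselect ((\bigcap_n F n) x).
      by rewrite PhiS// => e1; exists 0%N; rewrite PhiS//; exact: Fx.
    rewrite PhinS//; last by move=> /(_ n I).
    by move=> e0; exists n; rewrite PhinS.
  + move=> n; rewrite -outer_integral_measurable//; first by apply: mPhi; case: (Fc n).
    by move=> x; case/andP: (Phi01 (F n) x).
- by move=> F [cF FA cmu]; exists F; split => //; rewrite -CE.
Qed.

(** * Analytic graphs *)

Lemma cvg_rV (R : realType) n (S : Type) (F : set_system S) (u : S -> 'rV[R]_n)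
    (x : 'rV[R]_n) : Filter F ->
  (forall i, u s 0 i @[s --> F] --> x 0 i) -> u s @[s --> F] --> x.
Proof.
move=> FF ux A [P Px PA].
have : \forall s \near F, forall i j, P i j (u s i j).
  apply: filter_forall => i; apply: filter_forall => j; rewrite (ord1 i).
  by apply: (ux j); rewrite -(ord1 i); exact: Px.
by apply: filterS => s Ps; apply: PA.
Qed.

Section ProductSpace.
Context {R : realType} {n : nat}.
Let V := 'rV[R]_n.
Let T := (R * V)%type.

Lemma continuous_coord (i : 'I_n) : continuous (fun p : T => p.2 0 i).
Proof.
move=> p; apply: (@continuous_comp _ _ _ (snd : T -> V) (fun x => x 0 i)).
  exact: cvg_snd.
exact: coord_continuous.
Qed.

(** Analytic sets are not stable under complement, so the sigma-algebra [G] collects the sets that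
    are analytic together with their complements. Half-lines belong to it, the open ones as
    countable unions of closed ones. *)
Lemma analytic_preimage_measurable (S : set R) : measurable S ->
  analytic [set p : T | S p.1].
Proof.
pose G := [set A : set R | analytic [set p : T | A p.1] /\
                           analytic [set p : T | ~ A p.1]].
suff : @measurable _ (measurableTypeR R) `<=` G by move=> mG /mG[].
rewrite RGenCInfty.measurableE; apply: smallest_sub.
  split.
  - split; first by apply: analytic_closed; exact: closed0.
    rewrite (_ : [set p | _] = setT); first by apply: analytic_closed; exact: closedT.
    by apply/seteqP; split => // p _ /= [].
  - move=> A [anA anAc]; split.
      rewrite (_ : [set p : T | (setT `\` A) p.1] = [set p : T | ~ A p.1])//.
      by apply/seteqP; split => p /= => [[]|].
    rewrite (_ : [set p : T | ~ (setT `\` A) p.1] = [set p : T | A p.1])//.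
    apply/seteqP; split => p /= => [H|? []//].
    by apply: contrapT => nA; apply: H.
  - move=> A GA; split.
      rewrite (_ : [set p | _] = \bigcup_k [set p : T | A k p.1]).
        by apply: analytic_bigcup => k; case: (GA k).
      by apply/seteqP; split => p /= [k _ kp]; exists k.
    rewrite (_ : [set p | _] = \bigcap_k [set p : T | ~ A k p.1]).
      by apply: analytic_bigcap => k; case: (GA k).
    apply/seteqP; split => p /= Ap; first by move=> k _ /= Akp; apply: Ap; exists k.
    by move=> [k _]; exact: Ap.
move=> _ [x ->]; split.
  apply: analytic_closed; apply: (@closed_comp _ _ (fst : T -> R)).
    by move=> p _; exact: cvg_fst.
  by rewrite set_itvcy; exact: closed_ge.
rewrite (_ : [set p | _] = \bigcup_k [set p : T | p.1 <= x - k.+1%:R^-1]).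
  apply: analytic_bigcup => k; apply: analytic_closed.
  apply: (@closed_comp _ _ (fst : T -> R) [set y | y <= x - k.+1%:R^-1]).
    by move=> p _; exact: cvg_fst.
  exact: closed_le.
apply/seteqP; split => p /=.
  rewrite in_itv/= andbT => /negP; rewrite -ltNge => /ltr_add_invr[k kx].
  by exists k => //=; rewrite lerBrDr ltW.
move=> [k _ /= pk]; rewrite in_itv/= andbT => xp.
have := le_trans xp pk; rewrite lerBrDr gerDl leNgt => /negP; apply.
by rewrite invr_gt0.
Qed.

(** A point (t, x) with t in E is on the graph exactly when no rational r separates x_i from f_i(t)
    in any coordinate. [A] and [B] say that both lie on the same side of r, according to the
    position of f_i(t). *)
Lemma analytic_graph_on (E : set R) (f : R -> V) : measurable E ->
  (forall i, measurable_fun E (fun t => f t 0 i)) -> analytic (graph_on E f).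
Proof.
move=> mE mf.
pose A i (r : rat) := [set p : T | (E `&` (fun t => f t 0 i) @^-1` `[ratr r, +oo[) p.1] `&`
    [set p : T | ratr r <= p.2 0 i].
pose B i (r : rat) := [set p : T | (E `&` (fun t => f t 0 i) @^-1` `]-oo, ratr r[) p.1] `&`
    [set p : T | p.2 0 i <= ratr r].
rewrite (_ : graph_on E f = [set p : T | E p.1] `&`
    \bigcap_i \bigcap_r (A i r `|` B i r)).
  apply: analyticI; first exact: analytic_preimage_measurable.
  apply: analytic_bigcap_count => i; apply: analytic_bigcap_count => r.
  apply: analyticU; apply: analyticI.
  - by apply: analytic_preimage_measurable; exact: mf.
  - apply: analytic_closed; apply: (@closed_comp _ _ (fun p : T => p.2 0 i) [set y | ratr r <= y]).
      by move=> p _; exact: continuous_coord.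
    exact: closed_ge.
  - by apply: analytic_preimage_measurable; exact: mf.
  - apply: analytic_closed; apply: (@closed_comp _ _ (fun p : T => p.2 0 i) [set y | y <= ratr r]).
      by move=> p _; exact: continuous_coord.
    exact: closed_le.
apply/seteqP; split => [_ [t Et <-]|[t x] [/= Et AB]].
  split => // i _ r _; have [fr|fr] := leP (ratr r) (f t 0 i).
    by left; split => //; split => //=; rewrite in_itv/= andbT.
  by right; split; [split => //=; rewrite in_itv|exact: ltW].
exists t => //; congr pair; apply/rowP => i; apply/eqP; rewrite eq_le.
apply/andP; split; rewrite leNgt; apply/negP => /rat_in_itvoo[r].
  rewrite in_itv/= => /andP[xr rf]; have [[/= _ rx]|[/= [_ +] _]] := AB i I r I.
    by rewrite leNgt xr in rx.
  by rewrite in_itv/= ltNge (ltW rf).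
rewrite in_itv/= => /andP[fr rx]; have [[/= [_ +] _]|[/= _ xr]] := AB i I r I.
  by rewrite in_itv/= andbT leNgt fr.
by rewrite leNgt rx in xr.
Qed.

Lemma separable_product (K : set T) : K !=set0 ->
  exists D : nat -> T, (forall n, K (D n)) /\ K `<=` closure (range D).
Proof.
move=> [p0 Kp0].
pose near_pt (c : rat * 'rV[rat]_n) (k : nat) (p : T) :=
  `|ratr c.1 - p.1| < k.+1%:R^-1 /\ forall i, `|ratr (c.2 0 i) - p.2 0 i| < k.+1%:R^-1.
(* Each m encodes a rational centre and a precision, and selects a point of K that close to the
   centre. The default [p0] keeps the sequence in K when there is none. *)
pose D m := if unpickle m is Some (c, k) then
  xget p0 [set p | K p /\ near_pt c k p] else p0.
exists D; split.
  move=> m; rewrite /D; case: unpickle => [[c k]|//].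
  by case: xgetP => [p _ []|].
move=> p Kp A [[B1 B2] /= [/nbhs_ballP[e1 /= e10 B1e] [Q Qp QB2]] BA].
have /choice[e2 e2P] i : exists e, 0 < e /\ ball (p.2 0 i) e `<=` Q 0 i.
  by have /nbhs_ballP[e /= e0 eQ] := Qp 0 i; exists e.
pose e := \big[Num.min/e1]_i e2 i.
have e0 : 0 < e by apply/bigmin_gtP; split => // i _; case: (e2P i).
have [k ke] := ltr_add_invr (divr_gt0 e0 (ltr0n _ 2)); rewrite add0r in ke.
have k0 : 0 < k.+1%:R^-1 :> R by [].
have ratnear (y : R) : exists r : rat, `|ratr r - y| < k.+1%:R^-1.
  have [|r] := @rat_in_itvoo _ y (y + k.+1%:R^-1); first by rewrite ltrDl.
  rewrite in_itv/= => /andP[yr ry]; exists r.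
  by rewrite gtr0_norm ?subr_gt0// ltrBlDl.
have [c1 c1P] := ratnear p.1.
have /choice[c2 c2P] i := ratnear (p.2 0 i).
pose c := (c1, \row_i c2 i).
have cp : near_pt c k p by split => //= i; rewrite mxE.
have [KD [D1 D2]] : K (D (pickle (c, k))) /\ near_pt c k (D (pickle (c, k))).
  rewrite /D pickleK; case: xgetP => [q _ //|/(_ p)[]]; by split.
exists (D (pickle (c, k))); split; first by exists (pickle (c, k)).
move: (D _) KD D1 D2 => q {D} _ D1 D2; apply: BA; split.
  apply: B1e; rewrite -ball_normE /=.
  have ee1 : e <= e1 by exact: bigmin_le_id.
  apply: (le_lt_trans (ler_distD (ratr c1) _ _)); rewrite distrC.
  rewrite (lt_le_trans _ ee1)// (splitr e).
  by apply: ltrD; apply: lt_trans ke.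
apply: QB2 => i0 i; rewrite (ord1 i0); case: (e2P i) => _; apply.
have ee2 : e <= e2 i by exact: bigmin_le_cond.
have := D2 i; have := c2P i; rewrite -ball_normE /= mxE.
move=> cpi cqi; apply: (le_lt_trans (ler_distD (ratr (c2 i)) _ _)).
rewrite distrC (lt_le_trans _ ee2)// (splitr e).
by apply: ltrD; apply: lt_trans ke.
Qed.

Lemma compact_slab (M : R) :
  let X := [set p : T | 0 <= p.1 <= 1 /\ forall i, -M <= p.2 0 i <= M] in
  compact X /\ closed X.
Proof.
move=> X; have -> : X = (`[0, 1]%classic : set R) `*`
    [set v : V | forall i, (`[-M, M]%classic : set R) (v ord0 i)].
  by apply/seteqP; split => -[t x] /= []; rewrite in_itv/= => t01 xM; split => // i;
    have := xM i; rewrite in_itv/=.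
have cX : compact ((`[0, 1]%classic : set R) `*`
    [set v : V | forall i, (`[-M, M]%classic : set R) (v ord0 i)]).
  apply: compact_setX; first exact: segment_compact.
  by apply: (@rV_compact _ n (fun=> `[-M, M]%classic : set R)) => i; exact: segment_compact.
by split => //; apply: compact_closed cX; exact: norm_hausdorff.
Qed.

End ProductSpace.

(** * Gaussian estimates *)

Section Density.
Import HBNNSimple.
Context {d : measure_display} {T : measurableType d} {R : realType}.
Variables (mu nu : {measure set T -> \bar R}) (rho : T -> R).
Hypothesis rho_ge0 : forall x, 0 <= rho x.
Hypothesis rho_measurable : measurable_fun setT rho.
Hypothesis nuE : forall A, measurable A -> (nu A = \int[mu]_(x in A) (rho x)%:E)%E.

Lemma ge0_integral_density (f : T -> R) : measurable_fun setT f ->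
  (forall x, 0 <= f x) ->
  (\int[nu]_x (f x)%:E = \int[mu]_x ((f x)%:E * (rho x)%:E))%E.
Proof.
move=> /measurable_EFinP mf f0.
have mr : measurable_fun setT (EFin \o rho) by exact/measurable_EFinP.
pose f_ := nnsfun_approx measurableT mf.
have fnn (g : {nnsfun T >-> R}) :
    (\int[nu]_x (g x)%:E = \int[mu]_x ((g x)%:E * (rho x)%:E))%E.
  under [LHS]eq_integral do rewrite fimfunE -fsumEFin//.
  rewrite [LHS]ge0_integral_fsum//; last 2 first.
  - by move=> r; exact/measurable_EFinP/measurableT_comp.
  - by move=> n x _; rewrite EFinM nnfun_muleindic_ge0.
  under [RHS]eq_integral.
    move=> x xD; rewrite fimfunE -fsumEFin// muleC ge0_mule_fsumr; last first.
      by move=> r; rewrite EFinM nnfun_muleindic_ge0.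
    over.
  rewrite [RHS]ge0_integral_fsum//; last 2 first.
  - move=> r; apply: emeasurable_funM => //.
    exact/measurable_EFinP/measurableT_comp.
  - by move=> n x _; rewrite EFinM mule_ge0// ?nnfun_muleindic_ge0// lee_fin.
  apply: eq_fsbigr => r _.
  rewrite integralZl_indic_nnsfun//= integral_indic// setIT nuE//.
  under [RHS]eq_integral => x _ do rewrite muleC EFinM -muleA.
  have [r0|r0] := leP 0 r.
    rewrite ge0_integralZl//; last 2 first.
    - apply: emeasurable_funM => //; exact/measurable_EFinP/measurable_indic.
    - by move=> x _; rewrite mule_ge0// lee_fin.
    congr (_ * _)%E; rewrite integral_mkcond; apply: eq_integral => x _.
    by rewrite patchE indicE; case: ifP => _; rewrite ?mul1e ?mul0e.
  rewrite preimage_nnfun0// integral_set0 mule0.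
  by rewrite integral0_eq// => x _; rewrite indic0 /= mul0e mule0.
transitivity (lim (\int[nu]_x (f_ n x)%:E @[n --> \oo])%E).
  rewrite -monotone_convergence//=.
  - apply: eq_integral => ? /[!inE] xD; apply/esym/cvg_lim => //=.
    by apply: (cvg_nnsfun_approx measurableT mf) => // y _; rewrite lee_fin.
  - by move=> n; exact/measurable_EFinP/measurable_funTS.
  - by move=> n ? _; rewrite lee_fin.
  - by move=> ? _ ? ? mn; rewrite lee_fin; exact/lefP/nd_nnsfun_approx.
under eq_fun do rewrite fnn.
rewrite -monotone_convergence//=.
- apply: eq_integral => x _; apply/cvg_lim => //=.
  apply: cvgeM; last 2 first.
  + by apply: (cvg_nnsfun_approx measurableT mf) => // y _; rewrite lee_fin.
  + exact: cvg_cst.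
  by rewrite mule_def_fin.
- move=> n; apply: emeasurable_funM => //.
  exact/measurable_EFinP/measurable_funTS.
- by move=> n x _; rewrite mule_ge0// lee_fin.
- move=> x _ m n mn; rewrite lee_wpmul2r ?lee_fin//.
  exact/lefP/nd_nnsfun_approx.
Qed.

End Density.

Lemma exprn_le_expR (R : realType) (q : nat) (z : R) : 0 <= z ->
  z ^+ q <= q`!%:R * expR z.
Proof.
move=> z0; case: q => [|q].
  by rewrite expr0 fact0 mul1r -expR0 ler_expR.
have := expR_ge1Dxn q z0 => h.
have : z ^+ q.+1 / q.+1`!%:R <= expR z by apply: le_trans h; rewrite lerDr.
by rewrite ler_pdivrMr ?ltr0n ?fact_gt0// mulrC.
Qed.

Section Gaussian.
Context {R : realType}.
Implicit Types m s x : R.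

Lemma normal_peak_le s : s != 0 -> normal_peak s <= (2 * `|s|)^-1.
Proof.
move=> s0; have s00 : 0 < `|s| by rewrite normr_gt0.
rewrite /normal_peak lef_pV2 ?posrE ?mulr_gt0 ?sqrtr_gt0//; last first.
  by rewrite pmulrn_lgt0// mulr_gt0 ?pi_gt0// exprn_even_gt0.
rewrite -[leLHS]ger0_norm ?mulr_ge0// -sqrtr_sqr ler_wsqrtr// exprMn -normrX ger0_norm ?sqr_ge0//.
rewrite (_ : s ^+ 2 * pi *+ 2 = (2 * pi) * s ^+ 2); last by ring.
by rewrite ler_wpM2r ?sqr_ge0//; have := pi_ge2 R; lra.
Qed.

Lemma normal_peak2 s : normal_peak (2 * s) = normal_peak s / 2.
Proof.
rewrite /normal_peak exprMn -mulrA -mulrnAr sqrtrM ?sqr_ge0// sqrtr_sqr.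
by rewrite ger0_norm// invfM mulrC.
Qed.

(** Doubling the standard deviation halves the peak and leaves a Gaussian factor to spare. That
    factor absorbs any polynomial, so moment bounds reduce to the total mass 1 of the wider law. *)
Lemma normal_pdf_le2 m s x : s != 0 -> normal_pdf m s x <=
  2 * expR (- ((x - m) ^+ 2 / (8 * s ^+ 2))) * normal_pdf m (2 * s) x.
Proof.
move=> s0; have s20 : 2 * s != 0 by rewrite mulf_neq0.
rewrite /normal_pdf (negbTE s0) (negbTE s20) normal_peak2 /normal_fun.
rewrite (_ : 2 * _ * (_ / 2 * _) = normal_peak s * (expR (- ((x - m) ^+ 2 / (8 * s ^+ 2))) * expR (- (x - m) ^+ 2 / ((2 * s) ^+ 2 *+ 2)))); last by field.
rewrite ler_wpM2l ?normal_peak_ge0// -expRD ler_expR.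
have s2 : 0 < s ^+ 2 by rewrite exprn_even_gt0.
have y0 : 0 <= (x - m) ^+ 2 / s ^+ 2 by rewrite divr_ge0 ?sqr_ge0.
rewrite (_ : - (x - m) ^+ 2 / (s ^+ 2 *+ 2) = - ((x - m) ^+ 2 / s ^+ 2) / 2); last by field.
rewrite (_ : - (x - m) ^+ 2 / _ = - ((x - m) ^+ 2 / s ^+ 2) / 8); last by field.
rewrite (_ : (x - m) ^+ 2 / (8 * s ^+ 2) = ((x - m) ^+ 2 / s ^+ 2) / 8); last by field.
lra.
Qed.

(** With z = (x - m)^2 / (8 s^2) the spare factor is exp(-z), and z^q exp(-z) <= q!. *)
Lemma normal_moment m s (q : nat) : s != 0 ->
  (\int[normal_prob m s]_x ((x - m) ^+ (2 * q))%:E <=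
    (2 * q`!%:R * (8 * s ^+ 2) ^+ q)%:E)%E.
Proof.
move=> s0; have s20 : 2 * s != 0 by rewrite mulf_neq0.
have s2 : 0 < 8 * s ^+ 2 by rewrite mulr_gt0// exprn_even_gt0.
have mX : measurable_fun [set: R] (fun x => (x - m) ^+ (2 * q)).
  by apply: measurable_funX; apply: measurable_funB.
rewrite (@ge0_integral_density _ _ _ lebesgue_measure _ (normal_pdf m s)) //; last first.
- by move=> x; rewrite exprM exprn_ge0// sqr_ge0.
- exact: measurable_normal_pdf.
- exact: normal_pdf_ge0.
set c := 2 * q`!%:R * _.
have c0 : 0 <= c by rewrite !mulr_ge0// exprn_ge0// ltW.
rewrite -[leRHS]mule1 -(integral_normal_pdf m (2 * s)) -ge0_integralZl//; last 2 first.
- by apply/measurable_EFinP; exact: measurable_normal_pdf.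
- by move=> x _; rewrite lee_fin normal_pdf_ge0.
apply: ge0_le_integral => //.
- by move=> x _; rewrite -EFinM lee_fin mulr_ge0 ?normal_pdf_ge0// exprM exprn_ge0// sqr_ge0.
- apply: emeasurable_funM; apply/measurable_EFinP => //.
  exact: measurable_normal_pdf.
- apply: emeasurable_funM => //; apply/measurable_EFinP.
  exact: measurable_normal_pdf.
- move=> x _; rewrite -!EFinM lee_fin.
  apply: le_trans (ler_wpM2l _ (normal_pdf_le2 m x s0)) _.
    by rewrite exprM exprn_ge0// sqr_ge0.
  rewrite mulrA ler_wpM2r ?normal_pdf_ge0//.
  set z := (x - m) ^+ 2 / (8 * s ^+ 2).
  have z0 : 0 <= z by rewrite divr_ge0 ?sqr_ge0// ltW.
  have -> : (x - m) ^+ (2 * q) = z ^+ q * (8 * s ^+ 2) ^+ q.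
    by rewrite exprM -exprMn divfK// gt_eqF.
  rewrite /c (_ : _ * (2 * _) = 2 * (z ^+ q * expR (- z)) * (8 * s ^+ 2) ^+ q); last by ring.
  rewrite ler_wpM2r ?exprn_ge0 ?(ltW s2)// ler_wpM2l//.
  by rewrite expRN ler_pdivrMr ?expR_gt0// exprn_le_expR.
Qed.

Lemma normal_prob_itv m s (a b c : R) : s != 0 -> a <= b -> 0 <= c ->
  (forall x, a < x < b -> normal_pdf m s x <= c) ->
  (normal_prob m s `]a, b[ <= (c * (b - a))%:E)%E.
Proof.
move=> s0 ab c0 pdfc; rewrite /normal_prob.
apply: (@le_trans _ _ (\int[lebesgue_measure]_(x in `]a, b[) (cst c%:E x))%E).
  apply: ge0_le_integral => //=.
  - by move=> x _; rewrite lee_fin normal_pdf_ge0.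
  - by apply/measurable_EFinP/measurable_funTS; exact: measurable_normal_pdf.
rewrite integral_cst//= lebesgue_measure_itv/= lte_fin.
case: ltP => [_|_]; first by rewrite -EFinB -EFinM.
by rewrite mule0 lee_fin mulr_ge0// subr_ge0.
Qed.

End Gaussian.

Section GaussianVariable.
Context {dO : measure_display} {Omega : measurableType dO} {R : realType}.
Variable P : probability Omega R.
Implicit Types Y : Omega -> R.

Lemma gaussian_law Y : gaussian_rv P Y -> exists m s : R,
  (forall A : set R, measurable A ->
     P (Y @^-1` A) = if s == 0 then \d_m A else normal_prob m s A) /\
  forall f : R -> R, measurable_fun setT f -> (forall x, 0 <= f x) ->
    (\int[P]_w (f (Y w))%:E =
     if (s == 0)%R then (f m)%:E else \int[normal_prob m s]_x (f x)%:E)%E.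
Proof.
move=> [mY [m [s law]]]; exists m, s; split => // f mf f0.
have mY' : measurable_fun setT (Y : Omega -> measurableTypeR R) := mY.
have := ge0_integral_pushforward mY' P (f := EFin \o f) measurableT.
rewrite preimage_setT => <- //; last 2 first.
- exact/measurable_EFinP.
- by move=> x _; rewrite lee_fin.
have [s0|s0] := eqVneq s 0.
  rewrite (eq_measure_integral (\d_(m : measurableTypeR R))) => [|A mA _].
    by rewrite integral_dirac// ?diracT ?mul1e//; exact/measurable_EFinP.
  by have := law A mA; rewrite s0 eqxx => lawA; exact: lawA.
apply: eq_measure_integral => A mA _.
by have := law A mA; rewrite (negbTE s0) => lawA; exact: lawA.
Qed.

Lemma gaussian_moment Y : gaussian_rv P Y -> exists m s : R,
  (forall A : set R, measurable A ->
     P (Y @^-1` A) = if s == 0 then \d_m A else normal_prob m s A) /\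
  forall q, (\int[P]_w ((Y w - m) ^+ (2 * q))%:E <=
             (2 * q`!%:R * (8 * s ^+ 2) ^+ q)%:E)%E.
Proof.
move=> /gaussian_law[m [s [law lawf]]]; exists m, s; split => // q.
have mX : measurable_fun [set: R] (fun x => (x - m) ^+ (2 * q)).
  by apply: measurable_funX; apply: measurable_funB.
rewrite (lawf (fun x => (x - m) ^+ (2 * q)))//; last first.
  by move=> x; rewrite exprM exprn_ge0// sqr_ge0.
have [->|s0] := eqVneq s 0; last exact: normal_moment.
rewrite lee_fin subrr; case: q {mX} => [|q].
  by rewrite muln0 !expr0 fact0 !mulr1 ler1n.
by rewrite mulnS expr0n expr0n/= mulr0 expr0n/= mulr0.
Qed.

Lemma Lfun2_measurable Y (c : R) : measurable_fun setT Y ->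
  (\int[P]_w (Y w ^+ 2)%:E <= c%:E)%E -> Y \in Lfun P 2%:E.
Proof.
move=> mY Yc; rewrite inE; apply/andP; split; rewrite inE//=.
rewrite /finite_norm unlock /=; apply: poweR_lty.
under eq_integral do rewrite powR_mulrn// real_normK ?num_real//.
by rewrite (le_lt_trans Yc)// ltry.
Qed.

Lemma sqrrD_le (x y : R) : (x + y) ^+ 2 <= 2 * (x ^+ 2 + y ^+ 2).
Proof. by have := sqr_ge0 (x - y); rewrite !expr2; nra. Qed.

Lemma exprDn_le (x y : R) (q : nat) :
  (x + y) ^+ (2 * q) <= 4 ^+ q * (x ^+ (2 * q) + y ^+ (2 * q)).
Proof.
pose M := Num.max (x ^+ 2) (y ^+ 2).
have M0 : 0 <= M by rewrite le_max sqr_ge0.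
have xyM : (x + y) ^+ 2 <= 4 * M.
  apply: le_trans (sqrrD_le x y) _.
  have : x ^+ 2 <= M by rewrite le_max lexx.
  have : y ^+ 2 <= M by rewrite le_max lexx orbT.
  lra.
rewrite exprM; apply: (@le_trans _ _ ((4 * M) ^+ q)).
  by rewrite lerXn2r// ?nnegrE ?sqr_ge0 ?mulr_ge0.
rewrite exprMn ler_wpM2l ?exprn_ge0// !exprM /M.
have [_|_] := leP (x ^+ 2) (y ^+ 2).
  by rewrite lerDr exprn_ge0// sqr_ge0.
by rewrite lerDl exprn_ge0// sqr_ge0.
Qed.

Lemma gaussian_Lfun2 Y : gaussian_rv P Y -> Y \in Lfun P 2%:E.
Proof.
move=> gY; have [mY _] := gY; have [m [s [_ mom]]] := gaussian_moment gY.
have := mom 1%N; rewrite muln1 expr1 => mom1.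
apply: (@Lfun2_measurable _ (2 * (2 * 1`!%:R * (8 * s ^+ 2) + m ^+ 2))) => //.
have mYm : measurable_fun setT (fun w => ((Y w - m) ^+ 2)%:E).
  by apply/measurable_EFinP; apply: measurable_funX; apply: measurable_funB.
apply: (@le_trans _ _ (\int[P]_w (2%:E * ((Y w - m) ^+ 2)%:E + (2 * m ^+ 2)%:E))%E).
  apply: ge0_le_integral => //.
  - by move=> w _; rewrite lee_fin sqr_ge0.
  - by apply/measurable_EFinP; apply: measurable_funX.
  - apply: emeasurable_funD => //; exact: emeasurable_funM.
  - move=> w _; rewrite -EFinM -EFinD lee_fin -mulrDr.
    by apply: le_trans (sqrrD_le _ _); rewrite subrK.
rewrite ge0_integralD//; last 3 first.
- by move=> w _; rewrite -EFinM lee_fin mulr_ge0// sqr_ge0.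
- exact: emeasurable_funM.
- by move=> w _; rewrite lee_fin mulr_ge0// sqr_ge0.
rewrite ge0_integralZl//; last by move=> w _; rewrite lee_fin sqr_ge0.
rewrite integral_prob_cst mulrDr [leRHS]EFinD.
by rewrite leeD2r// [leRHS]EFinM lee_wpmul2l// lee_fin.
Qed.

(* The parameters of the law are only compared with the moments of Y, which
   spares computing the mean and the variance of [normal_prob]. *)
Lemma gaussian_centered Y (v : R) : gaussian_rv P Y -> ('E_P[Y] = 0)%E ->
  (\int[P]_w (Y w ^+ 2)%:E = v%:E)%E -> exists m s : R,
  [/\ forall A : set R, measurable A ->
        P (Y @^-1` A) = if s == 0 then \d_m A else normal_prob m s A,
      forall q, (\int[P]_w ((Y w - m) ^+ (2 * q))%:E <=
             (2 * q`!%:R * (8 * s ^+ 2) ^+ q)%:E)%E,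
      m ^+ 2 <= 16 * s ^+ 2, v <= 16 * s ^+ 2 & s ^+ 2 <= 32 * v].
Proof.
move=> gY EY vE; have [mY _] := gY; have [m [s [law mom]]] := gaussian_moment gY.
exists m, s.
have Y2 := gaussian_Lfun2 gY.
have Pfin : P setT \is a fin_num by exact: fin_num_measure.
have iY : P.-integrable setT (EFin \o Y) by apply/Lfun1_integrable; exact: Lfun_subset12.
have iY2 := Lfun2_integrable_sqr Y2.
(* Y has mean 0, so the second moment about m is v + m^2; the moment bound with q = 1 makes it at
   most 16 s^2, which controls both terms. *)
have vm : (\int[P]_w ((Y w - m) ^+ 2)%:E = (v + m ^+ 2)%:E)%E.
  have iYm : P.-integrable setT (fun w => (- 2 * m)%:E * (Y w)%:E)%E.
    exact: integrableZl.
  have im : P.-integrable setT (fun=> (m ^+ 2)%:E).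
    exact: finite_measure_integrable_cst.
  transitivity (\int[P]_w ((Y w ^+ 2)%:E + ((- 2 * m)%:E * (Y w)%:E + (m ^+ 2)%:E)))%E.
    apply: eq_integral => w _; rewrite -EFinM -!EFinD; congr EFin; ring.
  rewrite integralD//=; last exact: integrableD.
  have EY0 : (\int[P]_w (Y w)%:E = 0)%E by move: EY; rewrite unlock.
  rewrite integralD//= integralZl//= vE EY0 mule0 add0e.
  by rewrite integral_prob_cst EFinD.
have := mom 1%N; rewrite muln1 expr1 vm lee_fin (_ : 1`! = 1%N)// => mom1.
have v0 : 0 <= v.
  by rewrite -lee_fin -vE; apply: integral_ge0 => w _; rewrite lee_fin sqr_ge0.
split => //; [by have := sqr_ge0 m; lra | by have := sqr_ge0 m; lra|].
have [->|s0] := eqVneq s 0; first by rewrite expr0n/= mulr_ge0.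
have s00 : 0 < `|s| by rewrite normr_gt0.
(* The density is at most 1 / (2|s|) and this interval has length |s| / 2, so it has probability at
   most 1/4. Outside it Y^2 >= s^2 / 16, hence v >= (3/4)(s^2 / 16), which gives s^2 <= 32 v. *)
pose A : set R := `]- (`|s| / 4), `|s| / 4[%classic.
have PA : (P (Y @^-1` A) <= (4^-1)%:E)%E.
  rewrite law; last exact: measurable_itv.
  rewrite (negbTE s0).
  apply: le_trans (normal_prob_itv (m := m) s0 _ (_ : 0 <= (2 * `|s|)^-1) _) _.
  - lra.
  - by rewrite invr_ge0 mulr_ge0.
  - move=> x _; apply: le_trans (normal_pdf_ub _ _ s0) _; exact: normal_peak_le.
  - rewrite lee_fin opprK (_ : _ * _ = 4^-1)//; field.
    by rewrite gt_eqF.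
have mA : measurable (Y @^-1` A).
  by rewrite -[X in measurable X]setTI; apply: mY => //; exact: measurable_itv.
have PAc : ((3 / 4)%:E <= P (~` (Y @^-1` A)))%E.
  rewrite probability_setC// leeBrDr; last first.
    by rewrite ge0_fin_numE// (le_lt_trans PA)// ltry.
  apply: (@le_trans _ _ ((3 / 4)%:E + (4^-1)%:E)%E); first by rewrite leeD2l.
  by rewrite -EFinD lee_fin; lra.
have : ((s ^+ 2 / 16)%:E * (3 / 4)%:E <= v%:E)%E.
  rewrite -vE; apply: (@le_trans _ _ ((s ^+ 2 / 16)%:E * P (~` (Y @^-1` A)))%E).
    by rewrite lee_wpmul2l// lee_fin divr_ge0// sqr_ge0.
  rewrite -[X in P X]setIT -integral_indic//; last exact: measurableC.
  rewrite -ge0_integralZl//; last 2 first.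
  - by apply/measurable_EFinP/measurable_indic; exact: measurableC.
  - by rewrite lee_fin divr_ge0// sqr_ge0.
  apply: ge0_le_integral => //.
  - by move=> w _; rewrite -EFinM lee_fin mulr_ge0// divr_ge0// sqr_ge0.
  - apply: emeasurable_funM => //.
    by apply/measurable_EFinP/measurable_indic; exact: measurableC.
  - by apply/measurable_EFinP; apply: measurable_funX.
  - move=> w _; rewrite -EFinM lee_fin indicE.
    have [|] := boolP (w \in _); last by rewrite mulr0 sqr_ge0.
    rewrite inE; rewrite /preimage /A /= in_itv/= mulr1 => /negP; rewrite -ltr_norml -leNgt => sY.
    rewrite (_ : s ^+ 2 / 16 = (`|s| / 4) ^+ 2); last first.
      by rewrite exprMn real_normK ?num_real//; field.
    by rewrite -[leRHS]real_normK ?num_real// lerXn2r// nnegrE ?divr_ge0.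
rewrite -EFinM lee_fin; lra.
Qed.

End GaussianVariable.

(** * Fractional Brownian motion *)

Section CenteredGaussian.
Context {dO : measure_display} {Omega : measurableType dO} {R : realType}.
Variable P : probability Omega R.
Implicit Types Y : Omega -> R.

(** The outer 4^q comes from [exprDn_le], which splits Y into Y - m and m; 8^q from the moment about
    m; 16^q from m^2 <= 16 s^2; 32^q from s^2 <= 32 v. *)
Definition gaussian_moment_cst (q : nat) : R :=
  4 ^+ q * ((2 * q`!%:R * 8 ^+ q + 16 ^+ q) * 32 ^+ q).

Lemma gaussian_moment_cst_ge0 q : 0 <= gaussian_moment_cst q.
Proof.
by rewrite /gaussian_moment_cst !mulr_ge0 ?exprn_ge0// addr_ge0 ?mulr_ge0// exprn_ge0.
Qed.

Lemma centered_moment_le Y (v : R) (q : nat) : gaussian_rv P Y -> ('E_P[Y] = 0)%E ->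
  (\int[P]_w (Y w ^+ 2)%:E = v%:E)%E ->
  (\int[P]_w (Y w ^+ (2 * q))%:E <= (gaussian_moment_cst q * v ^+ q)%:E)%E.
Proof.
move=> gY EY vE; have [mY _] := gY.
have [m [s [_ mom ms vs sv]]] := gaussian_centered gY EY vE.
have mYm : measurable_fun setT (fun w => ((Y w - m) ^+ (2 * q))%:E).
  by apply/measurable_EFinP; apply: measurable_funX; apply: measurable_funB.
have even0 (x : R) : 0 <= x ^+ (2 * q) by rewrite exprM exprn_ge0// sqr_ge0.
apply: (@le_trans _ _ (\int[P]_w ((4 ^+ q)%:E * (((Y w - m) ^+ (2 * q))%:E + (m ^+ (2 * q))%:E)))%E).
  apply: ge0_le_integral => //.
  - by move=> w _; rewrite lee_fin.
  - by apply/measurable_EFinP; apply: measurable_funX.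
  - by apply: emeasurable_funM => //; exact: emeasurable_funD.
  - move=> w _; rewrite -EFinD -EFinM lee_fin.
    by rewrite -[in leLHS](subrK m (Y w)); exact: exprDn_le.
rewrite ge0_integralZl//; last 2 first.
- exact: emeasurable_funD.
- by move=> w _; rewrite -EFinD lee_fin addr_ge0.
rewrite ge0_integralD//; last 2 first.
- by move=> w _; rewrite lee_fin.
- by move=> w _; rewrite lee_fin.
rewrite integral_prob_cst /gaussian_moment_cst -mulrA [leRHS]EFinM.
apply: lee_wpmul2l; first by rewrite lee_fin exprn_ge0.
apply: (@le_trans _ _ ((2 * q`!%:R * (8 * s ^+ 2) ^+ q)%:E + ((16 * s ^+ 2) ^+ q)%:E)%E).
  apply: leeD; first exact: mom.
  by rewrite lee_fin exprM lerXn2r// nnegrE ?sqr_ge0// (mulr_ge0 (ler0n R 16) (sqr_ge0 s)).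
rewrite -EFinD lee_fin.
have -> : 2 * q`!%:R * (8 * s ^+ 2) ^+ q + (16 * s ^+ 2) ^+ q =
    (2 * q`!%:R * 8 ^+ q + 16 ^+ q) * (s ^+ 2) ^+ q.
  by rewrite (exprMn q 8) (exprMn q 16); ring.
rewrite -[leRHS]mulrA ler_wpM2l//.
rewrite -exprMn lerXn2r ?nnegrE ?sqr_ge0//.
by apply: le_trans sv; exact: sqr_ge0.
Qed.

(** The event is an interval of length 2h, on which the density is at most 2 / r because r <= 4|s|.
    If |z| >= 2h, every x in it has |x| >= |z| / 2; then (x - m)^2 >= x^2 / 2 - m^2 with m^2 <= 16
    s^2 costs the factor exp(8), and s^2 <= 32 r^2 gives the 32 in the exponent. *)
Lemma centered_small_ball Y (r z h : R) : gaussian_rv P Y -> ('E_P[Y] = 0)%E ->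
  0 < r -> (\int[P]_w (Y w ^+ 2)%:E = (r ^+ 2)%:E)%E -> 0 < h ->
  (P [set w | (`|Y w + z| < h)%R] <= (4 * h / r)%:E)%E /\
  (2 * h <= `|z| -> (P [set w | (`|Y w + z| < h)%R] <=
     (4 * h / r * (expR 8 * expR (- (z ^+ 2 / (32 * 16 * r ^+ 2)))))%:E)%E).
Proof.
move=> gY EY r0 vE h0.
have [m [s [law _ ms vs sv]]] := gaussian_centered gY EY vE.
have r20 : 0 < r ^+ 2 by rewrite exprn_gt0.
have s0 : s != 0 by apply: contraTneq vs => ->; rewrite expr0n/= mulr0 -ltNge.
have s00 : 0 < `|s| by rewrite normr_gt0.
have s20 : 0 < s ^+ 2 by rewrite exprn_even_gt0.
have rs : r <= 4 * `|s|.
  rewrite -(@ler_pXn2r _ 2)// ?nnegrE ?(ltW r0) ?mulr_ge0//.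
  by apply: (le_trans vs); rewrite exprMn real_normK ?num_real// -natrX.
have setE : [set w | (`|Y w + z| < h)%R] = Y @^-1` `]- z - h, - z + h[.
  apply/seteqP; split => w; rewrite /preimage/= in_itv/= ltr_norml => /andP[? ?];
  by apply/andP; split; lra.
have lenE : - z + h - (- z - h) = 2 * h by ring.
have peak : normal_peak s <= 2 / r.
  apply: (le_trans (normal_peak_le s0)).
  rewrite -[leRHS]invf_div lef_pV2 ?posrE ?mulr_gt0// ?divr_gt0//; lra.
have Ple c : 0 <= c -> (forall x, - z - h < x < - z + h -> normal_pdf m s x <= c) ->
    (P [set w | (`|Y w + z| < h)%R] <= (c * (2 * h))%:E)%E.
  move=> c0 pc; rewrite setE law; last exact: measurable_itv.
  rewrite (negbTE s0); apply: le_trans (normal_prob_itv (m := m) s0 _ c0 pc) _; first lra.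
  by rewrite lenE.
split.
  apply: le_trans (Ple (2 / r) _ _) _.
  - by rewrite divr_ge0// ltW.
  - by move=> x _; apply: le_trans (normal_pdf_ub _ _ s0) _.
  - by rewrite lee_fin le_eqVlt; apply/orP; left; apply/eqP; field; rewrite gt_eqF.
move=> hz; set e := expR 8 * _.
have e0 : 0 <= e by rewrite mulr_ge0 ?expR_ge0.
apply: le_trans (Ple (2 / r * e) _ _) _.
- by rewrite mulr_ge0// divr_ge0// ltW.
- move=> x /andP[zx xz]; rewrite /normal_pdf (negbTE s0); apply: ler_pM => //.
  + exact: normal_peak_ge0.
  + exact: normal_fun_ge0.
  rewrite /e -expRD /normal_fun ler_expR.
  have x2 : z ^+ 2 / 4 <= x ^+ 2.
    rewrite (_ : z ^+ 2 / 4 = (`|z| / 2) ^+ 2); last first.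
      by rewrite exprMn real_normK ?num_real//; field.
    rewrite -[leRHS]real_normK ?num_real// lerXn2r// ?nnegrE ?divr_ge0//.
    have : `|z| <= `|x| + `|- z - x| by rewrite -[`|z|]normrN; have := ler_normD x (- z - x); rewrite addrC subrK.
    have : `|- z - x| < h by rewrite ltr_norml; apply/andP; split; lra.
    lra.
  have xm : x ^+ 2 / 2 - m ^+ 2 <= (x - m) ^+ 2.
    by have := sqrrD_le (x - m) m; rewrite subrK; lra.
  have zs : z ^+ 2 / (16 * s ^+ 2) >= z ^+ 2 / (32 * 16 * r ^+ 2).
    rewrite ler_wpM2l ?sqr_ge0// lef_pV2 ?posrE; first by rewrite (mulrC 32 16) -mulrA ler_wpM2l.
      by rewrite (mulr_gt0 _ r20).
    by rewrite (mulr_gt0 _ s20).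
  have key : (x - m) ^+ 2 / (s ^+ 2 *+ 2) >= z ^+ 2 / (16 * s ^+ 2) - 8.
    rewrite (_ : z ^+ 2 / (16 * s ^+ 2) - 8 = (z ^+ 2 / 8 - 16 * s ^+ 2) / (s ^+ 2 *+ 2)); last by field.
    rewrite ler_wpM2r ?invr_ge0 ?mulrn_wge0 ?sqr_ge0//; clear -x2 xm ms; lra.
  by rewrite mulNr; clear -key zs; lra.
- by rewrite lee_fin le_eqVlt; apply/orP; left; apply/eqP; field; rewrite gt_eqF.
Qed.

End CenteredGaussian.

Section FBM.
Context {dO : measure_display} {Omega : measurableType dO} {R : realType}.
Variables (P : probability Omega R) (H : R) (X : R -> Omega -> R).
Hypothesis H_gt0 : 0 < H.
Hypothesis X_fbm : real_fbm P `[0, 1] H X.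

Lemma fbm_gaussian s t : 0 <= s <= 1 -> 0 <= t <= 1 ->
  gaussian_rv P (fun w => X t w - X s w).
Proof.
move=> s01 t01; have [gX _ _ _] := X_fbm.
have := gX 2%N (fun i => if i == 0 then t else s) (fun i => if i == 0 then 1 else -1).
rewrite (_ : (fun w => \sum_(i < 2) _) = fun w => X t w - X s w).
  by apply => i; case: ifP => _; rewrite /= in_itv.
by apply/funext => w; rewrite !big_ord_recl big_ord0 /= addr0 mul1r mulN1r.
Qed.

Lemma fbm_gaussian1 t : 0 <= t <= 1 -> gaussian_rv P (X t).
Proof.
move=> t01; have [gX _ _ _] := X_fbm.
have := gX 1%N (fun=> t) (fun=> 1).
rewrite (_ : (fun w => \sum_(i < 1) _) = X t).
  by apply => i; rewrite /= in_itv.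
by apply/funext => w; rewrite big_ord_recl big_ord0 addr0 mul1r.
Qed.

Lemma fbm_measurable t : 0 <= t <= 1 -> measurable_fun setT (X t).
Proof. by move=> /fbm_gaussian1[]. Qed.

Lemma fbm_increment s t : 0 <= s <= 1 -> 0 <= t <= 1 ->
  ('E_P[(fun w => X t w - X s w)%R] = 0)%E /\
  (\int[P]_w ((X t w - X s w) ^+ 2)%:E = ((`|t - s| `^ H) ^+ 2)%:E)%E.
Proof.
move=> s01 t01; have [_ EX covX _] := X_fbm.
have I u : 0 <= u <= 1 -> (`[0, 1]%classic : set R) u by rewrite /= in_itv.
have Xs2 := gaussian_Lfun2 (fbm_gaussian1 s01).
have Xt2 := gaussian_Lfun2 (fbm_gaussian1 t01).
have Pfin : P setT \is a fin_num by exact: fin_num_measure.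
have E0 : ('E_P[(fun w => X t w - X s w)%R] = 0)%E.
  rewrite (@expectationB _ _ _ P (X t) (X s)) ?EX ?sube0//; try exact: I.
    exact: Lfun_subset12.
  exact: Lfun_subset12.
split => //.
have := varianceB Xt2 Xs2.
rewrite (@varianceE _ _ _ P (fun w => X t w - X s w)); last exact: gaussian_Lfun2 (fbm_gaussian s01 t01).
rewrite E0 expe2 mule0 sube0 /variance !covX; try exact: I.
rewrite !subrr normr0 powR0 ?subr0; last by rewrite mulf_neq0// gt_eqF.
have -> : ('E_P[((fun w => X t w - X s w) ^+ 2)%R] =
    \int[P]_w ((X t w - X s w) ^+ 2)%:E)%E by rewrite unlock.
move=> ->; rewrite -EFinM -EFinD; congr EFin => /=.
rewrite distrC -powR_mulrn ?powR_ge0// -powRrM (mulrC 2 H).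
by field.
Qed.

End FBM.

Section SmallBall.
Context {dO : measure_display} {Omega : measurableType dO} {R : realType}.
Variables (P : probability Omega R) (H : R) (d : nat) (B : R -> Omega -> 'rV[R]_d).
Hypothesis H_gt0 : 0 < H.
Hypothesis B_fbm : fbm P `[0, 1] H B.

Lemma process_increment_measurable (X : R -> Omega -> R) s t (S : set R) :
  0 <= s <= 1 -> 0 <= t <= 1 -> measurable S ->
  process_sigma_algebra `[0, 1] X ((fun w => X t w - X s w) @^-1` S).
Proof.
move=> s01 t01 mS.
set G := [set A | exists2 t, (`[0, 1]%classic : set R) t &
         exists2 S : set R, measurable S & A = X t @^-1` S].
have mX u : 0 <= u <= 1 -> measurable_fun setT (X u : g_sigma_algebraType G -> R).
  move=> u01 _ Y mY; rewrite setTI; apply: sub_sigma_algebra.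
  by exists u; [rewrite /= in_itv|exists Y].
have := measurable_funB (mX t t01) (mX s s01).
by move=> /(_ measurableT S mS); rewrite setTI.
Qed.

Lemma independent_increments s t (z : 'rV[R]_d) h : 0 <= s <= 1 -> 0 <= t <= 1 ->
  P [set w | forall i, `|B t w 0 i - B s w 0 i + z 0 i| < h] =
  (\prod_(i < d) P [set w | (`|(B t w 0 i - B s w 0 i) + z 0 i| < h)%R])%E.
Proof.
move=> s01 t01; have [_ ind] := B_fbm.
rewrite -ind.
  congr (P _); apply/seteqP; split=> w /= Bw i; first by move=> _; exact: Bw.
  exact: Bw.
move=> i.
apply: (@process_increment_measurable (fun t w => B t w 0 i) s t [set x | `|x + z 0 i| < h]) => //.
rewrite (_ : [set x | _] = `]- z 0 i - h, - z 0 i + h[%classic); first exact: measurable_itv.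
by apply/seteqP; split => x /=; rewrite in_itv/= ltr_norml => /andP[? ?]; apply/andP; split; lra.
Qed.

Lemma expn_gauss_le (c x : R) q : 0 < c -> 1 <= x ->
  x ^+ q * expR (- (x ^+ 2 / c)) <= c ^+ q * q`!%:R.
Proof.
move=> c0 x1; have x0 : 0 <= x by apply: le_trans x1.
rewrite expRN -ler_pdivlMr ?invr_gt0 ?expR_gt0// invrK -mulrA.
apply: (@le_trans _ _ (c ^+ q * (x ^+ 2 / c) ^+ q)); last first.
  by rewrite ler_wpM2l ?exprn_ge0 ?(ltW c0)// exprn_le_expR// divr_ge0 ?sqr_ge0// ltW.
rewrite -exprMn mulrCA divff ?mulr1 ?gt_eqF// lerXn2r ?nnegrE ?sqr_ge0//.
by rewrite expr2 ler_peMl.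
Qed.

(** The last factor d^d pays for bounding the Euclidean norm by d times the largest coordinate; the
    rest is the constant of [small_ball_max]. *)
Definition small_ball_cst : R :=
  4 ^+ d * (expR 8 * ((32 * 16) ^+ d * d`!%:R)) * d%:R ^+ d.

Lemma small_ball_cst_ge0 : 0 <= small_ball_cst.
Proof. by rewrite /small_ball_cst !mulr_ge0 ?exprn_ge0 ?expR_ge0. Qed.

Lemma small_ball_max (s t : R) (z : 'rV[R]_d) (h : R) i0 : 0 <= s <= 1 -> 0 <= t <= 1 ->
  (forall i, `|z 0 i| <= `|z 0 i0|) -> 0 < h ->
  let m := Num.max (`|t - s| `^ H) `|z 0 i0| in 0 < m ->
  (P [set w | forall i, (`|B t w 0 i - B s w 0 i + z 0 i| < h)%R] <=
   ((4 * h / m) ^+ d * (expR 8 * ((32 * 16) ^+ d * d`!%:R)))%:E)%E.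
Proof.
move=> s01 t01 zM h0 m m0; rewrite independent_increments//.
set r := `|t - s| `^ H in m m0 *; set M := `|z 0 i0| in m m0 zM *.
pose p i := P [set w | (`|(B t w 0 i - B s w 0 i) + z 0 i| < h)%R].
have [X_fbm _] := B_fbm.
have p1 i : (p i <= 1)%E.
  apply: probability_le1; rewrite -[X in measurable X]setTI.
  have mN : measurable_fun setT (fun w => `|(B t w 0 i - B s w 0 i) + z 0 i|).
    apply: measurableT_comp => //; apply: measurable_funD => //.
    exact: (fbm_gaussian (X_fbm i) s01 t01).1.
  by have := mN measurableT _ (measurable_itv `]-oo, h[); congr measurable; apply/seteqP; split => w /=; rewrite in_itv.
have p0 i : (0 <= p i)%E by exact: measure_ge0.
set K := expR 8 * _.
have K1 : 1 <= K.
  have e1 : 1 <= expR 8 :> R by rewrite -expR0 ler_expR.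
  have q1 : 1 <= 32 * 16 :> R by rewrite mulr_ege1// ler1n.
  by rewrite /K (mulr_ege1 e1)// mulr_ege1// ?exprn_ege1// ler1n fact_gt0.
have K0 : 0 <= K by apply: le_trans K1.
have prod_le (c : R) : (forall i, p i <= c%:E)%E -> (\prod_(i < d) p i <= (c ^+ d)%:E)%E.
  move=> pc.
  suff : (0 <= \prod_(i < d) p i <= (\prod_(i < d) c)%:E)%E by rewrite prodr_const card_ord => /andP[].
  elim/big_rec2: _ => [|i x y _ /andP[x0 xy]]; first by rewrite lee01 lexx.
  by rewrite mule_ge0// EFinM lee_pmul.
have c0 : 0 <= 4 * h / m by rewrite divr_ge0 ?mulr_ge0 ?(ltW h0) ?(ltW m0).
(* If r dominates M, bound each density by its maximum; if M > r, the Gaussian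
   tail in the direction i0 of the largest shift absorbs the factor (M / r)^d. *)
have [m2h|hm] := leP m (2 * h).
  apply: le_trans (prod_le 1 p1) _.
  rewrite expr1n lee_fin mulr_ege1// exprn_ege1// ler_pdivlMr// mul1r.
  by apply: (le_trans m2h); lra.
have sb i : 0 < r -> _ := fun r0 => centered_small_ball (z 0 i)
  (fbm_gaussian (X_fbm i) s01 t01) (fbm_increment H_gt0 (X_fbm i) s01 t01).1 r0
  (fbm_increment H_gt0 (X_fbm i) s01 t01).2 h0.
have [Mr|rM] := leP M r.
  have mE : m = r by rewrite /m; apply/max_idPl.
  have r0 : 0 < r by rewrite -mE.
  have := prod_le (4 * h / m) (fun i => ltac:(rewrite mE; exact: (sb i r0).1)).
  by move=> /le_trans; apply; rewrite lee_fin ler_peMr// exprn_ge0.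
have mE : m = M by rewrite /m; apply/max_idPr/ltW.
rewrite mE in hm m0 c0 *.
have d0 : (0 < d)%N by apply: leq_ltn_trans (ltn_ord i0).
(* If r = 0 then s = t and the increment vanishes; coordinate i0 would need |z_i0| < h while |z_i0|
   > 2h, so its event is empty. *)
have [r0|r0] := ltP 0 r; last first.
  have rE : r = 0 by apply/eqP; rewrite eq_le r0 powR_ge0.
  have ts : t = s.
    apply/eqP; rewrite -subr_eq0 -normr_eq0.
    by have := rE => /eqP; rewrite /r powR_eq0 => /andP[].
  suff pi0 : p i0 = 0%E.
    rewrite (bigD1 i0)//= -/(p i0) pi0 mul0e lee_fin mulr_ge0// exprn_ge0//.
  rewrite /p (_ : [set w | _] = set0) ?measure0//.
  apply/seteqP; split => // w /=; rewrite ts subrr add0r -/M.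
  by apply/negP; rewrite -leNgt; lra.
set x := M / r.
have x1 : 1 <= x by rewrite ler_pdivlMr// mul1r ltW.
have zx : z 0 i0 ^+ 2 / (32 * 16 * r ^+ 2) = x ^+ 2 / (32 * 16).
  rewrite /x exprMn exprVn -(real_normK (num_real (z 0 i0))) -/M (invfM (32 * 16) (r ^+ 2)).
  by rewrite [(32 * 16)^-1 / _]mulrC mulrA.
have pi0 : (p i0 <= (4 * h / r * (expR 8 * expR (- (x ^+ 2 / (32 * 16)))))%:E)%E.
  by rewrite -zx; apply: (sb i0 r0).2; rewrite -/M ltW.
apply: (@le_trans _ _ ((4 * h / r) ^+ d * (expR 8 * expR (- (x ^+ 2 / (32 * 16)))))%:E).
  rewrite (bigD1 i0)//= -/(p i0).
  have : (0 <= \prod_(i < d | i != i0) p i <= ((4 * h / r) ^+ d.-1)%:E)%E.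
    suff : (0 <= \prod_(i < d | i != i0) p i <= (\prod_(i < d | i != i0) (4 * h / r))%:E)%E.
      by rewrite prodr_const cardC1 card_ord.
    elim/big_rec2: _ => [|i u y _ /andP[u0 uy]]; first by rewrite lee01 lexx.
    rewrite mule_ge0// EFinM lee_pmul//; exact: (sb i r0).1.
  move=> /andP[q0 q1]; apply: le_trans (lee_pmul _ q0 pi0 q1) _ => //.
  by rewrite -EFinM mulrAC -[X in X * _](@exprS _ _ d.-1) prednK.
rewrite lee_fin.
have -> : 4 * h / r = 4 * h / M * x by rewrite /x; field; rewrite !gt_eqF.
rewrite (exprMn d (4 * h / M) x) -[leLHS]mulrA ler_wpM2l ?exprn_ge0//.
rewrite mulrCA ler_wpM2l ?expR_ge0//.
by apply: expn_gauss_le => //; exact: mulr_gt0.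
Qed.

Lemma fbm_small_ball (s t : R) (z : 'rV[R]_d) (h : R) : (0 < d)%N -> 0 <= s <= 1 -> 0 <= t <= 1 ->
  0 < h ->
  (P [set w | forall i, (`|B t w 0 i - B s w 0 i + z 0 i| < h)%R] <=
   (small_ball_cst * h ^+ d)%:E * ((Num.max (`|t - s| `^ H) (enorm z) `^ d%:R)%:E)^-1)%E.
Proof.
move=> d0 s01 t01 h0; set rho := Num.max _ _.
pose i0 : 'I_d := [arg max_(i > Ordinal d0) `|z 0 i|]%O.
have zM i : `|z 0 i| <= `|z 0 i0|.
  by rewrite /i0; case: arg_maxP => //= j _ /(_ i isT).
have d1 : 1 <= d%:R :> R by rewrite ler1n.
have enz : enorm z <= d%:R * `|z 0 i0|.
  rewrite /enorm -[leRHS]ger0_norm ?mulr_ge0// -sqrtr_sqr ler_wsqrtr// exprMn.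
  apply: (@le_trans _ _ (\sum_(i < d) `|z 0 i0| ^+ 2)).
    by apply: ler_sum => i _; rewrite -real_normK ?num_real// lerXn2r ?nnegrE.
  rewrite sumr_const card_ord -[leLHS]mulr_natl ler_wpM2r ?sqr_ge0//.
  by rewrite expr2 ler_peMl.
set r := `|t - s| `^ H; set m := Num.max r `|z 0 i0|.
have r0 : 0 <= r by exact: powR_ge0.
have rhom : rho <= d%:R * m.
  rewrite /rho ge_max; apply/andP; split.
    by apply: (@le_trans _ _ (1 * m)); [rewrite mul1r le_max lexx|rewrite ler_wpM2r// le_max r0].
  by apply: (le_trans enz); rewrite ler_wpM2l// le_max lexx orbT.
have rho0 : 0 <= rho by rewrite le_max r0.
rewrite powR_mulrn// inver expf_eq0 d0 /=.
have K0 : 0 < small_ball_cst.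
  rewrite /small_ball_cst !mulr_gt0 ?exprn_gt0 ?expR_gt0//.
  by rewrite ltr0n.
(* At rho = 0 the inverse is +oo and the bound is trivial. *)
have [_|rhoN0] := eqVneq rho 0.
  by rewrite gt0_muley ?leey// lte_fin mulr_gt0// exprn_gt0.
have rhogt0 : 0 < rho by rewrite lt_neqAle eq_sym rhoN0.
have m0 : 0 < m.
  rewrite ltNge; apply/negP => m0; move: rhogt0; rewrite ltNge; case/negP.
  by apply: (le_trans rhom); rewrite mulr_ge0_le0.
apply: le_trans (small_ball_max s01 t01 zM h0 m0) _.
rewrite -EFinM lee_fin /small_ball_cst -/m.
set K := expR 8 * _.
have -> : 4 ^+ d * K * d%:R ^+ d * h ^+ d / rho ^+ d = (4 * h) ^+ d * (d%:R ^+ d / rho ^+ d) * K.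
  by rewrite (exprMn d 4 h); ring.
rewrite ler_wpM2r ?mulr_ge0 ?expR_ge0 ?exprn_ge0//.
rewrite exprMn ler_wpM2l ?exprn_ge0 ?mulr_ge0 ?(ltW h0)//.
rewrite -expr_div_n lerXn2r ?nnegrE ?invr_ge0 ?divr_ge0// ?(ltW m0)//.
by rewrite ler_pdivlMr// mulrC ler_pdivrMr.
Qed.

End SmallBall.

(** * The random field (t, x) |-> B_t + x and its joint measurability *)

Section JointMeasurability.
Context {dO : measure_display} {Omega : measurableType dO} {R : realType}.
Variable X : R -> Omega -> R.
Hypothesis mX : forall t, measurable_fun setT (X t).
Hypothesis cX : forall w, continuous (X ^~ w).

(** Freezing time at the grid of mesh 1 / k.+1 gives a process that is measurable piece by piece
    over countably many time intervals; it converges to X because the paths are continuous. *)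
Lemma measurable_process : measurable_fun setT (fun p : Omega * R => X p.2 p.1).
Proof.
pose Y k (p : Omega * R) := X ((Num.floor (k.+1%:R * p.2))%:~R / k.+1%:R) p.1.
apply: (@measurable_fun_cvg _ _ _ _ Y) => //.
- move=> k _ S mS; rewrite setTI.
  rewrite (_ : _ @^-1` _ = \bigcup_(j : int) (X (j%:~R / k.+1%:R) @^-1` S `*`
      `[j%:~R / k.+1%:R, (j + 1)%:~R / k.+1%:R[)).
    apply: countable_bigcupT_measurable => [|j]; first exact: countableP.
    apply: measurableX => //.
    by rewrite -[X in measurable X]setTI; exact: mX.
  apply/seteqP; split => [[w t] /= SY|[w t] /= [j _ [/= Sj]]].
    exists (Num.floor (k.+1%:R * t)) => //=; split => //=.
    by rewrite in_itv/= ler_pdivrMr// ltr_pdivlMr// mulrC floor_le floorD1_gt.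
  rewrite in_itv/= ler_pdivrMr// ltr_pdivlMr// => /andP[jt tj].
  by rewrite /Y /= (@floor_def _ _ j)// mulrC jt tj.
- move=> [w t] _ /=; rewrite /Y /=.
  have := @cX w t; apply: (@cvg_comp _ _ _ (fun k : nat =>
    (Num.floor (k.+1%:R * t))%:~R / k.+1%:R) (X ^~ w) _ (nbhs (t : R))).
  apply: (@squeeze_cvgr _ _ _ _ (fun k => (t : R) - k.+1%:R^-1) (cst (t : R))).
  + apply: nearW => k /=; rewrite ler_pdivlMr// ler_pdivrMr//.
    rewrite mulrBl mulVf// lerBlDr mulrC.
    by have := floorD1_gt (k.+1%:R * t); have := floor_le (k.+1%:R * t); rewrite intrD; lra.
  + rewrite -[X in _ --> X]subr0; apply: cvgB; first exact: cvg_cst.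
    exact: cvg_harmonic.
  + exact: cvg_cst.
Qed.

End JointMeasurability.

Section PathField.
Context {dO : measure_display} {Omega : measurableType dO} {R : realType}.
Variables (P : probability Omega R) (H : R) (d : nat) (B : R -> Omega -> 'rV[R]_d.+1).
Hypothesis B_fbm : fbm P `[0, 1] H B.
Let T := (R * 'rV[R]_d.+1)%type.

(** The paths are continuous only on [0, 1]; clamping time extends them to continuous functions on
    the line, so that [path_field] is continuous on the whole product space. *)
Definition clamp01 (t : R) : R := Num.max 0 (Num.min 1 t).

Lemma clamp01_itv t : 0 <= clamp01 t <= 1.
Proof. by rewrite /clamp01 le_max lexx ge_max ler01 ge_min lexx. Qed.

Lemma clamp01_id t : 0 <= t <= 1 -> clamp01 t = t.
Proof. by move=> /andP[t0 t1]; rewrite /clamp01 (min_idPr t1) (max_idPr t0). Qed.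

Lemma continuous_clamp01 : continuous clamp01.
Proof.
move=> t; apply: (@continuous_max _ _ (cst 0)); first exact: cvg_cst.
by apply: (@continuous_min _ _ (cst 1)); [exact: cvg_cst|exact: cvg_id].
Qed.

Lemma continuous_path w i : continuous (fun t => B (clamp01 t) w 0 i).
Proof.
move=> t; have [/(_ i)[_ _ _ /(_ w) /subspace_continuousP Bc] _] := B_fbm.
have tI u : (`[0, 1]%classic : set R) (clamp01 u) by rewrite /= in_itv/= clamp01_itv.
apply: (@cvg_comp _ _ _ clamp01 (fun u => B u w 0 i) _
  (within (`[0, 1]%classic : set R) (nbhs (clamp01 t)))); last exact: Bc.
move=> A; rewrite /within/= => wA.
have := continuous_clamp01 wA; apply: (@filterS _ (nbhs t)) => u /=.
by apply; exact: tI.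
Qed.

Definition path_field w (p : T) : 'rV[R]_d.+1 := B (clamp01 p.1) w + p.2.

Lemma continuous_path_field w : continuous (path_field w).
Proof.
move=> p; apply: cvg_rV => i.
rewrite [X in _ --> X](_ : _ = B (clamp01 p.1) w 0 i + p.2 0 i); last by rewrite mxE.
under eq_cvg do rewrite mxE.
apply: cvgD; last exact: continuous_coord.
apply: (@cvg_comp _ _ _ fst (fun t => B (clamp01 t) w 0 i) _ (nbhs p.1)); first exact: cvg_fst.
exact: continuous_path.
Qed.

Lemma measurable_path t i : measurable_fun setT (fun w => B (clamp01 t) w 0 i).
Proof.
have [/(_ i) Bi _] := B_fbm.
exact: (@fbm_measurable _ _ _ P H (fun t w => B t w 0 i)) (clamp01_itv t).
Qed.

Lemma measurable_path_field p i : measurable_fun setT (fun w => path_field w p 0 i).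
Proof.
rewrite (_ : (fun _ => _) = (fun w => B (clamp01 p.1) w 0 i + p.2 0 i)); last first.
  by apply/funext => w; rewrite mxE.
by apply: measurable_funD => //; exact: measurable_path.
Qed.

Lemma continuous_borel_measurable (S : ptopologicalType) (g : S -> R) :
  continuous g -> measurable_fun setT (g : borel S -> R).
Proof.
move=> /continuousP cg; apply: (measurability _ (RGenOInfty.measurableE R)) => /=.
move=> _ [_ [a ->] <-]; rewrite setTI; apply: sub_sigma_algebra.
by apply: cg; exact: interval_open.
Qed.

Lemma measurable_path_field_joint i :
  measurable_fun setT (fun x : Omega * borel T => path_field x.1 x.2 0 i).
Proof.
rewrite (_ : (fun _ => _) = (fun x : Omega * borel T =>
    B (clamp01 (x.2 : T).1) x.1 0 i + (x.2 : T).2 0 i)); last first.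
  by apply/funext => w; rewrite mxE.
apply: measurable_funD.
  apply: (@measurableT_comp _ _ _ _ _ _ (fun p : Omega * R => B (clamp01 p.2) p.1 0 i) _
    (fun x : Omega * borel T => (x.1, (x.2 : T).1))).
    apply: (@measurable_process _ _ _ (fun t w => B (clamp01 t) w 0 i)).
      by move=> t; exact: measurable_path.
    by move=> w; exact: continuous_path.
  apply: measurable_fun_pair; first exact: measurable_fst.
  apply: (@measurableT_comp _ _ _ _ _ _ (fst : borel T -> R)); last exact: measurable_snd.
  by apply: continuous_borel_measurable => p; exact: cvg_fst.
apply: (@measurableT_comp _ _ _ _ _ _ (fun p : borel T => (p : T).2 0 i)); last exact: measurable_snd.
by apply: continuous_borel_measurable; exact: continuous_coord.
Qed.

End PathField.

(** * The lower bound *)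

Lemma sqr_sum_le (R : realFieldType) (I : Type) (s : seq I) (a : I -> R) :
  (\sum_(i <- s) a i) ^+ 2 <= (size s)%:R * \sum_(i <- s) a i ^+ 2.
Proof.
set S := \sum_(i <- s) a i; set Q := \sum_(i <- s) _; set n : R := (size s)%:R.
have [n0|n0] := eqVneq n 0.
  have s0 : s = [::] by apply/size0nil/eqP; rewrite -(eqr_nat R) -/n n0.
  by rewrite /S s0 big_nil expr0n n0 mul0r.
have ngt0 : 0 < n by rewrite lt_neqAle eq_sym n0 /n ler0n.
have : 0 <= \sum_(i <- s) (a i - S / n) ^+ 2 by apply: sumr_ge0 => i _; exact: sqr_ge0.
have -> : \sum_(i <- s) (a i - S / n) ^+ 2 = Q - S ^+ 2 / n.
  under eq_bigr => i _ do rewrite sqrrB.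
  rewrite big_split/= sumrB -/Q (_ : \sum_(i <- s) (S / n) ^+ 2 = S ^+ 2 / n); last first.
    by rewrite big_const_seq count_predT iter_addr_0 -mulr_natr -/n; field; rewrite -/n.
  by rewrite sumrMnl -mulr_suml -/S; field; rewrite -/n.
by rewrite subr_ge0 ler_pdivrMr// mulrC.
Qed.

Lemma measure_bigsetU_seq d (T : measurableType d) (R : realType)
    (mu : {measure set T -> \bar R}) (I : eqType) (F : I -> set T) (s : seq I) :
  (forall i, measurable (F i)) -> uniq s -> trivIset [set` s] F ->
  mu (\big[setU/set0]_(i <- s) F i) = (\sum_(i <- s) mu (F i))%E.
Proof.
move=> mF us tF; have mU : measurable (\big[setU/set0]_(i <- s) F i) by exact: bigsetU_measurable.
have /= := @ge0_integral_bigsetU _ _ _ mu _ F (cst 1%E) s mF us tF.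
rewrite integral_cst// mul1e => -> //; apply: eq_bigr => i _.
by rewrite integral_cst ?mul1e.
Qed.

(** The blocks F i x F i are disjoint and lie in G, so the sum of the squared masses is at most the
    product mass of G; Cauchy-Schwarz compares it with the square of the sum. *)
Lemma measure_sqr_le_self_product d (T : measurableType d) (R : realType)
    (mu : probability T R) (I : choiceType) (F : I -> set T) (s : seq I) (K : set T)
    (G : set (T * T)) :
  (forall i, measurable (F i)) -> uniq s -> trivIset [set` s] F ->
  measurable K -> K `<=` \bigcup_(i in [set` s]) F i ->
  measurable G -> (forall i, i \in s -> F i `*` F i `<=` G) ->
  (mu K * mu K <= (size s)%:R%:E * (mu \x mu) G)%E.
Proof.
move=> mF us tF mK KF mG FG.
have fin A : measurable A -> mu A \is a fin_num by move=> mA; exact: fin_num_measure.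
have KU : K `<=` \big[setU/set0]_(i <- s) F i by rewrite bigcup_seq in KF.
pose a i := fine (mu (F i)).
have aE i : mu (F i) = (a i)%:E by rewrite /a fineK// fin.
have muK : (mu K <= (\sum_(i <- s) a i)%:E)%E.
  rewrite -sumEFin; under eq_bigr do rewrite -aE.
  rewrite -measure_bigsetU_seq//; apply: le_measure => //; rewrite inE//.
  by apply: bigsetU_measurable.
have GE : ((\sum_(i <- s) a i ^+ 2)%:E <= (mu \x mu) G)%E.
  pose F2 i := F i `*` F i.
  have mF2 i : measurable (F2 i) by exact: measurableX.
  have tF2 : trivIset [set` s] F2.
    by move=> i j si sj [[x y] [[/= ix _] [jx _]]]; apply: tF => //; exists x.
  apply: (@le_trans _ _ ((mu \x mu)%E (\big[setU/set0]_(i <- s) F2 i))); last first.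
    apply: le_measure; rewrite ?inE//; first exact: bigsetU_measurable.
    by rewrite -bigcup_seq => x [i /= si ix]; exact: FG ix.
  rewrite measure_bigsetU_seq// -sumEFin le_eqVlt; apply/orP; left; apply/eqP.
  apply: eq_bigr => i _.
  transitivity (mu (F i) * mu (F i))%E; first by rewrite !aE -EFinM expr2.
  exact: esym (product_measure1E mu mu (mF i) (mF i)).
apply: (@le_trans _ _ ((\sum_(i <- s) a i) ^+ 2)%:E).
  by rewrite expr2 EFinM; apply: lee_pmul.
apply: (@le_trans _ _ ((size s)%:R%:E * (\sum_(i <- s) a i ^+ 2)%:E)%E).
  by rewrite -EFinM lee_fin sqr_sum_le.
by rewrite lee_wpmul2l.
Qed.

Lemma measurable_inve d (T : measurableType d) (R : realType) (g : T -> R) :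
  measurable_fun setT g -> (forall x, 0 <= g x) ->
  measurable_fun setT (fun x => ((g x)%:E)^-1)%E.
Proof.
move=> mg g0.
rewrite (_ : (fun _ => _) = fun x => if g x == 0 then +oo%E else ((g x)^-1)%:E); last first.
  by apply/funext => x; rewrite inver.
apply: measurable_fun_ifT => //.
  apply: (measurable_fun_bool true); rewrite setTI.
  rewrite (_ : _ @^-1` _ = g @^-1` [set 0]); last by apply/seteqP; split => x /= /eqP.
  by rewrite -[X in measurable X]setTI; exact: mg.
apply/measurable_EFinP; rewrite (_ : (fun _ => _) = fun x => g x `^ (-1)); last first.
  by apply/funext => x; rewrite powR_inv1.
exact: (measurableT_comp (measurable_powR (-1)) mg).
Qed.

(** * Energy, expected overlap and the positive-measure estimate *)

Section Energy.
Context {R : realType} {d : nat}.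
Let T := (R * 'rV[R]_d)%type.

Lemma measurable_parabolic (H : R) :
  measurable_fun setT (fun u : borel T * borel T => parabolic H u.1 u.2).
Proof.
have m1 : measurable_fun setT (fun p : borel T => (p : T).1).
  by apply: continuous_borel_measurable => p; exact: cvg_fst.
have m2 i : measurable_fun setT (fun p : borel T => (p : T).2 0 i).
  by apply: continuous_borel_measurable; exact: continuous_coord.
apply: measurable_maxr.
  apply: (@measurableT_comp _ _ _ _ _ _ (fun x : R => x `^ H)); first exact: measurable_powR.
  apply: measurableT_comp => //; apply: measurable_funB.
    by apply: (measurableT_comp m1); exact: measurable_snd.
  by apply: (measurableT_comp m1); exact: measurable_fst.
apply: (@measurableT_comp _ _ _ _ _ _ (@Num.sqrt R)).
  by apply: continuous_measurable_fun; exact: sqrt_continuous.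
apply: measurable_sum => i; apply: measurable_funX.
rewrite (_ : (fun _ => _) = fun u : borel T * borel T => (u.1 : T).2 0 i - (u.2 : T).2 0 i); last first.
  by apply/funext => u; rewrite !mxE.
apply: measurable_funB.
  by apply: (measurableT_comp (m2 i)); exact: measurable_fst.
by apply: (measurableT_comp (m2 i)); exact: measurable_snd.
Qed.

Lemma parabolic_ge0 (H : R) (p q : T) : 0 <= parabolic H p q.
Proof. by rewrite /parabolic le_max powR_ge0. Qed.

Lemma energyE (H b : R) (mu : probability (borel T) R) :
  energy (@parabolic R d H) b mu =
  (\int[mu \x mu]_u ((parabolic H u.1 u.2 `^ b)%:E)^-1)%E.
Proof.
rewrite [RHS]fubini_tonelli1//; last first.
- by move=> u; rewrite inve_ge0 lee_fin powR_ge0.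
- apply: measurable_inve; last by move=> u; exact: powR_ge0.
  apply: (@measurableT_comp _ _ _ _ _ _ (fun x : R => x `^ b)); first exact: measurable_powR.
  exact: measurable_parabolic.
Qed.

End Energy.

Section Occupation.
Context {dO : measure_display} {Omega : measurableType dO} {R : realType}.
Variables (P : probability Omega R) (H : R) (d : nat) (B : R -> Omega -> 'rV[R]_d.+1).
Hypothesis H_gt0 : 0 < H.
Hypothesis B_fbm : fbm P `[0, 1] H B.
Let T := (R * 'rV[R]_d.+1)%type.
Variable mu : probability (borel T) R.
Let mu2 : probability (borel T * borel T)%type R := (mu \x mu)%E.
Variable K : set T.
Hypothesis K_measurable : measurable (K : set (borel T)).
Hypothesis K_time : forall p, K p -> 0 <= p.1 <= 1.

Definition near_pairs (h : R) : set (Omega * (borel T * borel T)) :=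
  [set x | [/\ K x.2.1, K x.2.2 & forall i,
    `|path_field B x.1 x.2.1 0 i - path_field B x.1 x.2.2 0 i| < h]].

Lemma measurable_near_pairs h : measurable (near_pairs h).
Proof.
have -> : near_pairs h = (setT `*` (K `*` K)) `&` \bigcap_(i in [set: 'I_d.+1])
    [set x | `|path_field B x.1 x.2.1 0 i - path_field B x.1 x.2.2 0 i| < h].
  by apply/seteqP; split => [[w [p q]] [/= Kp Kq xh]|[w [p q]] [[/= _ [Kp Kq]] xh]];
    split => // i; [move=> _; exact: xh|exact: xh].
apply: measurableI; first by apply: measurableX => //; exact: measurableX.
apply: fin_bigcap_measurable => // i _.
have m1 : measurable_fun setT (fun x : Omega * (borel T * borel T) => path_field B x.1 x.2.1 0 i).
  apply: (@measurableT_comp _ _ _ _ _ _ (fun x : Omega * borel T => path_field B x.1 x.2 0 i) _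
    (fun x : Omega * (borel T * borel T) => (x.1, x.2.1))); first exact: measurable_path_field_joint B_fbm i.
  apply: measurable_fun_pair; first exact: measurable_fst.
  by apply: (@measurableT_comp _ _ _ _ _ _ (@fst (borel T) (borel T))); [exact: measurable_fst|exact: measurable_snd].
have m2 : measurable_fun setT (fun x : Omega * (borel T * borel T) => path_field B x.1 x.2.2 0 i).
  apply: (@measurableT_comp _ _ _ _ _ _ (fun x : Omega * borel T => path_field B x.1 x.2 0 i) _
    (fun x : Omega * (borel T * borel T) => (x.1, x.2.2))); first exact: measurable_path_field_joint B_fbm i.
  apply: measurable_fun_pair; first exact: measurable_fst.
  by apply: (@measurableT_comp _ _ _ _ _ _ (@snd (borel T) (borel T))); exact: measurable_snd.
have mN : measurable_fun setT (fun x : Omega * (borel T * borel T) =>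
    `|path_field B x.1 x.2.1 0 i - path_field B x.1 x.2.2 0 i|).
  by apply: measurableT_comp => //; exact: measurable_funB.
have := mN measurableT _ (measurable_itv `]-oo, h[).
by rewrite setTI; congr measurable.
Qed.

Definition overlap h w : \bar R := mu2 (xsection (near_pairs h) w).

Lemma measurable_overlap h : measurable_fun setT (overlap h).
Proof. by apply: (measurable_fun_xsection mu2); exact: measurable_near_pairs. Qed.

(** By Tonelli the expectation goes inside. For fixed p and q in K the event is a small ball of the
    increment shifted by p.2 - q.2, and [fbm_small_ball] returns the energy kernel. *)
Lemma integral_overlap_le h : 0 < h ->
  (\int[P]_w overlap h w <=
   (small_ball_cst d.+1 * h ^+ d.+1)%:E * energy (@parabolic R d.+1 H) d.+1%:R mu)%E.
Proof.
move=> h0; have mG := measurable_near_pairs h.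
have := indic_fubini_tonelli P mu2 mG.
rewrite indic_fubini_tonelli_FE// indic_fubini_tonelli_GE// => /= ->.
set C := small_ball_cst _ * _.
have C0 : 0 <= C by rewrite mulr_ge0 ?exprn_ge0 ?(ltW h0)// small_ball_cst_ge0.
have mrho : measurable_fun setT (fun u : borel T * borel T =>
    (((parabolic H u.1 u.2 `^ d.+1%:R)%:E)^-1)%E).
  apply: measurable_inve; last by move=> u; exact: powR_ge0.
  apply: (@measurableT_comp _ _ _ _ _ _ (fun x : R => x `^ d.+1%:R)); first exact: measurable_powR.
  exact: measurable_parabolic.
rewrite energyE -ge0_integralZl//; last first.
  by move=> u _; rewrite inve_ge0 lee_fin powR_ge0.
apply: ge0_le_integral => //.
- exact: measurable_fun_ysection.
- by apply: emeasurable_funM => //; exact: measurable_cst.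
- move=> [p q] _ /=.
  have [[Kp Kq]|Kpq] := pselect (K p /\ K q); last first.
    rewrite (_ : ysection _ _ = set0) ?measure0; last first.
      by apply/seteqP; split => // w; rewrite /ysection/= inE => -[? ? _]; case: Kpq.
    by rewrite mule_ge0// inve_ge0 lee_fin powR_ge0.
  have -> : ysection (near_pairs h) (p, q) =
      [set w | forall i, `|B p.1 w 0 i - B q.1 w 0 i + (p.2 - q.2) 0 i| < h].
    have coordE w i : path_field B w p 0 i - path_field B w q 0 i =
        B p.1 w 0 i - B q.1 w 0 i + (p.2 - q.2) 0 i.
      by rewrite /path_field !mxE !clamp01_id ?K_time//; ring.
    apply/seteqP; split => w; rewrite /ysection/= inE.
      by move=> [_ _ wh] i; rewrite -coordE.
    by move=> wh; split => // i; rewrite coordE.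
  rewrite /parabolic distrC.
  exact: (fbm_small_ball H_gt0 B_fbm (p.2 - q.2) (ltn0Sn d) (K_time Kq) (K_time Kp) h0).
Qed.

End Occupation.

(** The lower limit of the events is an increasing union of intersections, each contained in one of
    the F n. *)
Lemma probability_bigcup_bigcap_le d (T : measurableType d) (R : realType)
    (P : probability T R) (F : nat -> set T) (c : R) :
  (forall n, measurable (F n)) -> (forall n, P (F n) <= c%:E)%E ->
  measurable (\bigcup_N \bigcap_(n in [set n | (N <= n)%N]) F n) /\
  (P (\bigcup_N \bigcap_(n in [set n | (N <= n)%N]) F n) <= c%:E)%E.
Proof.
move=> mF Fc; set G := fun N : nat => \bigcap_(n in [set n | (N <= n)%N]) F n.
have mG N : measurable (G N) by apply: bigcap_measurable => //; exists N => /=.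
have mUG : measurable (\bigcup_N G N) by exact: bigcup_measurable.
split => //.
have GG : {homo G : n m / (n <= m)%N >-> (n <= m)%O}.
  by move=> n m nm; apply/subsetPset => x Gx k /= mk; apply: Gx; exact: leq_trans mk.
have cG := nondecreasing_cvg_mu (mu := P) mG mUG GG.
rewrite -(cvg_lim _ cG)//; apply: lime_le; first by apply/cvg_ex; eexists; exact: cG.
apply: nearW => N; apply: le_trans (Fc N) => /=.
by apply: le_measure; rewrite ?inE// => x; apply => /=.
Qed.

Section GridCover.
Context {R : realType} {d : nat}.
Implicit Types K : set 'rV[R]_d.+1.

Lemma grid_cell_dist (h : R) (x y : 'rV[R]_d.+1) i : 0 < h ->
  grid_cell h x = grid_cell h y -> `|x 0 i - y 0 i| < h.
Proof.
move=> h0 /rowP/(_ i); rewrite !mxE => E.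
have := floor_le (x 0 i / h); have := floorD1_gt (x 0 i / h).
have := floor_le (y 0 i / h); have := floorD1_gt (y 0 i / h).
rewrite -E; set k := Num.floor _; rewrite ltr_pdivrMr// ler_pdivlMr// => y1 y0.
rewrite ltr_pdivrMr// ler_pdivlMr// => x1 x0.
rewrite intrD mulrDl mul1r in x1 y1.
by rewrite ltr_norml; apply/andP; split; lra.
Qed.

(** The bound on duplicate-free lists of occupied cells yields a longest one, and a longest one
    misses no occupied cell. *)
Lemma finite_grid_cover K (h b : R) : 0 < h ->
  (forall t, uniq t -> (forall k, k \in t -> exists2 x, K x & grid_cell h x = k) ->
    (size t)%:R * h ^+ d.+1 <= b) ->
  exists t, [/\ uniq t, (size t)%:R * h ^+ d.+1 <= b &
    forall x, K x -> grid_cell h x \in t].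
Proof.
move=> h0 hb; have hd : 0 < h ^+ d.+1 by rewrite exprn_gt0.
pose Q (n : nat) := `[< exists t : seq 'rV[int]_d.+1, [/\ uniq t,
  forall k, k \in t -> exists2 x, K x & grid_cell h x = k & size t = n] >].
have Q0 : exists n, Q n by exists 0%N; apply/asboolP; exists [::].
have Qb n : Q n -> (n <= Num.truncn (b / h ^+ d.+1))%N.
  move=> /asboolP[t [ut Kt <-]]; have st := hb t ut Kt.
  have b0 : 0 <= b by apply: le_trans st; rewrite mulr_ge0 ?(ltW hd).
  by rewrite truncn_ge_nat ?divr_ge0 ?(ltW hd)// ler_pdivlMr.
case: (ex_maxnP Q0 Qb) => n /asboolP[t [ut Kt sn]] nmax.
exists t; split; [by []|exact: hb|move=> x Kx].
apply/negPn/negP => xt.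
have /nmax : Q n.+1.
  apply/asboolP; exists (grid_cell h x :: t); split; rewrite /= ?xt ?sn// => k.
  by rewrite inE => /predU1P[->|/Kt//]; exists x.
by rewrite ltnn.
Qed.

End GridCover.

Section PositiveImage.
Context {dO : measure_display} {Omega : measurableType dO} {R : realType}.
Variables (P : probability Omega R) (H : R) (d : nat) (B : R -> Omega -> 'rV[R]_d.+1).
Hypothesis H_gt0 : 0 < H.
Hypothesis B_fbm : fbm P `[0, 1] H B.
Let T := (R * 'rV[R]_d.+1)%type.
Variable mu : probability (borel T) R.
Variable K : set T.
Hypothesis K_measurable : measurable (K : set (borel T)).
Hypothesis K_compact : compact K.
Hypothesis K_time : forall p, K p -> 0 <= p.1 <= 1.

Lemma sqr_measure_le_overlap (h b : R) w : 0 < h ->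
  (forall t, uniq t ->
    (forall k, k \in t -> exists2 x, (path_field B w @` K) x & grid_cell h x = k) ->
    (size t)%:R * h ^+ d.+1 <= b) ->
  (mu K * mu K * (h ^+ d.+1)%:E <= b%:E * overlap B mu K h w)%E.
Proof.
move=> h0 hb; have [t [ut st tK]] := finite_grid_cover h0 hb.
have hd : 0 < h ^+ d.+1 by rewrite exprn_gt0.
pose F (k : 'rV[int]_d.+1) : set (borel T) := K `&` [set p | grid_cell h (path_field B w p) = k].
have mF k : measurable (F k).
  rewrite (_ : F k = K `&` \bigcap_(i in [set: 'I_d.+1])
      (fun p : borel T => path_field B w p 0 i) @^-1` `[(k 0 i)%:~R * h, (k 0 i + 1)%:~R * h[); last first.
    apply/seteqP; split => p [Kp pk]; split => //.
      by move=> i _ /=; rewrite in_itv/= -ler_pdivlMr// -ltr_pdivrMr// -pk mxE floor_le floorD1_gt.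
    apply/rowP => i; rewrite mxE; apply: floor_def.
    by have := pk i Logic.I; rewrite /= in_itv/= -ler_pdivlMr// -ltr_pdivrMr.
  apply: measurableI => //; apply: fin_bigcap_measurable => // i _.
  rewrite -[X in measurable X]setTI.
  apply: (@continuous_borel_measurable R T (fun p => path_field B w p 0 i)) => //.
  move=> p; apply: (@cvg_comp _ _ _ (path_field B w) (fun v : 'rV[R]_d.+1 => v 0 i) _
    (nbhs (path_field B w p))); first exact: (continuous_path_field B_fbm).
  exact: coord_continuous.
have := @measure_sqr_le_self_product _ _ R mu _ F t K
  (xsection (near_pairs B K h) w) mF ut.
have tF : trivIset [set` t] F by move=> i j _ _ [p [[_ /= <-] [_ /= <-]]].
move=> /(_ tF K_measurable) CS.
apply: (@le_trans _ _ ((size t)%:R%:E * overlap B mu K h w * (h ^+ d.+1)%:E)%E).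
  apply: lee_wpmul2r; first by rewrite lee_fin ltW.
  apply: CS.
  - by move=> p Kp; exists (grid_cell h (path_field B w p)) => //=; exact: (tK _ (ex_intro2 _ _ p Kp erefl)).
  - exact: measurable_xsection (measurable_near_pairs B_fbm K_measurable h).
  - move=> k _ [p q] [[Kp pk] [Kq qk]]; rewrite /xsection/= inE; split => //= i.
    by apply: grid_cell_dist => //; rewrite pk qk.
by rewrite muleAC -EFinM lee_wpmul2r.
Qed.

(** A null compact image occupies cells of small total volume at every small scale, which by
    [sqr_measure_le_overlap] forces a large overlap there. So the null event lies in the lower limit
    of the events F n, each of probability at most 1/2. *)
Lemma null_image_probability_le : (0 < mu K)%E ->
  (energy (@parabolic R d.+1 H) d.+1%:R mu < +oo)%E ->
  exists N, [/\ measurable N, (P N <= 2^-1%:E)%E &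
    [set w | lebesgue_rV (path_field B w @` K) = 0%E] `<=` N].
Proof.
move=> muK0; set I := energy _ _ _ => Ioo.
have I0 : (0 <= I)%E.
  apply: integral_ge0 => p _; apply: integral_ge0 => q _.
  by rewrite inve_ge0 lee_fin powR_ge0.
have Ifin : I \is a fin_num by rewrite ge0_fin_numE.
have muKfin : mu K \is a fin_num by exact: fin_num_measure.
pose a := fine (mu K); have aE : mu K = a%:E by rewrite fineK.
have a0 : 0 < a by rewrite -lte_fin -aE.
pose C := small_ball_cst (R := R) d.+1; have C0 : 0 <= C by exact: small_ball_cst_ge0.
have e0 : 0 <= fine I by rewrite fine_ge0.
(* Twice the bound on the expected overlap per unit of h^d, so that Markov's inequality gives 1/2;
   the added 1 keeps l positive in all cases. *)
pose l := 2 * (C * fine I) + 1.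
have l0 : 0 < l by rewrite ltr_wpDl// mulr_ge0// mulr_ge0.
(* Chosen so that c * l = a^2 / 2, which contradicts the lower bound a^2 when the overlap is below l
   * h^d. *)
pose c := a * a / (2 * l).
have c0 : 0 < c by rewrite divr_gt0 ?mulr_gt0.
pose h (n : nat) : R := n.+1%:R^-1.
have h0 n : 0 < h n by rewrite invr_gt0.
have hd n : 0 < h n ^+ d.+1 by rewrite exprn_gt0.
pose F n := [set w | ((l * h n ^+ d.+1)%:E <= overlap B mu K (h n) w)%E].
have mo n := measurable_overlap B_fbm mu K_measurable (h n).
have mF n : measurable (F n).
  have := emeasurable_fun_c_infty measurableT (mo n) (l * h n ^+ d.+1)%:E.
  by rewrite setTI.
have o0 n w : (0 <= overlap B mu K (h n) w)%E by exact: measure_ge0.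
have PF n : (P (F n) <= 2^-1%:E)%E.
  have lh : 0 < l * h n ^+ d.+1 by rewrite mulr_gt0.
  have := @le_integral_comp_abse _ _ _ P setT measurableT _ _ id
    (@measurable_id _ _ _) (fun r r0 => r0) (fun x y _ _ xy => xy) (mo n) lh.
  rewrite setTI; under eq_integral do rewrite gee0_abs//.
  rewrite (_ : [set x | _] = F n); last by apply/seteqP; split => w; rewrite /F/= gee0_abs.
  move=> /le_trans /(_ (integral_overlap_le H_gt0 B_fbm mu K_measurable K_time (h0 n))).
  rewrite -/I -(fineK Ifin) -EFinM -/C => PFn.
  have PFfin : P (F n) \is a fin_num by exact: fin_num_measure.
  pose x := fine (P (F n)); have xE : P (F n) = x%:E by rewrite fineK.
  have xh : (l * h n ^+ d.+1) * x <= C * h n ^+ d.+1 * fine I.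
    by rewrite -lee_fin EFinM -xE; exact: PFn.
  have xl : l * x <= C * fine I by rewrite -(ler_pM2r (hd n)) mulrAC [leRHS]mulrAC.
  rewrite xE lee_fin -(ler_pM2l l0); apply: (le_trans xl).
  by rewrite ler_pdivlMr// mulrC /l lerDl.
have [mN PN] := probability_bigcup_bigcap_le mF PF.
exists (\bigcup_N \bigcap_(n in [set n | (N <= n)%N]) F n); split => // w /= Lw.
have cK : compact (path_field B w @` K).
  apply: continuous_compact => //; apply: continuous_subspaceT.
  exact: (continuous_path_field B_fbm).
have [|e e00 he] := @lebesgue_rV_grid R d _ c cK; first by rewrite Lw lte_fin.
have [N Ne] := ltr_add_invr e00; rewrite add0r in Ne.
exists N => // n /= Nn; rewrite /F/= leNgt; apply/negP => on.
have hn : 0 < h n < e.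
  rewrite h0/=; apply: le_lt_trans Ne; rewrite /h lef_pV2 ?posrE// ler_nat//.
have := @sqr_measure_le_overlap (h n) c w (h0 n) (he _ hn).
rewrite aE -!EFinM leNgt => /negP; apply.
apply: (@le_lt_trans _ _ (c%:E * (l * h n ^+ d.+1)%:E)%E).
  by rewrite lee_wpmul2l ?lee_fin ?ltW.
rewrite -EFinM lte_fin (_ : c * _ = a * a * h n ^+ d.+1 / 2).
  by rewrite gtr_pMr ?invf_lt1 ?mulr_gt0//; lra.
by rewrite /c; field; rewrite gt_eqF.
Qed.

End PositiveImage.

Lemma coord_le_norm (R : realType) n (x : 'rV[R]_n) i : `|x 0 i| <= `|x|.
Proof.
rewrite [leRHS]/Num.Def.normr/= mx_normrE.
by apply: (@le_bigmax _ _ _ _ (fun ij : 'I_1 * 'I_n => `|x ij.1 ij.2|) (0, i)).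
Qed.

Section CapacityImage.
Context {dO : measure_display} {Omega : measurableType dO} {R : realType}.
Variables (P : probability Omega R) (H : R) (d : nat) (B : R -> Omega -> 'rV[R]_d.+1).
Hypothesis P_complete : measure_is_complete P.
Hypothesis H_gt0 : 0 < H.
Hypothesis B_fbm : fbm P `[0, 1] H B.
Variables (f : R -> 'rV[R]_d.+1) (E : set R).
Hypothesis f_bounded : [bounded f t | t in `[0, 1]].
Hypothesis f_borel : measurable_fun (`[0, 1] : set R) (f : R -> borel 'rV[R]_d.+1).
Hypothesis E_borel : measurable E.
Hypothesis E_sub : E `<=` `[0, 1].
Let T := (R * 'rV[R]_d.+1)%type.

Lemma path_field_graph w : [set B t w + f t | t in E] = path_field B w @` graph_on E f.
Proof.
have tE t : E t -> clamp01 t = t by move=> /E_sub; rewrite /= in_itv/= => /clamp01_id.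
apply/seteqP; split => [_ [t Et <-]|_ [_ [t Et <-] <-]].
  by exists (t, f t); [exists t|rewrite /path_field/= tE].
by exists t => //; rewrite /path_field/= tE.
Qed.

Lemma positive_capacity_image :
  let image w := [set B t w + f t | t in E] in
  (0 < capacity (@parabolic R d.+1 H) d.+1%:R (graph_on E f))%E ->
  measurable [set w | (0 < lebesgue_rV (image w))%E] /\
  (0 < P [set w | (0 < lebesgue_rV (image w))%E])%E.
Proof.
move=> image cap0.
have imE w : image w = path_field B w @` graph_on E f by exact: path_field_graph.
have mfi i : measurable_fun E (fun t => f t 0 i).
  apply: (@measurable_funS _ _ _ _ (`[0, 1]%classic : set R)) => //.
  apply: (@measurableT_comp _ _ _ _ _ _ (fun v : borel 'rV[R]_d.+1 => (v : 'rV[R]_d.+1) 0 i)) => //.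
  by apply: continuous_borel_measurable; exact: coord_continuous.
have anG := analytic_graph_on E_borel mfi.
have [M HM] : exists M, forall t, E t -> `|f t| <= M.
  have [M [_ HM]] := f_bounded; exists (M + 1) => t /E_sub tI.
  by apply: (HM (M + 1)) => //; rewrite ltrDl.
have /= := @compact_slab R d.+1 M.
set X := [set p | _] => -[cX clX].
have GX : graph_on E f `<=` X.
  move=> _ [t Et <-]; split => /=; first by have := E_sub Et; rewrite /= in_itv.
  by move=> i; rewrite -ler_norml (le_trans (coord_le_norm _ _))// HM.
have mpos : measurable [set w | (0 < lebesgue_rV (image w))%E].
  rewrite (_ : [set w | _] = [set w | (0 < lebesgue_rV (path_field B w @` graph_on E f))%E]).
    apply: (measurable_image_pos (P := P) (X := X)) => //.
    - exact: (continuous_path_field B_fbm).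
    - exact: (measurable_path_field B_fbm).
    - exact: separable_product.
  by apply/seteqP; split => w /=; rewrite imE.
split => //.
have [mu muG Emu] : exists2 mu : probability (borel T) R, mu.-negligible (~` graph_on E f) &
    (energy (@parabolic R d.+1 H) d.+1%:R mu < +oo)%E.
  have : (ereal_inf [set energy (@parabolic R d.+1 H) d.+1%:R mu |
      mu in [set mu : probability (borel T) R | mu.-negligible (~` graph_on E f)]] < +oo)%E.
    rewrite ltey; apply: contraTneq cap0 => capoo.
    by rewrite /capacity capoo invey ltxx.
  by move=> /ereal_inf_lt[_ [mu muG <-]] ?; exists mu.
have half1 : 2^-1 < 1 :> R by rewrite invf_lt1// ltr1n.
have [F [cF FG muF]] := inner_regular_analytic clX anG GX muG half1.
have mF : measurable (F : set (borel T)).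
  rewrite -[F]setCK; apply: measurableC.
  by apply: sub_sigma_algebra; exact: closed_openC.
have FX : F `<=` X by exact: subset_trans GX.
have cpF : compact F by exact: subclosed_compact cF cX FX.
have Ftime p : F p -> 0 <= p.1 <= 1 by move=> /FX[].
have muF0 : (0 < mu F)%E by apply: lt_le_trans muF; rewrite lte_fin.
have [N [mN PN LN]] := null_image_probability_le H_gt0 B_fbm mF cpF Ftime muF0 Emu.
apply: (@lt_le_trans _ _ (P (~` N))).
  rewrite probability_setC// sube_gt0; apply: le_lt_trans PN _.
  by rewrite lte_fin.
apply: le_measure; rewrite ?inE//; first exact: measurableC.
move=> w Nw /=; rewrite lt_neqAle lebesgue_rV_ge0 andbT eq_sym; apply/eqP => Lw.
apply: Nw; apply: LN => /=; apply/eqP; rewrite eq_le lebesgue_rV_ge0 andbT -Lw imE.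
by apply: le_lebesgue_rV; exact: image_subset.
Qed.

End CapacityImage.

(** * The upper bound *)

(** The contents grow as delta decreases to 0, so the one at scale 1 is at most the limit, which is
    0. *)
Lemma hausdorff_null_cover (R : realType) (T : Type) (X : set T) (rho : T -> T -> R)
    (beta : R) (G : set T) : hausdorff_measure X rho beta G = 0%E ->
  forall e : R, 0 < e -> exists (c : nat -> T) (r : nat -> R),
    [/\ forall n, 0 <= r n, G `<=` \bigcup_n rho_ball X rho (c n) (r n) &
     (\sum_(0 <= n <oo) ((2 * r n) `^ beta)%:E < e%:E)%E].
Proof.
move=> HG e e0; pose F delta := hausdorff_content X rho beta delta G.
have Fmono : {in Interval (BRight (0 : R)) +oo%O &,
    {homo F : n m / n <= m >-> (m <= n)%E}}.
  move=> x y _ _ xy; apply: ereal_inf_le_tmp => _ [c [r [Xr Gc ->]]].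
  exists c, r; split => // n; have [Xc /andP[r0 rx]] := Xr n.
  by rewrite r0 (le_trans rx).
have F1 : (F 1%R <= 0)%E.
  rewrite -HG /hausdorff_measure.
  have /cvg_lim -> // := @nonincreasing_at_right_cvge R F 0 +oo%O isT Fmono.
  by apply: ereal_sup_ubound; exists 1 => //=; rewrite in_itv/= ltr01.
have /ereal_inf_lt[_ [c [r [Xr Gc ->]]] Se] : (F 1%R < e%:E)%E.
  by apply: le_lt_trans F1 _; rewrite lte_fin.
by exists c, r; split => // n; have [_ /andP[]] := Xr n.
Qed.

(** The point y is the limit of its dyadic truncations J k / 2^k. Consecutive truncations differ by
    at most one mesh cell, so the increments sum to a geometric series, and continuity passes to the
    limit. *)
Lemma dyadic_chaining (R : realType) (g : R -> R) (th V y : R) :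
  continuous g -> 0 < th < 1 -> 0 <= V ->
  (forall k j, (j < 2 ^ k)%N ->
    `|g (j.+1%:R / 2 ^+ k) - g (j%:R / 2 ^+ k)| <= th ^+ k * V) ->
  0 <= y <= 1 -> `|g y - g 0| <= V / (1 - th).
Proof.
move=> cg /andP[th0 th1] V0 incr /andP[y0 y1].
have p2 k : 0 < 2 ^+ k :> R by rewrite exprn_gt0.
pose J k := Num.truncn (2 ^+ k * y).
have y2 k : 0 <= 2 ^+ k * y by rewrite mulr_ge0// ltW.
have JP k : (J k)%:R <= 2 ^+ k * y < (J k).+1%:R by exact: truncn_itv.
have Jle k : (J k <= 2 ^ k)%N.
  have /andP[Jy _] := JP k; rewrite -(ler_nat R) natrX (le_trans Jy)//.
  by rewrite ler_piMr// ltW.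
(* Refining the mesh either keeps the truncation or moves it by one cell of level k.+1. *)
have JS k : J k.+1 = (2 * J k)%N \/ J k.+1 = (2 * J k).+1.
  have /andP[a1 a2] := JP k; have /andP[b1 b2] := JP k.+1.
  have lo : (2 * J k < (J k.+1).+1)%N.
    rewrite -(ltr_nat R) natrM; apply: le_lt_trans b2.
    by rewrite exprS -mulrA ler_wpM2l.
  have hi : (J k.+1 < 2 * (J k).+1)%N.
    rewrite -(ltr_nat R) natrM; apply: le_lt_trans b1 _.
    by rewrite exprS -mulrA ltr_pM2l.
  lia.
have th10 : 0 < 1 - th by rewrite subr_gt0.
have part k : `|g ((J k)%:R / 2 ^+ k) - g 0| <= V * (1 - th ^+ k.+1) / (1 - th).
  elim: k => [|k IH].
    rewrite expr1 mulfK ?gt_eqF// expr0 divr1.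
    have := Jle 0%N; rewrite leq_eqVlt ltnS leqn0 => /orP[]/eqP ->; last by rewrite subrr normr0.
    by have := incr 0%N 0%N isT; rewrite !expr0 !divr1 mul1r.
  have step : `|g ((J k.+1)%:R / 2 ^+ k.+1) - g ((J k)%:R / 2 ^+ k)| <= th ^+ k.+1 * V.
    have half : (J k)%:R / 2 ^+ k = (2 * J k)%:R / 2 ^+ k.+1 :> R.
      by rewrite natrM exprS; field; rewrite gt_eqF.
    have := Jle k.+1; rewrite half; case: (JS k) => ->.
      by move=> _; rewrite subrr normr0 mulr_ge0// exprn_ge0// ltW.
    by move=> jk; exact: incr.
  rewrite (_ : V * (1 - th ^+ k.+2) / (1 - th) =
      th ^+ k.+1 * V + V * (1 - th ^+ k.+1) / (1 - th)); last first.
    by rewrite (exprS _ k.+1); field; rewrite gt_eqF.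
  rewrite -[X in `|X|](subrKA (g ((J k)%:R / 2 ^+ k))).
  by apply: le_trans (ler_normD _ _) _; exact: lerD.
have Jcvg : (J k)%:R / 2 ^+ k @[k --> \oo] --> y.
  apply: (@squeeze_cvgr _ _ _ _ (fun k => y - 2^-1 ^+ k) (cst y)).
  - apply: nearW => k; have /andP[a1 a2] := JP k.
    rewrite ler_pdivlMr// ler_pdivrMr// mulrBl exprVn mulVf ?gt_eqF//.
    by rewrite lerBlDr natr1 /= (mulrC y) (ltW a2) a1.
  - rewrite -[X in _ --> X]subr0; apply: cvgB; first exact: cvg_cst.
    by apply: cvg_expr; rewrite ger0_norm ?invr_ge0// invf_lt1// ltr1n.
  - exact: cvg_cst.
have gcvg : `|g ((J k)%:R / 2 ^+ k) - g 0| @[k --> \oo] --> `|g y - g 0|.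
  apply: cvg_norm; apply: cvgB; last exact: cvg_cst.
  exact: (cvg_comp _ _ Jcvg (@cg y)).
rewrite -(cvg_lim _ gcvg)//; apply: limr_le; first by apply/cvg_ex; eexists; exact: gcvg.
apply: nearW => k; apply: (le_trans (part k)).
rewrite ler_pM2r ?invr_gt0// ler_piMr//.
by rewrite gerBl exprn_ge0// ltW.
Qed.

Lemma nneseries_half_le (R : realType) (a : nat -> \bar R) (A : R) : 0 <= A ->
  (forall k, 0 <= a k <= (A * 2^-1 ^+ k)%:E)%E ->
  (\sum_(0 <= k <oo) a k <= (2 * A)%:E)%E.
Proof.
move=> A0 aA; apply: lime_le.
  by apply: is_cvg_nneseries => k _ _; case/andP: (aA k).
apply: nearW => n; apply: (@le_trans _ _ (\sum_(0 <= k < n) (A * 2^-1 ^+ k)%:E)%E).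
  by apply: lee_sum => k _; case/andP: (aA k).
rewrite sumEFin lee_fin.
have := @geometric_le_lim R n A 2^-1 A0; rewrite /series/=.
rewrite (_ : A / (1 - 2^-1) = 2 * A); last by field.
by apply; rewrite ?invr_gt0// ger0_norm ?invr_ge0// invf_lt1// ltr1n.
Qed.

(** * Moments of the chaining series *)

Section Chaining.
Context {dO : measure_display} {Omega : measurableType dO} {R : realType}.
Variables (P : probability Omega R) (H : R) (d : nat) (B : R -> Omega -> 'rV[R]_d.+1).
Hypothesis H_gt0 : 0 < H.
Hypothesis B_fbm : fbm P `[0, 1] H B.
Variables (q : nat) (i : 'I_d.+1).

(* 2^(-H/2): an increment over a mesh of length L/2^k has size L^H times the
   2k-th power of this ratio; one half of the decay bounds the maximum over the
   mesh, the other half pays for the 2^k mesh points. *)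
Definition chain_ratio : R := 2^-1 `^ (H / 2).
Local Notation th := chain_ratio.

Lemma chain_ratio_itv : 0 < th < 1.
Proof.
rewrite powR_gt0 ?invr_gt0//= [ltRHS](_ : 1 = 1 `^ (H / 2)); last by rewrite powR1.
by rewrite gt0_ltr_powR ?divr_gt0// ?nnegrE ?invr_ge0// invf_lt1// ltr1n.
Qed.

Lemma chain_ratio_scale (L : R) k : 0 <= L ->
  (L / 2 ^+ k) `^ H = L `^ H * th ^+ (2 * k).
Proof.
move=> L0; rewrite powRM ?invr_ge0 ?exprn_ge0//; congr (_ * _).
have powX (a c : R) n : 0 <= a -> (a ^+ n) `^ c = (a `^ c) ^+ n.
  move=> a0; rewrite -[in LHS]powR_mulrn//.
  rewrite -[RHS]powR_mulrn; last exact: powR_ge0.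
  rewrite -[LHS]powRrM.
  rewrite -[RHS]powRrM.
  rewrite mulrC.
  by [].
rewrite -exprVn powX ?invr_ge0// exprM; congr (_ ^+ _).
by rewrite -powX ?invr_ge0// -powR_mulrn ?invr_ge0// -powRrM; congr (_ `^ _); field.
Qed.

Definition mesh (u v : R) k (j : nat) : R := u + (v - u) * (j%:R / 2 ^+ k).

Definition chain_increment u v k j w : R :=
  B (clamp01 (mesh u v k j.+1)) w 0 i - B (clamp01 (mesh u v k j)) w 0 i.

(** If V is the 2q-th root of this sum, the weight of level k bounds each increment of that level by
    th^k * V, which is the hypothesis of [dyadic_chaining]. *)
Definition chain_sum u v w : \bar R :=
  (\sum_(0 <= k <oo) ((th ^- (k * (2 * q)))%:E *
    \sum_(j < 2 ^ k) (chain_increment u v k j w ^+ (2 * q))%:E))%E.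

Lemma even_pow_ge0 (x : R) : 0 <= x ^+ (2 * q).
Proof. by rewrite exprM exprn_ge0// sqr_ge0. Qed.

Lemma chain_term_ge0 u v k w : (0 <= (th ^- (k * (2 * q)))%:E *
    \sum_(j < 2 ^ k) (chain_increment u v k j w ^+ (2 * q))%:E)%E.
Proof.
have /andP[th0 _] := chain_ratio_itv.
rewrite mule_ge0//; first by rewrite lee_fin invr_ge0 exprn_ge0// ltW.
by apply: sume_ge0 => j _; rewrite lee_fin even_pow_ge0.
Qed.

Lemma chain_sum_ge0 u v w : (0 <= chain_sum u v w)%E.
Proof. by apply: nneseries_ge0 => k _ _; exact: chain_term_ge0. Qed.

Lemma measurable_chain_increment u v k j :
  measurable_fun setT (fun w => (chain_increment u v k j w ^+ (2 * q))%:E).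
Proof.
apply/measurable_EFinP; apply: measurable_funX.
by apply: measurable_funB; exact: measurable_path B_fbm _ _.
Qed.

Lemma measurable_chain_term u v k : measurable_fun setT (fun w =>
  ((th ^- (k * (2 * q)))%:E * \sum_(j < 2 ^ k) (chain_increment u v k j w ^+ (2 * q))%:E)%E).
Proof.
apply: emeasurable_funM => //; apply: emeasurable_sum => j.
exact: measurable_chain_increment.
Qed.

Lemma measurable_chain_sum u v : measurable_fun setT (chain_sum u v).
Proof.
apply: ge0_emeasurable_sum => [k w _ _|k _]; first exact: chain_term_ge0.
exact: measurable_chain_term.
Qed.

Lemma mesh_itv u v k j : 0 <= u -> u <= v -> v <= 1 -> (j <= 2 ^ k)%N ->
  0 <= mesh u v k j <= 1.
Proof.
move=> u0 uv v1 jk; have p2 : 0 < 2 ^+ k :> R by rewrite exprn_gt0.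
have vu : 0 <= v - u by rewrite subr_ge0.
rewrite addr_ge0 ?mulr_ge0 ?divr_ge0 ?(ltW p2)//=.
apply: (le_trans _ v1); rewrite -lerBrDl ler_piMr//.
by rewrite ler_pdivrMr// mul1r -natrX ler_nat.
Qed.

(** After the weight has cancelled half of the decay of the moments, the 2^k increments of level k
    contribute a multiple of (2 th^(2q))^k, at most 2^-k by the assumption on q. *)
Lemma integral_chain_sum_le u v : 0 <= u -> u <= v -> v <= 1 ->
  th ^+ (2 * q) <= 4^-1 ->
  (\int[P]_w chain_sum u v w <=
    (2 * (gaussian_moment_cst q * ((v - u) `^ H) ^+ (2 * q)))%:E)%E.
Proof.
move=> u0 uv v1 thq; have vu : 0 <= v - u by rewrite subr_ge0.
have /andP[th0 _] := chain_ratio_itv.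
rewrite integral_nneseries//; last 2 first.
- by move=> k; exact: measurable_chain_term.
- by move=> k w _; exact: chain_term_ge0.
set D := ((v - u) `^ H) ^+ (2 * q).
have D0 : 0 <= D by exact: even_pow_ge0.
apply: nneseries_half_le; first by rewrite mulr_ge0// gaussian_moment_cst_ge0.
move=> k; apply/andP; split; first by apply: integral_ge0 => w _; exact: chain_term_ge0.
have thk : 0 <= th ^- (k * (2 * q)) by rewrite invr_ge0 exprn_ge0// ltW.
rewrite ge0_integralZl//; last 2 first.
- by apply: emeasurable_sum => j; exact: measurable_chain_increment.
- by move=> w _; apply: sume_ge0 => j _; rewrite lee_fin even_pow_ge0.
rewrite ge0_integral_sum//; last 2 first.
- by move=> j; exact: measurable_chain_increment.
- by move=> j w _; rewrite lee_fin even_pow_ge0.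
have incr (j : 'I_(2 ^ k)) : (\int[P]_w (chain_increment u v k j w ^+ (2 * q))%:E <=
    (gaussian_moment_cst q * (D * th ^+ (2 * k) ^+ (2 * q)))%:E)%E.
  have s01 := mesh_itv u0 uv v1 (ltnW (ltn_ord j)).
  have t01 := mesh_itv u0 uv v1 (ltn_ord j).
  have [/(_ i) Bi _] := B_fbm.
  rewrite /chain_increment (clamp01_id s01) (clamp01_id t01).
  have [E0 V0] := fbm_increment H_gt0 Bi s01 t01.
  apply: le_trans (centered_moment_le q (fbm_gaussian Bi s01 t01) E0 V0) _.
  rewrite lee_fin ler_wpM2l ?gaussian_moment_cst_ge0//.
  have -> : mesh u v k j.+1 - mesh u v k j = (v - u) / 2 ^+ k.
    by rewrite /mesh -natr1; field; rewrite expf_neq0.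
  rewrite ger0_norm ?divr_ge0 ?exprn_ge0// chain_ratio_scale//.
  by rewrite -exprM exprMn.
apply: (@le_trans _ _ ((th ^- (k * (2 * q)))%:E *
    \sum_(j < 2 ^ k) (gaussian_moment_cst q * (D * th ^+ (2 * k) ^+ (2 * q)))%:E)%E).
  by apply: lee_wpmul2l; [rewrite lee_fin|apply: lee_sum => j _; exact: incr].
rewrite sumEFin sumr_const card_ord -EFinM lee_fin -[_ *+ _]mulr_natl.
set c : R := gaussian_moment_cst q.
rewrite [leLHS](_ : _ = c * D * (2 ^+ k * th ^+ (2 * q) ^+ k)); last first.
  rewrite natrX -!exprM (_ : 2 * k * (2 * q) = k * (2 * q) + k * (2 * q))%N; last by lia.
  by rewrite exprD (mulnC (2 * q)%N k); field; rewrite expf_neq0// gt_eqF.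
rewrite ler_wpM2l ?mulr_ge0 ?gaussian_moment_cst_ge0//.
rewrite -exprMn lerXn2r ?nnegrE ?mulr_ge0 ?exprn_ge0 ?invr_ge0 ?(ltW th0)//.
by rewrite (_ : 2^-1 = 2 * 4^-1) ?ler_wpM2l//; field.
Qed.

End Chaining.

Lemma exists_root (R : realType) (n : nat) (x : R) : (0 < n)%N -> 0 <= x ->
  exists2 y : R, 0 <= y & y ^+ n = x.
Proof.
move=> n0 x0; exists (x `^ n%:R^-1); first exact: powR_ge0.
by rewrite -powR_mulrn ?powR_ge0// -powRrM mulVf ?powRr1// pnatr_eq0 -lt0n.
Qed.

Lemma expr_addr_le (R : realFieldType) (n : nat) (x y : R) : 0 <= x -> 0 <= y ->
  (x + y) ^+ n <= 2 ^+ n * (x ^+ n + y ^+ n).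
Proof.
move=> x0 y0; wlog xy : x y x0 y0 / x <= y.
  by move=> W; have [/W|/ltW/W] := leP x y; last rewrite addrC [_ ^+ n + _]addrC; apply.
apply: (@le_trans _ _ ((2 * y) ^+ n)).
  by rewrite lerXn2r ?nnegrE ?addr_ge0 ?mulr_ge0// mulr_natl mulr2n lerD2r.
by rewrite exprMn ler_wpM2l ?exprn_ge0// lerDr exprn_ge0.
Qed.

(** The first term covers x <= r, the second x > r. It converts the moment of order 2q into one of
    order d at scale r. *)
Lemma expr_le_interpolate (R : realFieldType) (n p : nat) (x r : R) : (n <= p)%N ->
  0 <= x -> 0 < r -> x ^+ n <= r ^+ n + r ^+ n / r ^+ p * x ^+ p.
Proof.
move=> np x0 r0; have rn : 0 < r ^+ n by rewrite exprn_gt0.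
have [xr|rx] := leP x r.
  rewrite ler_wpDr//; first by rewrite mulr_ge0 ?divr_ge0 ?exprn_ge0 ?(ltW r0).
  by rewrite lerXn2r ?nnegrE// ltW.
rewrite ler_wpDl ?(ltW rn)// -(subnK np) !exprD.
rewrite (_ : r ^+ n / _ = (r ^+ (p - n))^-1); last by field; rewrite !expf_neq0 ?gt_eqF.
rewrite mulrA ler_peMl ?exprn_ge0// mulrC ler_pdivlMr ?exprn_gt0// mul1r.
by rewrite lerXn2r ?nnegrE ?(ltW r0) ?(ltW rx).
Qed.

Section Oscillation.
Context {dO : measure_display} {Omega : measurableType dO} {R : realType}.
Variables (P : probability Omega R) (H : R) (d : nat) (B : R -> Omega -> 'rV[R]_d.+1).
Hypothesis H_gt0 : 0 < H.
Hypothesis B_fbm : fbm P `[0, 1] H B.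
Variable q : nat.
Hypothesis q_gt0 : (0 < q)%N.
Local Notation th := (chain_ratio H).

Lemma oscillation_le i u v s w : 0 <= u -> v <= 1 -> u <= s <= v ->
  ((`|B s w 0 i - B u w 0 i| ^+ (2 * q))%:E <=
   ((1 - th) ^- (2 * q))%:E * chain_sum H B q i u v w)%E.
Proof.
move=> u0 v1 /andP[us sv]; have uv := le_trans us sv.
have /andP[th0 th1] := chain_ratio_itv H_gt0.
have th10 : 0 < 1 - th by rewrite subr_gt0.
have Kgt0 : 0 < (1 - th) ^- (2 * q) by rewrite invr_gt0 exprn_gt0.
have S0 := chain_sum_ge0 B H_gt0 q i u v w.
have [Soo|Snoo] := eqVneq (chain_sum H B q i u v w) +oo%E.
  by rewrite Soo gt0_muley ?leey// lte_fin.
have Sfin : chain_sum H B q i u v w \is a fin_num by rewrite ge0_fin_numE// ltey.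
pose W := fine (chain_sum H B q i u v w).
have WE : chain_sum H B q i u v w = W%:E by rewrite fineK.
have W0 : 0 <= W by rewrite -lee_fin -WE.
have q20 : (0 < 2 * q)%N by rewrite muln_gt0.
have [V V0 VW] := exists_root q20 W0.
rewrite WE -EFinM lee_fin -VW -exprVn -exprMn lerXn2r ?nnegrE ?mulr_ge0 ?invr_ge0 ?(ltW th10)//.
rewrite mulrC.
pose g y := B (clamp01 (u + (v - u) * y)) w 0 i.
pose y := (s - u) / (v - u).
have [vu|vu] := eqVneq v u.
  have -> : s = u by apply/eqP; rewrite eq_le us -vu sv.
  by rewrite subrr normr0 divr_ge0// ltW.
have vu0 : 0 < v - u by rewrite subr_gt0 lt_neqAle eq_sym vu.
have y01 : 0 <= y <= 1 by rewrite divr_ge0 ?subr_ge0//= ler_pdivrMr// mul1r lerD2r.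
have gs : g y = B s w 0 i.
  rewrite /g /y mulrC divfK ?gt_eqF// addrC subrK clamp01_id//.
  by rewrite (le_trans u0)// (le_trans sv).
have gu : g 0 = B u w 0 i by rewrite /g mulr0 addr0 clamp01_id// u0 (le_trans uv).
rewrite -gs -gu; apply: (dyadic_chaining _ _ V0 _ y01).
- move=> z; apply: (@cvg_comp _ _ _ (fun y => u + (v - u) * y)
    (fun t => B (clamp01 t) w 0 i) _ (nbhs (u + (v - u) * z))); last exact: (continuous_path B_fbm).
  by apply: cvgD; [exact: cvg_cst|apply: cvgM; [exact: cvg_cst|exact: cvg_id]].
- by rewrite th0.
move=> k j jk.
rewrite -(@ler_pXn2r _ (2 * q))// ?nnegrE ?mulr_ge0 ?exprn_ge0 ?(ltW th0)//.
rewrite [leRHS]exprMn VW -exprM.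
have kW : ((th ^- (k * (2 * q)))%:E *
    \sum_(j < 2 ^ k) (chain_increment B i u v k j w ^+ (2 * q))%:E <= W%:E)%E.
  rewrite -WE; apply: le_trans (nneseries_lim_ge k.+1 _); last first.
    by move=> l _ _; exact: chain_term_ge0.
  rewrite big_nat_recr//= leeDr//.
  by apply: sume_ge0 => l _; exact: chain_term_ge0.
move: kW; rewrite sumEFin -EFinM lee_fin mulrC ler_pdivrMr ?exprn_gt0// mulrC => kW.
apply: le_trans kW; rewrite (bigD1 (Ordinal jk))//= ler_wpDr//.
  by apply: sumr_ge0 => l _; exact: even_pow_ge0.
by rewrite /chain_increment -normrX ger0_norm ?even_pow_ge0.
Qed.

Variables (f : R -> 'rV[R]_d.+1) (E : set R).
Hypothesis E_sub : E `<=` `[0, 1].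
Hypothesis dq : (d.+1 <= 2 * q)%N.
Let T := (R * 'rV[R]_d.+1)%type.

Definition ball_image (c : T) (r : R) w : set 'rV[R]_d.+1 :=
  [set B s w + f s | s in [set s | E s /\
     rho_ball (@half_space R d.+1) (@parabolic R d.+1 H) c r (s, f s)]].

Definition time_start (c : T) (r : R) : R := clamp01 (c.1 - r `^ H^-1).
Definition time_end (c : T) (r : R) : R := clamp01 (c.1 + r `^ H^-1).

(** The image of a ball lies in a box of half-side D + r, where D bounds the oscillation of B. Its
    volume (2 (D + r))^d is at most 4^d (D^d + r^d), and D^d is interpolated between r^d and D^(2q),
    here replaced by its chaining bound; d stands for [d.+1]. *)
Definition ball_bound (c : T) (r : R) w : \bar R :=
  ((4 ^+ d.+1)%:E * ((2 * r ^+ d.+1)%:E + (r ^+ d.+1 / r ^+ (2 * q))%:E *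
    (((1 - th) ^- (2 * q))%:E *
      \sum_(i < d.+1) chain_sum H B q i (time_start c r) (time_end c r) w)))%E.

Lemma clamp01_homo : {homo @clamp01 R : x y / x <= y}.
Proof.
move=> x y xy; rewrite /clamp01 ge_max le_max lexx/= le_max.
by apply/orP; right; rewrite le_min !ge_min lexx/= xy orbT.
Qed.

Lemma time_itv c r s : E s ->
  rho_ball (@half_space R d.+1) (@parabolic R d.+1 H) c r (s, f s) ->
  time_start c r <= s <= time_end c r.
Proof.
move=> Es [_]; rewrite /= /parabolic gt_max/= => /andP[sr _].
have s01 : 0 <= s <= 1 by have := E_sub Es; rewrite /= in_itv.
have sc : `|s - c.1| <= r `^ H^-1.
  have H0 := gt_eqF H_gt0.
  rewrite -[leLHS](@powRr1 R)// -(@mulfV _ H) ?H0// powRrM.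
  by rewrite ge0_ler_powR ?nnegrE ?powR_ge0 ?invr_ge0 ?(ltW H_gt0) ?(ltW sr)// (le_trans _ (ltW sr))// powR_ge0.
move: sc; rewrite ler_norml => /andP[sc1 sc2].
rewrite -[s](clamp01_id s01) /time_start /time_end.
by apply/andP; split; apply: clamp01_homo; lra.
Qed.

Lemma lebesgue_rV_ball_image_le c r w : 0 <= r ->
  (lebesgue_rV (ball_image c r w) <= ball_bound c r w)%E.
Proof.
move=> r0.
have V0 : (0 <= \sum_(i < d.+1) chain_sum H B q i (time_start c r) (time_end c r) w)%E.
  by apply: sume_ge0 => i _; exact: chain_sum_ge0.
have /andP[th0 th1] := chain_ratio_itv H_gt0.
have K0 : 0 < (1 - th) ^- (2 * q) by rewrite invr_gt0 exprn_gt0// subr_gt0.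
have [r00|rN0] := eqVneq r 0.
  rewrite (_ : ball_image c r w = set0) ?lebesgue_rV0.
    rewrite /ball_bound mule_ge0// ?lee_fin ?exprn_ge0// adde_ge0 ?lee_fin ?mulr_ge0 ?exprn_ge0//.
    by rewrite mule_ge0 ?mule_ge0 ?lee_fin ?divr_ge0 ?exprn_ge0 ?(ltW K0).
  apply/seteqP; split => // y [s [Es [hs sr]] sy].
  by move: sr; rewrite /= r00 ltNge parabolic_ge0.
have rgt0 : 0 < r by rewrite lt_neqAle eq_sym rN0.
have rd := exprn_gt0 d.+1 rgt0; have rq := exprn_gt0 (2 * q) rgt0.
set V := (\sum_(i < d.+1) chain_sum _ _ _ _ _ _ _)%E in V0 *.
rewrite /ball_bound -/V.
have [Voo|Vnoo] := eqVneq V +oo%E.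
  rewrite Voo gt0_muley ?lte_fin// gt0_muley ?lte_fin ?divr_gt0// addey//.
  by rewrite gt0_muley ?leey// lte_fin exprn_gt0.
have Vfin : V \is a fin_num by rewrite ge0_fin_numE// ltey.
(* Since V sums the chaining series of all coordinates, the single number D bounds the oscillation
   of each. *)
have [D D0 DV] : exists2 D, 0 <= D & D ^+ (2 * q) = (1 - th) ^- (2 * q) * fine V.
  by apply: exists_root; rewrite ?muln_gt0// mulr_ge0 ?(ltW K0)// fine_ge0.
set u := time_start c r in V V0 Vnoo Vfin DV *; set v := time_end c r in V V0 Vnoo Vfin DV *.
pose m := B u w + c.2.
pose l : 'rV[R]_d.+1 := \row_i (m 0 i - (D + r)).
pose l' : 'rV[R]_d.+1 := \row_i (m 0 i + (D + r)).
have image_box : ball_image c r w `<=` closed_box l l'.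
  move=> _ [s [Es cs] <-] i; rewrite !mxE.
  have usv := time_itv Es cs.
  have [_] := cs; rewrite /= /parabolic gt_max => /andP[_ fr].
  have fri : `|c.2 0 i - f s 0 i| < r.
    apply: le_lt_trans fr; rewrite -[leLHS]ger0_norm// -sqrtr_sqr ler_wsqrtr//.
    rewrite (bigD1 i)//= real_normK ?num_real// !mxE lerDl.
    by apply: sumr_ge0 => j _; exact: sqr_ge0.
  have osc : `|B s w 0 i - B u w 0 i| <= D.
    rewrite -(@ler_pXn2r _ (2 * q)) ?muln_gt0 ?nnegrE// DV -lee_fin.
    have /andP[u0 _] := clamp01_itv (c.1 - r `^ H^-1).
    have /andP[_ v1] := clamp01_itv (c.1 + r `^ H^-1).
    apply: le_trans (oscillation_le i w u0 v1 usv) _.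
    rewrite EFinM fineK//; apply: lee_wpmul2l; first by rewrite lee_fin ltW.
    rewrite /V (bigD1 i)//= leeDl//.
    by apply: sume_ge0 => j _; exact: chain_sum_ge0.
  move: fri osc; rewrite ltr_norml ler_norml => /andP[a1 a2] /andP[b1 b2].
  by apply/andP; split; lra.
have Dr0 : 0 <= D + r by rewrite addr_ge0.
apply: le_trans (le_lebesgue_rV image_box) _.
have ll' i : l 0 i <= l' 0 i by rewrite !mxE lerD2l ge0_cp.
apply: le_trans (lebesgue_rV_closed_box ll') _.
rewrite -(fineK Vfin) -[X in (_ + _ * X)%E]EFinM -DV -[X in (_ + X)%E]EFinM.
rewrite -[X in (_ * X)%E]EFinD -[leRHS]EFinM lee_fin.
have -> : vol l l' = (2 * (D + r)) ^+ d.+1.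
  rewrite /vol -[in RHS](card_ord d.+1) -prodr_const.
  by apply: eq_bigr => i _; rewrite !mxE; ring.
rewrite exprMn.
have -> : 4 ^+ d.+1 = 2 ^+ d.+1 * 2 ^+ d.+1 :> R by rewrite -exprMn -natrM.
rewrite -mulrA ler_wpM2l ?exprn_ge0//.
apply: le_trans (expr_addr_le _ D0 r0) _; rewrite ler_wpM2l ?exprn_ge0//.
rewrite (_ : 2 * r ^+ d.+1 = r ^+ d.+1 + r ^+ d.+1); last by ring.
by rewrite -[leRHS]addrA [leLHS]addrC lerD2l; exact: expr_le_interpolate.
Qed.

End Oscillation.

(** * Expected volume of the covering boxes and almost sure nullity *)

Section NullImage.
Context {dO : measure_display} {Omega : measurableType dO} {R : realType}.
Variables (P : probability Omega R) (H : R) (d : nat) (B : R -> Omega -> 'rV[R]_d.+1).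
Hypothesis H_gt0 : 0 < H.
Hypothesis B_fbm : fbm P `[0, 1] H B.
Let T := (R * 'rV[R]_d.+1)%type.

(** The factor 2^H reflects a time span of at most 2 r^(1/H), whose H-th power is at most 2^H r. *)
Definition ball_bound_cst (q : nat) : R :=
  4 ^+ d.+1 * (2 + (1 - chain_ratio H) ^- (2 * q) *
    (d.+1%:R * (2 * (gaussian_moment_cst q * (2 `^ H) ^+ (2 * q))))).

Lemma ball_bound_cst_ge0 q : 0 <= ball_bound_cst q.
Proof.
have /andP[_ th1] := chain_ratio_itv H_gt0.
rewrite mulr_ge0 ?exprn_ge0// addr_ge0// mulr_ge0//.
  by rewrite invr_ge0 exprn_ge0// subr_ge0 ltW.
by rewrite mulr_ge0// mulr_ge0// mulr_ge0 ?gaussian_moment_cst_ge0// exprn_ge0// powR_ge0.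
Qed.

Lemma ball_bound_ge0 q (c : T) r w : 0 <= r -> (0 <= ball_bound H B q c r w)%E.
Proof.
move=> r0; have /andP[_ th1] := chain_ratio_itv H_gt0.
rewrite mule_ge0// ?lee_fin ?exprn_ge0// adde_ge0 ?lee_fin ?mulr_ge0 ?exprn_ge0//.
rewrite mule_ge0 ?lee_fin ?divr_ge0 ?exprn_ge0// mule_ge0//.
  by rewrite lee_fin invr_ge0 exprn_ge0// subr_ge0 ltW.
by apply: sume_ge0 => i _; exact: chain_sum_ge0.
Qed.

Lemma measurable_sum_chain_sum q u v :
  measurable_fun setT (fun w => \sum_(i < d.+1) chain_sum H B q i u v w)%E.
Proof. by apply: emeasurable_sum => i; exact: (measurable_chain_sum H_gt0 B_fbm). Qed.

Lemma measurable_ball_bound q (c : T) r : measurable_fun setT (ball_bound H B q c r).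
Proof.
apply: emeasurable_funM => //; apply: emeasurable_funD => //.
apply: emeasurable_funM => //; apply: emeasurable_funM => //.
exact: measurable_sum_chain_sum.
Qed.

Lemma clamp01_addr (x h : R) : 0 <= h -> clamp01 (x + h) <= clamp01 x + h.
Proof.
move=> h0; rewrite {1}/clamp01 ge_max; apply/andP; split.
  by rewrite addr_ge0//; have /andP[] := clamp01_itv x.
rewrite -lerBlDr /clamp01 le_max le_min; apply/orP; right; apply/andP; split.
  by rewrite lerBlDr ge_min lerDl h0.
by rewrite lerBlDr ge_min lexx orbT.
Qed.

Lemma time_length (c : T) (r : R) : 0 <= r ->
  (time_end H c r - time_start H c r) `^ H <= 2 `^ H * r.
Proof.
move=> r0; set rho := r `^ H^-1; have rho0 : 0 <= rho by exact: powR_ge0.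
have HV : rho `^ H = r by rewrite -powRrM mulVf ?powRr1// gt_eqF.
rewrite -[X in _ * X]HV -powRM//; apply: ge0_ler_powR; rewrite ?nnegrE ?mulr_ge0 ?(ltW H_gt0)//.
  rewrite subr_ge0; apply: clamp01_homo.
  by apply: (@le_trans _ _ c.1); rewrite ?gerBl ?lerDl.
rewrite lerBlDl /time_end /time_start -/rho.
rewrite (_ : c.1 + rho = c.1 - rho + 2 * rho); last by rewrite mulr_natl mulr2n -addrA addKr.
by apply: clamp01_addr; rewrite mulr_ge0.
Qed.

Lemma integral_ball_bound_le q (c : T) r : 0 <= r ->
  chain_ratio H ^+ (2 * q) <= 4^-1 ->
  (\int[P]_w ball_bound H B q c r w <= (ball_bound_cst q)%:E * ((2 * r) `^ d.+1%:R)%:E)%E.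
Proof.
move=> r0 thq; have /andP[_ th1] := chain_ratio_itv H_gt0.
set u := time_start H c r; set v := time_end H c r.
have rho0 : 0 <= r `^ H^-1 by exact: powR_ge0.
have /andP[u0 _] := clamp01_itv (c.1 - r `^ H^-1).
have /andP[_ v1] := clamp01_itv (c.1 + r `^ H^-1).
have uv : u <= v.
  by apply: clamp01_homo; apply: (@le_trans _ _ c.1); rewrite ?gerBl ?lerDl.
set K := (1 - chain_ratio H) ^- (2 * q).
have K0 : 0 <= K by rewrite invr_ge0 exprn_ge0// subr_ge0 ltW.
set g : R := gaussian_moment_cst q; have g0 : 0 <= g by exact: gaussian_moment_cst_ge0.
have mS := measurable_sum_chain_sum q u v.
have S0 w : (0 <= \sum_(i < d.+1) chain_sum H B q i u v w)%E.
  by apply: sume_ge0 => i _; exact: chain_sum_ge0.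
have rr0 : 0 <= r ^+ d.+1 / r ^+ (2 * q) by rewrite divr_ge0 ?exprn_ge0.
have intS : (\int[P]_w \sum_(i < d.+1) chain_sum H B q i u v w <=
    (d.+1%:R * (2 * (g * (2 `^ H * r) ^+ (2 * q))))%:E)%E.
  rewrite ge0_integral_sum//; last 2 first.
  - by move=> i; exact: (measurable_chain_sum H_gt0 B_fbm).
  - by move=> i w _; exact: chain_sum_ge0.
  apply: (@le_trans _ _ (\sum_(i < d.+1) (2 * (g * (2 `^ H * r) ^+ (2 * q)))%:E)%E).
    apply: lee_sum => i _.
    apply: le_trans (integral_chain_sum_le H_gt0 B_fbm i u0 uv v1 thq) _.
    rewrite lee_fin ler_wpM2l// ler_wpM2l// lerXn2r ?nnegrE ?powR_ge0 ?mulr_ge0 ?powR_ge0//.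
    exact: time_length.
  by rewrite sumEFin sumr_const card_ord -[_ *+ _]mulr_natl.
rewrite /ball_bound -/u -/v -/K.
rewrite ge0_integralZl//; last 2 first.
- by apply: emeasurable_funD => //; do 2 apply: emeasurable_funM => //.
- move=> w _; rewrite adde_ge0 ?lee_fin ?mulr_ge0 ?exprn_ge0//.
  by rewrite mule_ge0 ?lee_fin// mule_ge0 ?lee_fin.
rewrite ge0_integralD//; last 3 first.
- by move=> w _; rewrite lee_fin mulr_ge0 ?exprn_ge0.
- by move=> w _; rewrite mule_ge0 ?mule_ge0 ?lee_fin.
- by apply: emeasurable_funM => //; exact: emeasurable_funM.
rewrite integral_prob_cst ge0_integralZl//; last 2 first.
- exact: emeasurable_funM.
- by move=> w _; rewrite mule_ge0 ?lee_fin.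
rewrite ge0_integralZl//.
apply: (@le_trans _ _ ((4 ^+ d.+1)%:E * ((2 * r ^+ d.+1)%:E +
    (r ^+ d.+1 / r ^+ (2 * q))%:E * (K%:E *
    (d.+1%:R * (2 * (g * (2 `^ H * r) ^+ (2 * q))))%:E)))%E).
  apply: lee_wpmul2l; first by rewrite lee_fin exprn_ge0.
  by apply: leeD2l; do 2 (apply: lee_wpmul2l; first by rewrite lee_fin).
rewrite -[X in (_ + _ * X)%E]EFinM -[X in (_ + X)%E]EFinM.
rewrite -[X in (_ * X <= _)%E]EFinD -[leLHS]EFinM -[leRHS]EFinM lee_fin.
rewrite powR_mulrn ?mulr_ge0// /ball_bound_cst -/K -/g -[leRHS]mulrA ler_wpM2l ?exprn_ge0//.
apply: (@le_trans _ _ ((2 + K * (d.+1%:R * (2 * (g * (2 `^ H) ^+ (2 * q))))) * r ^+ d.+1)); last first.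
  rewrite ler_wpM2l//.
    by rewrite addr_ge0// mulr_ge0// mulr_ge0// mulr_ge0// mulr_ge0// exprn_ge0// powR_ge0.
  by rewrite lerXn2r ?nnegrE ?mulr_ge0// ler_peMl// ler1n.
rewrite [leRHS]mulrDl lerD2l (exprMn (2 * q) (2 `^ H) r).
set X := (2 `^ H) ^+ (2 * q); have X0 : 0 <= X by rewrite exprn_ge0// powR_ge0.
rewrite [leLHS](_ : _ = K * (d.+1%:R * (2 * (g * X))) * (r ^+ d.+1 / r ^+ (2 * q) * r ^+ (2 * q))); last by ring.
apply: ler_wpM2l; first by rewrite mulr_ge0// mulr_ge0// mulr_ge0// mulr_ge0.
have [->|r1] := eqVneq r 0; first by rewrite expr0n/= !mul0r.
by rewrite divfK// expf_neq0.
Qed.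

(** The order must be at least the dimension for the interpolation and large enough for the chaining
    series to converge; the ratio is below 1, so every large q serves. *)
Lemma exists_moment_order : exists q : nat,
  [/\ (0 < q)%N, (d.+1 <= 2 * q)%N & chain_ratio H ^+ (2 * q) <= 4^-1].
Proof.
have /andP[th0 th1] := chain_ratio_itv H_gt0.
have th1' : `|chain_ratio H| < 1 by rewrite ger0_norm// ltW.
have : \forall n \near \oo, chain_ratio H ^+ n < 4^-1.
  by apply: (cvgr_lt 0 (cvg_expr th1')); rewrite invr_gt0.
move=> [N _ HN]; exists (N + d.+1)%N; split; [lia|lia|].
by apply/ltW/HN => /=; lia.
Qed.

Variables (f : R -> 'rV[R]_d.+1) (E : set R).
Hypothesis E_sub : E `<=` `[0, 1].

(** Covers of arbitrarily small total make the outer integral of the measure of the image vanish. A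
    measurable hull of it then has integral 0 and is null almost everywhere, which settles the
    original function. *)
Lemma null_hausdorff_image :
  hausdorff_measure (@half_space R d.+1) (@parabolic R d.+1 H) d.+1%:R (graph_on E f) = 0%E ->
  {ae P, forall w, lebesgue_rV [set B t w + f t | t in E] = 0%E}.
Proof.
move=> HG; have [q [q0 dq thq]] := exists_moment_order.
pose L w := lebesgue_rV [set B t w + f t | t in E].
have L0 w : (0 <= L w)%E by exact: lebesgue_rV_ge0.
have outer_le e : 0 < e -> (outer_integral P L <= (ball_bound_cst q)%:E * e%:E)%E.
  move=> e0; have [c [r [r0 Gc Se]]] := hausdorff_null_cover HG e0.
  apply: (@le_trans _ _ (\int[P]_w \sum_(0 <= k <oo) ball_bound H B q (c k) (r k) w)%E).
    apply: ereal_inf_lbound => /=.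
    exists (fun w => \sum_(0 <= k <oo) ball_bound H B q (c k) (r k) w)%E => //; split.
      apply: ge0_emeasurable_sum => [k w _ _|k _]; first exact: ball_bound_ge0.
      exact: measurable_ball_bound.
    move=> w; apply: (@le_trans _ _ (lebesgue_rV (\bigcup_k ball_image H B f E (c k) (r k) w))).
      apply: le_lebesgue_rV => _ [t Et <-].
      have [k _ ctr] := Gc (t, f t) (ex_intro2 _ _ t Et erefl).
      by exists k => //; exists t.
    apply: le_trans (@lebesgue_rV_sigma_subadditive R d _) _.
    apply: lee_nneseries => [k _ _|k _]; first exact: lebesgue_rV_ge0.
    exact: (lebesgue_rV_ball_image_le H_gt0 B_fbm q0 f E_sub dq (c k) w (r0 k)).
  rewrite integral_nneseries//; last 2 first.
  - by move=> k; exact: measurable_ball_bound.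
  - by move=> k w _; exact: ball_bound_ge0.
  apply: (@le_trans _ _ (\sum_(0 <= k <oo) (ball_bound_cst q)%:E * ((2 * r k) `^ d.+1%:R)%:E)%E).
    apply: lee_nneseries => [k _ _|k _]; last exact: integral_ball_bound_le.
    by apply: integral_ge0 => w _; exact: ball_bound_ge0.
  rewrite nneseriesZl; last by move=> k _; rewrite lee_fin powR_ge0.
  by apply: lee_wpmul2l; [rewrite lee_fin ball_bound_cst_ge0|exact: ltW].
have outer0 : (outer_integral P L <= 0)%E.
  apply/lee_addgt0Pr => e e0; rewrite add0e.
  have C1 : 0 < ball_bound_cst q + 1 by rewrite ltr_wpDl// ball_bound_cst_ge0.
  apply: le_trans (outer_le (e / (ball_bound_cst q + 1)) _) _; first by rewrite divr_gt0.
  rewrite -EFinM lee_fin mulrCA ler_piMr ?(ltW e0)// ler_pdivrMr// mul1r lerDl//.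
have [h [mh Lh hI]] := outer_integral_hull P L0.
have h0 w : (0 <= h w)%E by apply: le_trans (Lh w).
have hI0 : (\int[P]_w `|h w| = 0)%E.
  apply/eqP; rewrite eq_le; apply/andP; split; last by apply: integral_ge0.
  by under eq_integral do rewrite gee0_abs//; rewrite hI.
have /(_ measurableT _ mh)[+ _] := @ae_eq_integral_abs _ _ _ P setT.
move=> /(_ hI0); apply: filterS => w /(_ Logic.I) /= hw.
by apply/eqP; rewrite eq_le L0 andbT -hw; exact: Lh.
Qed.

End NullImage.

Theorem corollary5p5 (R : realType) (dO : measure_display)
    (Omega : measurableType dO) (P : probability Omega R)
    (P_complete : measure_is_complete P)
    (d : nat) (d_gt0 : (0 < d)%N) (H : R) (H01 : 0 < H < 1)
    (B : R -> Omega -> 'rV[R]_d) (B_fbm : fbm P `[0, 1] H B)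
    (f : R -> 'rV[R]_d) (f_bounded : [bounded f t | t in `[0, 1]])
    (f_borel : measurable_fun (`[0, 1] : set R) (f : R -> borel 'rV[R]_d))
    (a b : R) (a_gt0 : 0 < a) (ab : a < b) (b_le1 : b <= 1)
    (E : set R) (E_borel : measurable E) (E_sub : E `<=` `[a, b]) :
  let image w := [set B t w + f t | t in E] in
  let rho := @parabolic R d H in
  ((0 < capacity rho d%:R (graph_on E f))%E ->
     measurable [set w | (0 < lebesgue_rV (image w))%E] /\
     (0 < P [set w | (0 < lebesgue_rV (image w))%E])%E) /\
  (hausdorff_measure (@half_space R d) rho d%:R (graph_on E f) = 0%E ->
     {ae P, forall w, lebesgue_rV (image w) = 0%E}).
Proof.
have E01 : E `<=` `[0, 1].
  move=> t /E_sub; rewrite /= !in_itv/= => /andP[at_ tb].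
  by rewrite (le_trans (ltW a_gt0) at_) (le_trans tb b_le1).
have /andP[H0 _] := H01.
case: d d_gt0 B B_fbm f f_bounded f_borel => // d _ B B_fbm f f_bounded f_borel image rho.
split; first exact: (positive_capacity_image P_complete H0 B_fbm f_bounded f_borel E_borel E01).
exact: (null_hausdorff_image H0 B_fbm E01).
Qed.
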